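(* Let $Q$ be a smooth manifold with $n:=\dim(Q)\ge1$, let $\mathbb{T}=\mathbb{Z}$ or $\mathbb{T}=\mathbb{R}$, and let $\Phi\colon Q\times\mathbb{T}\to Q$ be a $C^\infty$ dynamical system such that $Q$ is the basin of an attracting hyperbolic fixed point $x_0\in Q$. Assume that $D_{x_0}\Phi^1$ is semisimple (diagonalizable over $\mathbb{C}$) and that $(D_{x_0}\Phi^1,D_{x_0}\Phi^1)$ is $\infty$-nonresonant. Then there exists an $n$-tuple $\psi=(\psi_1,\dots,\psi_n)$ of $C^\infty$ principal eigenfunctions such that every $C^\infty$ Koopman eigenfunction $\varphi$ is a finite sum of scalar multiples of products of the $\psi_j$ and their complex conjugates $\bar\psi_j$: $$\varphi=\sum_{|\ell|+|m|\le k}c_{\ell,m}\,\psi^{[\ell]}\bar\psi^{[m]}$$ for some $k\in\mathbb{N}_{\ge0}$ and some coefficients $c_{\ell,m}\in\mathbb{C}$, where $\ell,m$ range over $\mathbb{N}_{\ge0}^n$.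
   Context: A dynamical system $\Phi\colon Q\times\mathbb{T}\to Q$ satisfies $\Phi^0=\mathrm{id}_Q$ and $\Phi^{t+s}=\Phi^t\circ\Phi^s$ for all $t,s\in\mathbb{T}$, where $\Phi^t:=\Phi(\cdot,t)$. That $Q$ is the basin of an attracting hyperbolic fixed point $x_0$ means: $x_0$ is fixed by all $\Phi^t$, is asymptotically stable, every point of $Q$ converges to $x_0$ as $t\to+\infty$, and no eigenvalue of $D_{x_0}\Phi^1$ has modulus $1$ (so all have modulus $<1$). $D_xF$ denotes the derivative of $F$ at $x$. A Koopman eigenfunction is a function $\psi\colon Q\to\mathbb{C}$, not identically zero, such that for some $\mu\in\mathbb{C}$ one has $\psi\circ\Phi^t=e^{\mu t}\psi$ for all $t\in\mathbb{T}$. A principal eigenfunction is a $C^1$ Koopman eigenfunction $\psi$ with $\psi(x_0)=0$ and $D_{x_0}\psi\ne0$. $\infty$-nonresonance: if $\lambda_1,\dots,\lambda_n$ are the eigenvalues of (the complexification of) $Y=D_{x_0}\Phi^1$ repeated with multiplicities, $(Y,Y)$ is $\infty$-nonresonant if $\lambda_i\ne\lambda_1^{m_1}\cdots\lambda_n^{m_n}$ for every $i$ and every $(m_1,\dots,m_n)\in\mathbb{N}_{\ge0}^n$ with $m_1+\cdots+m_n\ge2$. Multi-indices: for $i=(i_1,\dots,i_n)\in\mathbb{N}_{\ge0}^n$, $|i|:=i_1+\cdots+i_n$; $\psi^{[i]}:=\psi_1^{i_1}\cdots\psi_n^{i_n}$ (pointwise product) and $\bar\psi:=(\bar\psi_1,\dots,\bar\psi_n)$.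 *)

(* Defs.v *)
From mathcomp Require Import all_boot all_order all_algebra.
From mathcomp Require Import complex.
From mathcomp Require Import all_classical all_reals all_analysis.
Set Implicit Arguments.
Unset Strict Implicit.
Unset Printing Implicit Defensive.
Import Order.TTheory GRing.Theory Num.Theory numFieldNormedType.Exports.
Local Open Scope classical_set_scope.
Local Open Scope ring_scope.

(* On an open U in finite dimension this is the usual notion: the Fréchet
   derivative exists on U and all directional derivatives (equivalently, the
   partial derivatives) are of class C^(k-1).  The values of ['D_v f] outside U
   are irrelevant. *)
Fixpoint Ck_on (R : realType) (V W : normedModType R) (k : nat)
    (U : set V) (f : V -> W) : Prop :=
  if k is k'.+1 then
    (forall x, U x -> differentiable f x) /\
    (forall v : V, Ck_on k' U ('D_v f))
  else forall x, U x -> {for x, continuous f}.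

Definition smooth_on (R : realType) (V W : normedModType R)
    (U : set V) (f : V -> W) : Prop := forall k, Ck_on k U f.

(* [chart_inv] is only meaningful on the open set
   [chart_map @` chart_dom]. *)
Record chart (R : realType) (n : nat) (Q : topologicalType) := Chart {
  chart_dom : set Q;
  chart_map : Q -> 'rV[R]_n;
  chart_inv : 'rV[R]_n -> Q;
  chart_dom_open : open chart_dom;
  chart_img_open : open (chart_map @` chart_dom);
  chart_mapK : forall x, chart_dom x -> chart_inv (chart_map x) = x;
  chart_map_continuous :
    forall x, chart_dom x -> {for x, continuous chart_map};
  chart_inv_continuous :
    forall y, (chart_map @` chart_dom) y -> {for y, continuous chart_inv} }.

Definition chart_img (R : realType) (n : nat) (Q : topologicalType)
  (c : chart R n Q) : set 'rV[R]_n := chart_map c @` chart_dom c.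

(* The atlas need not be maximal.  The preferred chart [chart_at x] serves to
   identify the tangent space at x with R^n. *)
Record smooth_manifold (R : realType) (n : nat) := SmoothManifold {
  mfd_carrier :> topologicalType;
  mfd_hausdorff : hausdorff_space mfd_carrier;
  mfd_second_countable : @second_countable mfd_carrier;
  atlas : set (chart R n mfd_carrier);
  atlas_compatible : forall c d, atlas c -> atlas d ->
    smooth_on (chart_map c @` (chart_dom c `&` chart_dom d))
              (chart_map d \o chart_inv c);
  chart_at : mfd_carrier -> chart R n mfd_carrier;
  chart_at_atlas : forall x, atlas (chart_at x);
  chart_at_dom : forall x, chart_dom (chart_at x) x }.
Arguments atlas {R n} s _.

Definition smooth_map (R : realType) (m n : nat)
    (M : smooth_manifold R m) (N : smooth_manifold R n) (F : M -> N) : Prop :=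
  continuous F /\
  forall c d, atlas M c -> atlas N d ->
    smooth_on [set y | chart_img c y /\ chart_dom d (F (chart_inv c y))]
              (chart_map d \o F \o chart_inv c).

(* Joint smoothness of F : M * R -> N, in the product charts c * id. *)
Definition smooth_map_time (R : realType) (m n : nat)
    (M : smooth_manifold R m) (N : smooth_manifold R n)
    (F : M -> R -> N) : Prop :=
  continuous (fun p : M * R => F p.1 p.2) /\
  forall c d, atlas M c -> atlas N d ->
    smooth_on [set p : 'rV[R]_m * R |
                chart_img c p.1 /\ chart_dom d (F (chart_inv c p.1) p.2)]
              (fun p : 'rV[R]_m * R =>
                chart_map d (F (chart_inv c p.1) p.2)).

(* C-valued functions are treated as maps into R^2. *)
Definition Ck_fun (R : realType) (n : nat) (Q : smooth_manifold R n) (k : nat)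
    (psi : Q -> R[i]) : Prop :=
  forall c, atlas Q c ->
    Ck_on k (chart_img c) (fun y => complex.Re (psi (chart_inv c y))) /\
    Ck_on k (chart_img c) (fun y => complex.Im (psi (chart_inv c y))).

Definition smooth_fun (R : realType) (n : nat) (Q : smooth_manifold R n)
  (psi : Q -> R[i]) : Prop := forall k, Ck_fun k psi.

(* Matrix of D_x F in the preferred charts at x and F x.  It acts on row
   vectors from the right, i.e. it is the transpose of the usual Jacobian. *)
Definition mfd_deriv (R : realType) (m n : nat)
    (M : smooth_manifold R m) (N : smooth_manifold R n) (F : M -> N) (x : M) :
    'M[R]_(m, n) :=
  lin1_mx ('d (chart_map (chart_at (F x)) \o F \o chart_inv (chart_at x))
              (chart_map (chart_at x) x)).

(* D_x psi : T_x Q -> C, as an R-linear map read in the preferred chart at x. *)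
Definition fun_deriv (R : realType) (n : nat) (Q : smooth_manifold R n)
    (psi : Q -> R[i]) (x : Q) (v : 'rV[R]_n) : R[i] :=
  let c := chart_at x in
  Complex ('d (fun y => complex.Re (psi (chart_inv c y))) (chart_map c x) v)
          ('d (fun y => complex.Im (psi (chart_inv c y))) (chart_map c x) v).

Inductive time_kind := discrete_time | continuous_time.

Definition time (R : realType) (T : time_kind) : realDomainType :=
  match T with
  | discrete_time => int : realDomainType
  | continuous_time => R : realDomainType
  end.

Definition time_val (R : realType) (T : time_kind) : time R T -> R :=
  match T return time R T -> R with
  | discrete_time => fun t : int => t%:~R
  | continuous_time => fun t : R => t
  end.

Definition dynamical_system (R : realType) (T : time_kind) (Q : Type)
    (Phi : Q -> time R T -> Q) : Prop :=
  (forall x, Phi x 0 = x) /\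
  (forall t s x, Phi x (t + s) = Phi (Phi x s) t).

(* For discrete time, Q * Z is a disjoint union of copies of Q. *)
Definition smooth_system (R : realType) (n : nat) (Q : smooth_manifold R n)
    (T : time_kind) : (Q -> time R T -> Q) -> Prop :=
  match T return (Q -> time R T -> Q) -> Prop with
  | discrete_time => fun Phi : Q -> int -> Q =>
      forall t, smooth_map (fun x => Phi x t)
  | continuous_time => fun Phi : Q -> R -> Q => smooth_map_time Phi
  end.

Definition converges_to (R : realType) (T : time_kind) (Q : topologicalType)
    (Phi : Q -> time R T -> Q) (x x0 : Q) : Prop :=
  forall U, nbhs x0 U -> exists t0, forall t, t0 <= t -> U (Phi x t).

Definition lyapunov_stable (R : realType) (T : time_kind)
    (Q : topologicalType) (Phi : Q -> time R T -> Q) (x0 : Q) : Prop :=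
  forall U, nbhs x0 U -> exists2 V, nbhs x0 V &
    forall x t, V x -> 0 <= t -> U (Phi x t).

Definition asymptotically_stable (R : realType) (T : time_kind)
    (Q : topologicalType) (Phi : Q -> time R T -> Q) (x0 : Q) : Prop :=
  lyapunov_stable Phi x0 /\ \forall x \near x0, converges_to Phi x x0.

Definition complexify (R : realType) (n : nat) (A : 'M[R]_n) : 'M[R[i]]_n :=
  map_mx (real_complex R) A.

Definition time_one_deriv (R : realType) (n : nat) (Q : smooth_manifold R n)
    (T : time_kind) (Phi : Q -> time R T -> Q) (x0 : Q) : 'M[R]_n :=
  mfd_deriv (fun x => Phi x 1) x0.

Definition attracting_hyperbolic_basin (R : realType) (n : nat)
    (Q : smooth_manifold R n) (T : time_kind) (Phi : Q -> time R T -> Q)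
    (x0 : Q) : Prop :=
  [/\ forall t, Phi x0 t = x0,
      asymptotically_stable Phi x0,
      forall x, converges_to Phi x x0 &
      forall a, eigenvalue (complexify (time_one_deriv Phi x0)) a ->
                `|a| != 1].

(* Here lam lists the complex eigenvalues of Y with algebraic multiplicity. *)
Definition infty_nonresonant (R : realType) (n : nat) (Y : 'M[R]_n) : Prop :=
  forall lam : 'I_n -> R[i],
    char_poly (complexify Y) = \prod_(j < n) ('X - (lam j)%:P) ->
    forall (i : 'I_n) (m : 'I_n -> nat),
      (2 <= \sum_(j < n) m j)%N -> lam i <> \prod_(j < n) lam j ^+ m j.

Definition cexp (R : realType) (z : R[i]) : R[i] :=
  Complex (expR (complex.Re z) * cos (complex.Im z))
          (expR (complex.Re z) * sin (complex.Im z)).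

Definition koopman_eigenfunction (R : realType) (T : time_kind) (Q : Type)
    (Phi : Q -> time R T -> Q) (psi : Q -> R[i]) : Prop :=
  (exists x, psi x <> 0) /\
  exists mu : R[i], forall t x,
    psi (Phi x t) = cexp (mu * real_complex R (time_val t)) * psi x.

Definition principal_eigenfunction (R : realType) (n : nat)
    (Q : smooth_manifold R n) (T : time_kind) (Phi : Q -> time R T -> Q)
    (x0 : Q) (psi : Q -> R[i]) : Prop :=
  [/\ Ck_fun 1 psi, koopman_eigenfunction Phi psi, psi x0 = 0 &
      exists v, fun_deriv psi x0 v <> 0].

(* Multi-indices in N^n with entries at most k; those of length at most k are
   all of this form. *)
Definition multi_index (n k : nat) := {ffun 'I_n -> 'I_k.+1}.

Definition mi_length (n k : nat) (l : multi_index n k) : nat :=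
  (\sum_(j < n) l j)%N.

Definition mi_power (R : realType) (n k : nat) (Q : Type)
    (psi : 'I_n -> Q -> R[i]) (l : multi_index n k) (x : Q) : R[i] :=
  \prod_(j < n) psi j x ^+ l j.

(* Main.v *)
(* Let F be the time-one map in a chart centred at x0, with eigenvalues lam_j of
   modulus < 1 (stability and hyperbolicity).  Nonresonance lets one correct the
   linear eigenforms of D_0 F by words in them, which gives, for each N, a smooth
   germ P_j with P_j o F - lam_j P_j = O(|x|^N).  Once |lam_j|^-1 rho^N < 1, with rho
   the contraction rate of F, lam_j^-k (P_j o F^k) converges to a smooth
   eigenfunction near 0, which the basin property extends to psi_j on Q.
   If phi is an eigenfunction of the time-one map with factor L, its leading
   homogeneous part at x0 is a combination of words in the psi_j with eigenvalue L;
   subtracting that combination raises the order of vanishing of phi.  An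
   eigenfunction that vanishes to a high enough order is 0, so phi is a polynomial
   in the psi_j: their conjugates are never needed.  For T = R, psi_j o Phi^t -
   exp(mu_j t) psi_j is again an eigenfunction with factor lam_j, with zero
   differential at x0; by nonresonance it has no leading part, so it is 0. *)
From HB Require Import structures.
Require Import Defs.
From mathcomp Require Import all_boot all_order all_algebra.
From mathcomp Require Import complex.
From mathcomp Require Import all_classical all_reals all_analysis.
From mathcomp Require Import ring lra.
Set Implicit Arguments.
Unset Strict Implicit.
Unset Printing Implicit Defensive.
Import Order.TTheory GRing.Theory Num.Theory numFieldNormedType.Exports.
Local Open Scope classical_set_scope.
Local Open Scope ring_scope.

(** * Calculus of C^k functions and germs *)

Section Ck_calculus.
Variable R : realType.
Implicit Types V W : normedModType R.

(** Three obstacles shape the proof. First, the limit of [lam_j^-k P_j o F^k] must be smooth to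
    every order although N is fixed once and for all. Differentiation costs no order of vanishing if
    the differential of a germ is regarded as a function on the tangent bundle, where the fibre
    variable vanishes at the origin too; and the tangent map contracts at the same rate, its
    differential at 0 being two copies of D_0 F. The same N therefore serves all orders of
    differentiability. Second, hyperbolicity alone only excludes modulus 1; that unstable
    eigenvalues are absent has to be extracted from Lyapunov stability by a cone argument. Third, in
    continuous time the logarithm mu_j of lam_j is not arbitrary, since D Phi^t must scale the j-th
    form by exp(mu_j t) for every t. The mu_j are therefore eigenvalues of the generator of t -> D
    Phi^t, to which semisimplicity is first transferred from D Phi^1. Semisimplicity also makes
    composition with F diagonal, modulo higher order, on words in the eigenforms, so that the
    homological equations are solved by dividing coefficients by scalars. *)

Lemma differentiable_near_eq V W (f g : V -> W) x :
  (\near x, f x = g x) -> differentiable f x -> differentiable g x.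
Proof.
move=> fg df.
have fgx : f x = g x by exact: nbhs_singleton fg.
have fgs : \forall h \near (0 : V), f (h + x) = g (h + x).
  by move: fg; rewrite (near_shift 0 x) subr0.
have h : g \o shift x = cst (g x) + 'd f x +o_0 id.
  apply/eqaddoP => _ /posnumP[e]; near=> h.
  have -> : (g \o shift x - (cst (g x) + 'd f x)) h
         = (f \o shift x - (cst (f x) + 'd f x)) h.
    rewrite /= !fctE /= fgx; congr (_ - _).
    by apply: esym; near: h; exact: fgs.
  near: h.
  by have [_ /eqaddoP/(_ e%:num (gt0 e))] := (diff_locallyP _ _).1 df.
have dg := diff_unique (diff_continuous df) h.
by apply/diff_locallyP; rewrite dg; split => //; exact: diff_continuous.
Unshelve. all: by end_near.
Qed.

Lemma Ck_on_ext V W k (U : set V) (f g : V -> W) : open U ->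
  (forall x, U x -> f x = g x) -> Ck_on k U f -> Ck_on k U g.
Proof.
move=> oU; have nU x : U x -> \forall y \near x, U y.
  by move=> Ux; exact: open_nbhs_nbhs (conj oU Ux).
elim: k f g => [|k IH] f g fg /=.
  move=> cf x Ux.
  have fgx : {near x, f =1 g} by near=> y; apply: fg; near: y; exact: nU.
  rewrite /prop_for /continuous_at -fg //.
  apply: cvg_trans (cf x Ux).
  by apply: near_eq_cvg.
move=> [df Df]; split => [x Ux|v].
  apply: differentiable_near_eq (df x Ux).
  by near=> y; apply: fg; near: y; exact: nU.
apply: IH (Df v) => x Ux; apply: near_eq_derive.
by near=> y; apply: fg; near: y; exact: nU.
Unshelve. all: by end_near.
Qed.

Lemma Ck_on_sub V W k (U U' : set V) (f : V -> W) : U `<=` U' ->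
  Ck_on k U' f -> Ck_on k U f.
Proof.
move=> UU'; elim: k f => [|k IH] f /=; first by move=> h x /UU'; exact: h.
by move=> [h1 h2]; split=> [x /UU'|v]; [exact: h1|exact: IH].
Qed.

Lemma Ck_on_pred V W k (U : set V) (f : V -> W) :
  Ck_on k.+1 U f -> Ck_on k U f.
Proof.
elim: k f => [|k IH] f [df Df] /=.
  by move=> x Ux; apply: differentiable_continuous; exact: df.
by split=> // v; apply: IH.
Qed.

Lemma Ck_on_cst V W k (U : set V) (a : W) : Ck_on k U (cst a : V -> W).
Proof.
elim: k a => [|k IH] a /=; first by move=> x _; exact: cst_continuous.
split=> [x _|v]; first exact: differentiable_cst.
have -> : 'D_v (cst a : V -> W) = cst 0 by apply/funext => x; exact: derive_cst.
exact: IH.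
Qed.

Lemma Ck_onD V W k (U : set V) (f g : V -> W) : open U ->
  Ck_on k U f -> Ck_on k U g -> Ck_on k U (fun x => f x + g x).
Proof.
move=> oU; elim: k f g => [|k IH] f g /=.
  by move=> cf cg x Ux; apply: cvgD; [exact: cf|exact: cg].
move=> [df Df] [dg Dg]; split=> [x Ux|v].
  by apply: differentiableD; [exact: df|exact: dg].
apply: Ck_on_ext (IH _ _ (Df v) (Dg v)) => // x Ux.
by rewrite deriveD //; apply: diff_derivable; [exact: df|exact: dg].
Qed.

Lemma Ck_onM V k (U : set V) (f g : V -> R) : open U ->
  Ck_on k U f -> Ck_on k U g -> Ck_on k U (fun x => f x * g x).
Proof.
move=> oU; elim: k f g => [|k IH] f g.
  by move=> /= cf cg x Ux; apply: cvgM; [exact: cf|exact: cg].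
move=> Cf Cg; have [df Df] := Cf; have [dg Dg] := Cg; split=> [x Ux|v].
  by apply: differentiableM; [exact: df|exact: dg].
have := Ck_onD oU (IH _ _ (Ck_on_pred Cf) (Dg v)) (IH _ _ (Ck_on_pred Cg) (Df v)).
apply: Ck_on_ext => // x Ux.
by rewrite deriveM //; apply: diff_derivable; [exact: df|exact: dg].
Qed.

Lemma Ck_on_sum V I (s : seq I) k (U : set V) (f : I -> V -> R) : open U ->
  (forall i, Ck_on k U (f i)) -> Ck_on k U (fun x => \sum_(i <- s) f i x).
Proof.
move=> oU h; elim: s => [|i s IH].
  apply: Ck_on_ext (Ck_on_cst k U 0) => // x _; by rewrite big_nil.
by apply: Ck_on_ext (Ck_onD oU (h i) IH) => // x _; rewrite big_cons.
Qed.

Lemma differentiable_derivableD V W (f : V -> W) x v w a :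
  differentiable f x -> 'D_(a *: v + w) f x = a *: 'D_v f x + 'D_w f x.
Proof. by move=> df; rewrite !deriveE // linearP. Qed.



Lemma rV_coord_le m (x : 'rV[R]_m) j : `|x 0 j| <= `|x|.
Proof.
by rewrite [leRHS]/Num.Def.normr/= mx_normrE; exact: (le_bigmax _ _ (0, j)).
Qed.

Lemma rV_norm_le m (x : 'rV[R]_m) e : 0 <= e ->
  (forall j, `|x 0 j| <= e) -> `|x| <= e.
Proof.
move=> e0 h; rewrite [leLHS]/Num.Def.normr/= mx_normrE.
by apply: bigmax_le => // -[i j] _ /=; rewrite (ord1 i).
Qed.

Lemma rV_cvg (T : Type) (F : set_system T) (FF : Filter F) m
    (f : T -> 'rV[R]_m) (l : 'rV[R]_m) :
  (forall j, f t 0 j @[t --> F] --> l 0 j) -> f t @[t --> F] --> l.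
Proof.
move=> h; apply/cvgrPdist_le => /= e e0; near=> x.
apply: rV_norm_le => [|j]; first exact: ltW.
rewrite !mxE; move: j; near: x; apply: filter_forall => j.
exact: ((cvgrPdist_le _ _).1 (h j)).
Unshelve. all: by end_near.
Qed.

Lemma rV_differentiable V m (F : V -> 'rV[R]_m) x :
  (forall j, differentiable (fun y => F y 0 j) x) -> differentiable F x.
Proof.
move=> h; have -> : F = \sum_(j < m) (fun y => F y 0 j *: 'e_j).
  by apply/funext => y; rewrite fct_sumE -row_sum_delta.
by apply: differentiable_sum => j; exact: differentiableZl.
Qed.

Lemma derive_rV V m (F : V -> 'rV[R]_m) x v :
  (forall j, differentiable (fun y => F y 0 j) x) ->
  'D_v F x = \row_j 'D_v (fun y => F y 0 j) x.
Proof.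
move=> /rV_differentiable dF; rewrite derive_mx; last exact: diff_derivable.
by apply/rowP => j; rewrite !mxE.
Qed.

Lemma derive_comp V V' W (f : V' -> W) (F : V -> V') x v :
  differentiable F x -> differentiable f (F x) ->
  'D_v (f \o F) x = 'D_('D_v F x) f (F x).
Proof.
move=> dF df; rewrite (@deriveE _ _ _ (f \o F)); last exact: differentiable_comp.
by rewrite diff_comp // (@deriveE _ _ _ f (F x) _ df) (@deriveE _ _ _ F x _ dF).
Qed.

Lemma derive_sum_delta m W (f : 'rV[R]_m -> W) x v : differentiable f x ->
  'D_v f x = \sum_(j < m) v 0 j *: 'D_('e_j) f x.
Proof.
move=> df; rewrite deriveE // {1}(row_sum_delta v) linear_sum.
by apply: eq_bigr => j _; rewrite linearZ deriveE.
Qed.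

(** The chain rule in coordinates writes a directional derivative of [f \o F] as a sum of products
    of functions of one class less, so induction on the order suffices and no higher chain rule
    appears. *)
Lemma Ck_on_comp V m k (U : set V) (U' : set 'rV[R]_m) (f : 'rV[R]_m -> R)
    (F : V -> 'rV[R]_m) : open U -> open U' ->
  (forall x, U x -> U' (F x)) -> (forall j, Ck_on k U (fun x => F x 0 j)) ->
  Ck_on k U' f -> Ck_on k U (f \o F).
Proof.
move=> oU oU' UU'; elim: k f => [|k IH] f.
  move=> cF cf x Ux; apply: (@continuous_comp _ _ _ F f).
    by apply: rV_cvg => j; exact: cF.
  by apply: cf; exact: UU'.
move=> CF [df Df].
have dF x : U x -> differentiable F x.
  by move=> Ux; apply: rV_differentiable => j; exact: (CF j).1.
split=> [x Ux|v].
  by apply: differentiable_comp; [exact: dF|apply: df; exact: UU'].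
have C1 j : Ck_on k U (fun x => 'D_v (fun y => F y 0 j) x * 'D_('e_j) f (F x)).
  apply: Ck_onM => //; first exact: (CF j).2.
  by apply: (IH ('D_('e_j) f)) => [i|]; [exact: Ck_on_pred|exact: Df].
apply: Ck_on_ext (Ck_on_sum (index_enum 'I_m) oU C1) => // x Ux.
rewrite derive_comp; [|exact: dF|by apply: df; exact: UU'].
rewrite derive_sum_delta; last by apply: df; exact: UU'.
apply: eq_bigr => j _; rewrite derive_rV ?mxE // => i.
exact: (CF i).1.
Qed.

(** Needed beside [Ck_on_comp] because the target of the inner map may be any normed module, such as
    the product of space and time. The derivative along [v] is again ['D_(l v) f] after the same
    affine map, so the induction closes. *)
Lemma Ck_on_affine V V' W k (U : set V') (f : V' -> W)
    (l : {linear V -> V'}) (b : V') : open U -> continuous l ->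
  Ck_on k U f -> Ck_on k [set x | U (l x + b)] (fun x => f (l x + b)).
Proof.
move=> oU cl.
have cA : continuous (fun x => l x + b).
  by move=> x; apply: cvgD; [exact: cl|exact: cvg_cst].
have oP : open [set x | U (l x + b)] by exact: ((continuousP _).1 cA).
elim: k f => [|k IH] f /=.
  move=> cf x Ux; apply: (@continuous_comp _ _ _ (fun x => l x + b) f) => //.
    exact: cA.
  exact: cf.
move=> [df Df].
have dA x : differentiable (fun x => l x + b) x.
  apply: (@differentiableD _ _ _ l (cst b)) => //.
  exact: linear_differentiable.
split=> [x Ux|v].
  apply: (@differentiable_comp _ _ _ _ (fun x => l x + b) f) => //.
  exact: df.
apply: Ck_on_ext (IH _ (Df (l v))) => // x Ux.
have /= -> := @derive_comp _ _ _ f (fun x => l x + b) x v (dA x) (df _ Ux).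
congr ('D_ _ f _).
rewrite (@deriveD _ _ _ l (cst b)) ?derive_cst ?addr0.
- by rewrite deriveE ?diff_lin //; exact: linear_differentiable.
- by apply: diff_derivable; exact: linear_differentiable.
- exact: derivable_cst.
Qed.

Lemma differentiable_eps V W (f : V -> W) x : differentiable f x ->
  forall e : R, 0 < e -> exists2 d : R, 0 < d &
    forall h, `|h| < d -> `|f (x + h) - f x - 'D_h f x| <= e * `|h|.
Proof.
move=> df e e0.
have [_ /eqaddoP/(_ e e0)/nbhs_normP[d d0 hd]] := (diff_locallyP _ _).1 df.
exists d => // h hlt; have := hd h; rewrite /= sub0r normrN => /(_ hlt).
by rewrite !fctE /= opprD addrA [h + x]addrC deriveE.
Qed.

Lemma eps_differentiable V W (f : V -> W) (df : {linear V -> W}) x :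
  continuous df ->
  (forall e : R, 0 < e -> exists2 d : R, 0 < d &
    forall h, `|h| < d -> `|f (x + h) - f x - df h| <= e * `|h|) ->
  differentiable f x /\ forall v, 'D_v f x = df v.
Proof.
move=> cdf H.
have h : f \o shift x = cst (f x) + df +o_0 id.
  apply/eqaddoP => e e0; have [d d0 hd] := H e e0.
  apply/nbhs_normP; exists d => // h; rewrite /= sub0r normrN => hlt.
  by rewrite !fctE /= opprD addrA [h + x]addrC; exact: hd.
have E := diff_unique cdf h.
have dfx : differentiable f x by apply/diff_locallyP; rewrite E; split.
by split => // v; rewrite deriveE // E.
Qed.

Lemma MVT_line V (f : V -> R) x v :
  (forall t : R, 0 <= t <= 1 -> differentiable f (x + t *: v)) ->
  exists2 t : R, 0 <= t <= 1 & f (x + v) - f x = 'D_v f (x + t *: v).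
Proof.
move=> df; pose g (t : R) := f (x + t *: v).
have dl (t : R) : is_diff t (fun t : R => x + t *: v) ( *:%R^~ v).
  by apply: is_diff_eq; rewrite add0r.
have dg (t : R) : 0 <= t <= 1 -> differentiable g t.
  move=> t01; apply: (@differentiable_comp _ _ _ _ (fun t : R => x + t *: v) f).
    exact: ex_diff.
  exact: df.
have Dg (t : R) : 0 <= t <= 1 -> 'D_1 g t = 'D_v f (x + t *: v).
  move=> t01.
  have := @derive_comp _ _ _ f (fun t : R => x + t *: v) t 1.
  rewrite /comp => -> //; last exact: df.
  by rewrite (@deriveE _ _ _ (fun t : R => x + t *: v)) // diff_val scale1r.
have [| |t] := @MVT_segment R g (fun t => 'D_v f (x + t *: v)) 0 1 ler01.
- move=> t; rewrite in_itv /= => /andP[t0 t1].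
  have t01 : 0 <= t <= 1 by rewrite !ltW.
  by rewrite -Dg //; apply: derivableP; exact: diff_derivable (dg _ t01).
- apply: continuous_in_subspaceT => t; rewrite inE /= in_itv /= => t01.
  exact: differentiable_continuous (dg _ t01).
rewrite in_itv /= => t01; rewrite subr0 mulr1 /g scale1r scale0r addr0 => E.
by exists t.
Qed.

Lemma differentiable_shift V W (f : V -> W) x b :
  differentiable f (x + b) -> differentiable (fun y => f (y + b)) x.
Proof.
move=> df; exact: (@differentiable_comp _ _ _ _ (fun y => y + b) f).
Qed.

Lemma derive_shift_arg V W (f : V -> W) x b v :
  'D_v (fun y => f (y + b)) x = 'D_v f (x + b).
Proof.
by rewrite /derive /comp /=; under eq_fun do rewrite -addrA.
Qed.

Lemma deriveZ_dir V W (f : V -> W) x a v : differentiable f x ->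
  'D_(a *: v) f x = a *: 'D_v f x.
Proof. by move=> df; rewrite !deriveE // linearZ. Qed.

(* [D_u D_v f x] is the limit of second differences along the square spanned by
   [s u] and [s v]; only the differentiability of [D_v f] at [x] is needed. *)
Lemma second_difference V (f : V -> R) (U : set V) x u v : open U -> U x ->
  (forall y, U y -> differentiable f y) -> differentiable ('D_v f) x ->
  forall e : R, 0 < e -> exists2 d : R, 0 < d & forall s : R, 0 < s < d ->
   `|f (x + s *: u + s *: v) - f (x + s *: u) - f (x + s *: v) + f x
     - s ^+ 2 * 'D_u ('D_v f) x| <= e * s ^+ 2.
Proof.
move=> oU Ux df ddf e e0.
(* Points of the square are within [s * N] of [x]; the summand 1 keeps [N] positive when both
   directions are zero. *)
pose N := `|u| + `|v| + 1.
have N0 : 0 < N by rewrite /N -addrA ltr_wpDl // ltr_wpDl.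
have [d1 d10 h1] := differentiable_eps ddf (divr_gt0 e0 (mulr_gt0 (ltr0n _ 2) N0)).
have /nbhs_normP[d2 d20 h2] := open_nbhs_nbhs (conj oU Ux).
exists (Num.min d1 d2 / N); first by rewrite divr_gt0 // lt_min d10 d20.
move=> s /andP[s0]; rewrite ltr_pdivlMr // lt_min => /andP[sd1 sd2].
have small (a b : R) : 0 <= a <= 1 -> 0 <= b <= 1 ->
    `|a *: (s *: u) + b *: (s *: v)| <= s * N.
  move=> /andP[a0 a1] /andP[b0 b1]; apply: le_trans (ler_normD _ _) _.
  rewrite !normrZ !ger0_norm ?(ltW s0) // /N !mulrDr mulr1 -addrA.
  apply: lerD; first by rewrite ler_piMl // mulr_ge0 // ltW.
  by rewrite ler_wpDr ?(ltW s0) // ler_piMl // mulr_ge0 // ltW.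
have inU (a b : R) : 0 <= a <= 1 -> 0 <= b <= 1 ->
    U (x + (a *: (s *: u) + b *: (s *: v))).
  move=> a01 b01; apply: h2 => /=; rewrite opprD addrA subrr add0r normrN.
  exact: le_lt_trans (small _ _ a01 b01) sd2.
have z01 : 0 <= (0 : R) <= 1 by rewrite lexx ler01.
have o01 : 0 <= (1 : R) <= 1 by rewrite lexx ler01.
have dUu (t : R) : 0 <= t <= 1 -> differentiable f (x + t *: (s *: v) + s *: u).
  move=> t01; apply: df; have := inU _ _ o01 t01.
  by rewrite scale1r [s *: u + _]addrC addrA.
have dU0 (t : R) : 0 <= t <= 1 -> differentiable f (x + t *: (s *: v)).
  by move=> t01; apply: df; have := inU _ _ z01 t01; rewrite scale0r add0r.
(* The second difference is the increment along [s *: v] of the first difference along [s *: u], so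
   one mean value theorem turns it into a difference of two values of ['D_v f]. *)
have [|t t01] := @MVT_line V (fun y => f (y + s *: u) - f y) x (s *: v).
  move=> t t01; apply: differentiableB; last exact: dU0.
  by apply: differentiable_shift; exact: dUu.
rewrite (@deriveB _ _ _ (fun y => f (y + s *: u)) f); last 2 first.
- by apply: diff_derivable; apply: differentiable_shift; exact: dUu.
- by apply: diff_derivable; exact: dU0.
rewrite derive_shift_arg !deriveZ_dir; [|exact: dU0|exact: dUu].
rewrite -scalerBr => E.
have -> : f (x + s *: u + s *: v) - f (x + s *: u) - f (x + s *: v) + f x
  = s * ('D_v f (x + t *: (s *: v) + s *: u) - 'D_v f (x + t *: (s *: v))).
  rewrite -[RHS]E [x + s *: v + _]addrAC.
  by move: (f _) (f _) (f _) (f _); clear; move=> a b c d; ring.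
set p := t *: (s *: v) + s *: u; set q := t *: (s *: v).
have := h1 p; have := h1 q.
have pN : `|p| <= s * N.
  by rewrite /p addrC -[s *: u]scale1r; exact: small.
have qN : `|q| <= s * N.
  by have := small _ _ z01 t01; rewrite scale0r add0r.
move=> /(_ (le_lt_trans qN sd1)) hq /(_ (le_lt_trans pN sd1)) hp.
have Dpq : 'D_p ('D_v f) x - 'D_q ('D_v f) x = s * 'D_u ('D_v f) x.
  by rewrite !deriveE // -linearB /p addrAC subrr add0r linearZ.
rewrite -addrA -/p.
have -> : s * ('D_v f (x + p) - 'D_v f (x + q)) - s ^+ 2 * 'D_u ('D_v f) x
   = s * (('D_v f (x + p) - 'D_v f x - 'D_p ('D_v f) x)
      - ('D_v f (x + q) - 'D_v f x - 'D_q ('D_v f) x)).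
  rewrite expr2 -mulrA -Dpq.
  move: ('D_v f (x + p)) ('D_v f (x + q)) ('D_p _ x) ('D_q _ x) ('D_v f x).
  by clear; move=> a b c d g; ring.
rewrite normrM gtr0_norm // expr2 mulrCA ler_pM2l //.
apply: le_trans (ler_normB _ _) _; apply: le_trans (lerD hp hq) _.
rewrite -mulrDr -ler_pdivlMl ?divr_gt0 ?mulr_gt0 //.
apply: le_trans (lerD pN qN) _.
rewrite invf_div -[X in X <= _]mul1r -[X in X <= _]mulr1.
rewrite [X in X <= _](_ : _ = 2 * N / e * (e * s)) //.
by field; rewrite gt_eqF.
Qed.

(** The second difference is symmetric in [u] and [v], and both mixed derivatives are its limit
    after division by the square of the step. *)
Lemma derive_comm V (f : V -> R) (U : set V) x u v : open U ->
  Ck_on 2 U f -> U x -> 'D_u ('D_v f) x = 'D_v ('D_u f) x.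
Proof.
move=> oU [df Df] Ux; apply/eqP; rewrite -subr_eq0 -normr_eq0 eq_le normr_ge0 andbT.
apply/ler_addgt0Pr => e e0; rewrite add0r.
have e20 : 0 < e / 2 by rewrite divr_gt0.
have [d1 d10 h1] := second_difference u oU Ux df ((Df v).1 x Ux) e20.
have [d2 d20 h2] := second_difference v oU Ux df ((Df u).1 x Ux) e20.
pose s := Num.min d1 d2 / 2.
have s0 : 0 < s by rewrite divr_gt0 // lt_min d10 d20.
have slt : s < Num.min d1 d2 by rewrite ltr_pdivrMr // ltr_pMr ?ltr1n // lt_min d10 d20.
move: slt; rewrite lt_min => /andP[sd1 sd2].
have := h1 s; rewrite s0 sd1 => /(_ isT); rewrite distrC => H1.
have := h2 s; rewrite s0 sd2 => /(_ isT) H2.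
have s20 : 0 < s ^+ 2 by rewrite exprn_gt0.
rewrite -(ler_pM2r s20).
rewrite -{1}(gtr0_norm s20) -normrM.
have -> : e * s ^+ 2 = e / 2 * s ^+ 2 + e / 2 * s ^+ 2 by field.
apply: le_trans (lerD H1 H2); apply: le_trans (ler_normD _ _).
rewrite [x + s *: v + _]addrAC.
set Z := (X in _ <= `|X|); suff -> : ('D_u ('D_v f) x - 'D_v ('D_u f) x) * s ^+ 2 = Z by [].
rewrite /Z; move: (f _) (f _) (f _) (f _) (s ^+ 2) ('D_u _ x) ('D_v _ x).
by clear; move=> a b c d g h i; ring.
Qed.

(** * Smooth germs and their order of vanishing *)

Definition smooth_near V W (f : V -> W) (x : V) :=
  exists U, [/\ open U, U x & smooth_on U f].

Lemma smooth_near_ext V W (f g : V -> W) x : (\near x, f x = g x) ->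
  smooth_near f x -> smooth_near g x.
Proof.
rewrite /prop_near1 nbhsE => -[U' [oU' U'x] fg] [U [oU Ux sf]].
exists (U `&` U'); split; [exact: openI|by []|] => k.
apply: (Ck_on_ext (f := f)); first exact: openI.
  by move=> y [_ /fg].
by apply: Ck_on_sub (sf k) => y [].
Qed.

Lemma smooth_near_cst V W (a : W) (x : V) : smooth_near (cst a) x.
Proof. by exists setT; split => //; [exact: openT|move=> k; exact: Ck_on_cst]. Qed.

Lemma smooth_nearD V W (f g : V -> W) x : smooth_near f x -> smooth_near g x ->
  smooth_near (fun y => f y + g y) x.
Proof.
move=> [U [oU Ux sf]] [U' [oU' U'x sg]]; have oUU' := openI oU oU'.
exists (U `&` U'); split => // k; apply: Ck_onD => //.
  by apply: Ck_on_sub (sf k) => y [].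
by apply: Ck_on_sub (sg k) => y [].
Qed.

Lemma smooth_nearM V (f g : V -> R) x : smooth_near f x -> smooth_near g x ->
  smooth_near (fun y => f y * g y) x.
Proof.
move=> [U [oU Ux sf]] [U' [oU' U'x sg]]; have oUU' := openI oU oU'.
exists (U `&` U'); split => // k; apply: Ck_onM => //.
  by apply: Ck_on_sub (sf k) => y [].
by apply: Ck_on_sub (sg k) => y [].
Qed.

Lemma smooth_nearZ V (a : R) (f : V -> R) x : smooth_near f x ->
  smooth_near (fun y => a * f y) x.
Proof. by move=> sf; apply: smooth_nearM => //; exact: smooth_near_cst. Qed.

Lemma smooth_nearB V (f g : V -> R) x : smooth_near f x -> smooth_near g x ->
  smooth_near (fun y => f y - g y) x.
Proof.
move=> sf sg; have := smooth_nearD sf (smooth_nearZ (-1) sg).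
by apply: smooth_near_ext; near=> y; rewrite mulN1r.
Unshelve. all: by end_near.
Qed.

Lemma smooth_near_sum V I (s : seq I) (f : I -> V -> R) x :
  (forall i, smooth_near (f i) x) -> smooth_near (fun y => \sum_(i <- s) f i y) x.
Proof.
move=> sf; elim: s => [|i s IH].
  by under eq_fun do rewrite big_nil; exact: smooth_near_cst.
by under eq_fun do rewrite big_cons; exact: smooth_nearD.
Qed.

Lemma smooth_near_coord m j (x : 'rV[R]_m) :
  smooth_near (fun y : 'rV[R]_m => y 0 j) x.
Proof.
exists setT; split; [exact: openT|by []|] => -[|k] /=.
  by move=> y _; exact: coord_continuous.
split=> [y _|v]; first exact: differentiable_coord.
have -> : 'D_v (fun y : 'rV[R]_m => y 0 j) = cst (v 0 j).
  apply/funext => y; rewrite -[in RHS](derive_id y v) derive_mx ?mxE //.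
exact: Ck_on_cst.
Qed.

Lemma smooth_near_derive V W (f : V -> W) v x : smooth_near f x ->
  smooth_near ('D_v f) x.
Proof. by move=> [U [oU Ux sf]]; exists U; split => // k; exact: (sf k.+1).2. Qed.

Lemma smooth_near_differentiable V W (f : V -> W) x : smooth_near f x ->
  \forall y \near x, differentiable f y.
Proof.
move=> [U [oU Ux sf]]; apply: filterS (open_nbhs_nbhs (conj oU Ux)) => y.
exact: (sf 1%N).1.
Qed.

Lemma smooth_near_differentiable_at V W (f : V -> W) x : smooth_near f x ->
  differentiable f x.
Proof. by move=> /smooth_near_differentiable/nbhs_singleton. Qed.

Lemma smooth_near_continuous V W (f : V -> W) x : smooth_near f x ->
  {for x, continuous f}.
Proof. by move=> [U [oU Ux sf]]; exact: (sf 0%N). Qed.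

Lemma smooth_near_comp V m (f : 'rV[R]_m -> R) (F : V -> 'rV[R]_m) x :
  (forall j, smooth_near (fun y => F y 0 j) x) -> smooth_near f (F x) ->
  smooth_near (f \o F) x.
Proof.
move=> sF [U [oU UFx sf]].
have [B BP] := choice sF.
pose B' := [set y | forall j, B j y].
have oB' : open B'.
  rewrite openE => y By; apply: filter_forall => j.
  by have [oB _ _] := BP j; exact: open_nbhs_nbhs (conj oB (By j)).
have cF y : B' y -> {for y, continuous F}.
  move=> B'y; apply: rV_cvg => j; have [_ _ /(_ 0%N)] := BP j; apply.
  exact: B'y.
have oU' : open (B' `&` F @^-1` U).
  rewrite openE => y [B'y UFy]; rewrite /interior.
  apply: filterI; first exact: open_nbhs_nbhs (conj oB' B'y).
  exact: (cF _ B'y _ (open_nbhs_nbhs (conj oU UFy))).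
exists (B' `&` F @^-1` U); split => //.
  by split => // j; have [] := BP j.
move=> k; apply: (Ck_on_comp (U' := U)) => //.
  by move=> y [].
move=> j; have [_ _ sOj] := BP j.
by apply: Ck_on_sub (sOj k) => y [/(_ j)].
Qed.

Lemma smooth_near_row_differentiable V m (F : V -> 'rV[R]_m) x :
  (forall j, smooth_near (fun y => F y 0 j) x) ->
  \forall y \near x, forall j, differentiable (fun z => F z 0 j) y.
Proof.
by move=> sF; apply: filter_forall => j; exact: smooth_near_differentiable.
Qed.

Lemma derive_comp_row V m (f : 'rV[R]_m -> R) (F : V -> 'rV[R]_m) x v :
  (forall j, differentiable (fun z => F z 0 j) x) -> differentiable f (F x) ->
  'D_v (f \o F) x = \sum_j 'D_v (fun z => F z 0 j) x * 'D_('e_j) f (F x).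
Proof.
move=> dF df; rewrite derive_comp //; last exact: rV_differentiable.
rewrite derive_sum_delta // derive_rV //.
by apply: eq_bigr => j _; rewrite mxE.
Qed.

(** The order of vanishing is encoded by iterated directional derivatives rather than by a bound
    O(|x|^d), so that the Leibniz and chain rules give its closure properties by induction;
    [vanish_bound] recovers the bound for smooth germs. *)
Fixpoint vanish V (d : nat) (f : V -> R) : Prop :=
  if d is d'.+1 then f 0 = 0 /\ forall v, vanish d' ('D_v f) else True.

Lemma vanish_ext V d (f g : V -> R) : (\forall y \near (0 : V), f y = g y) ->
  vanish d f -> vanish d g.
Proof.
elim: d f g => [//|d IH] f g fg [f0 Df]; split.
  by rewrite -f0; apply: esym; exact: nbhs_singleton fg.
move=> v; apply: IH (Df v); move: fg => /near_join; apply: filterS => y.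
exact: near_eq_derive.
Qed.

Lemma vanish_pred V d (f : V -> R) : vanish d.+1 f -> vanish d f.
Proof.
by elim: d f => [//|d IH] f [f0 Df]; split => // v; apply: IH; exact: Df.
Qed.

Lemma vanish_le V d e (f : V -> R) : (d <= e)%N -> vanish e f -> vanish d f.
Proof.
move=> /subnK <-; elim: (e - d)%N => [//|j IH] h.
by apply: IH; exact: vanish_pred.
Qed.

Lemma vanish_cst0 V d : vanish d (cst 0 : V -> R).
Proof.
elim: d => [//|d IH]; split => // v.
suff -> : 'D_v (cst 0 : V -> R) = cst 0 by [].
by apply/funext => x; exact: derive_cst.
Qed.

Lemma vanishD V d (f g : V -> R) : smooth_near f 0 -> smooth_near g 0 ->
  vanish d f -> vanish d g -> vanish d (fun y => f y + g y).
Proof.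
elim: d f g => [//|d IH] f g sf sg [f0 Df] [g0 Dg]; split.
  by rewrite f0 g0 addr0.
move=> v; apply: vanish_ext
  (IH _ _ (smooth_near_derive v sf) (smooth_near_derive v sg) (Df v) (Dg v)).
have df := smooth_near_differentiable sf; have dg := smooth_near_differentiable sg.
near=> y; rewrite deriveD //; apply: diff_derivable.
  by near: y; exact: df.
by near: y; exact: dg.
Unshelve. all: by end_near.
Qed.

Lemma vanishM V d e (f g : V -> R) : smooth_near f 0 -> smooth_near g 0 ->
  vanish d f -> vanish e g -> vanish (d + e) (fun y => f y * g y).
Proof.
(* The induction is on a lower bound [k] of [d + e]: when one of the two orders is already 0,
   differentiating that factor leaves the sum unchanged, while [k] still drops. *)
have [k] : exists2 k, (k <= d + e)%N & k = (d + e)%N by exists (d + e)%N.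
move=> + <-; elim: k d e f g => [//|k IH] d e f g kde sf sg vf vg; split.
  case: d kde vf => [|d] kde vf; last by case: vf => ->; rewrite mul0r.
  by case: e kde vg => [//|e] _ [-> _]; rewrite mulr0.
move=> v.
have df := smooth_near_differentiable sf; have dg := smooth_near_differentiable sg.
have sDf := smooth_near_derive v sf; have sDg := smooth_near_derive v sg.
have v1 : vanish k (fun y => f y * 'D_v g y).
  case: e kde vg => [|e] kde vg; first by apply: (IH d 0) => //; exact: ltnW.
  by apply: (IH d e) => //; [move: kde; rewrite addnS|exact: vg.2].
have v2 : vanish k (fun y => g y * 'D_v f y).
  case: d kde vf => [|d] kde vf.
    by apply: (IH e 0) => //; rewrite addn0 ltnW.
  by apply: (IH e d) => //; [move: kde; rewrite addSn addnC|exact: vf.2].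
apply: vanish_ext (vanishD _ _ v1 v2); try exact: smooth_nearM.
near=> y; rewrite deriveM //; apply: diff_derivable.
  by near: y; exact: df.
by near: y; exact: dg.
Unshelve. all: by end_near.
Qed.

Lemma vanishMr V d (f g : V -> R) : smooth_near f 0 -> smooth_near g 0 ->
  vanish d f -> vanish d (fun y => f y * g y).
Proof. by move=> sf sg vf; have := @vanishM _ d 0 f g sf sg vf I; rewrite addn0. Qed.

Lemma vanishZ V d (a : R) (f : V -> R) : smooth_near f 0 ->
  vanish d f -> vanish d (fun y => a * f y).
Proof.
by move=> sf vf; apply: (@vanishM _ 0 d (cst a)) => //; exact: smooth_near_cst.
Qed.

Lemma vanishB V d (f g : V -> R) : smooth_near f 0 -> smooth_near g 0 ->
  vanish d f -> vanish d g -> vanish d (fun y => f y - g y).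
Proof.
move=> sf sg vf vg.
have := vanishD sf (smooth_nearZ (-1) sg) vf (vanishZ (-1) sg vg).
by apply: vanish_ext; near=> y; rewrite mulN1r.
Unshelve. all: by end_near.
Qed.

Lemma vanish_sum V I (s : seq I) d (f : I -> V -> R) :
  (forall i, smooth_near (f i) 0) -> (forall i, vanish d (f i)) ->
  vanish d (fun y => \sum_(i <- s) f i y).
Proof.
move=> sf vf; elim: s => [|i s IH].
  by under eq_fun do rewrite big_nil; exact: vanish_cst0.
under eq_fun do rewrite big_cons.
by apply: vanishD => //; exact: smooth_near_sum.
Qed.

Lemma near_row_comp V m (F : V -> 'rV[R]_m) x (P : 'rV[R]_m -> Prop) :
  (forall j, smooth_near (fun y => F y 0 j) x) -> (\forall z \near F x, P z) ->
  \forall y \near x, P (F y).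
Proof.
move=> sF; have cF : {for x, continuous F}.
  by apply: rV_cvg => j; exact: smooth_near_continuous (sF j).
exact: cF.
Qed.

Lemma vanish_comp V m d (f : 'rV[R]_m -> R) (F : V -> 'rV[R]_m) :
  (forall j, smooth_near (fun y => F y 0 j) 0) -> F 0 = 0 ->
  smooth_near f 0 -> vanish d f -> vanish d (f \o F).
Proof.
move=> sF F0; elim: d f => [//|d IH] f sf [f0 Df]; split; first by rewrite /= F0.
move=> v.
apply: (@vanish_ext _ _ (fun y =>
    \sum_j 'D_('e_j) f (F y) * 'D_v (fun z => F z 0 j) y)); last first.
  have sDf j : smooth_near (fun y => 'D_('e_j) f (F y)) 0.
    by apply: (smooth_near_comp (f := 'D_('e_j) f)) => //;
      rewrite F0; exact: smooth_near_derive.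
  have sDF j : smooth_near (fun y => 'D_v (fun z => F z 0 j) y) 0.
    exact: smooth_near_derive.
  apply: vanish_sum => j; first exact: smooth_nearM.
  apply: vanishMr => //.
  exact: (IH ('D_('e_j) f) (smooth_near_derive _ sf) (Df _)).
have dF := smooth_near_row_differentiable sF.
have df0 : \forall z \near F 0, differentiable f z.
  by rewrite F0; exact: smooth_near_differentiable.
have df := near_row_comp sF df0.
near=> y; rewrite derive_comp_row; last 2 first.
- by near: y.
- by near: y.
by apply: eq_bigr => j _; rewrite mulrC.
Unshelve. all: by end_near.
Qed.

(** The mean value theorem on the segment from 0 to [x] trades one derivative for one factor [|x|],
    so no Taylor formula is involved. *)
Lemma vanish_bound m d (f : 'rV[R]_m -> R) : smooth_near f 0 -> vanish d f ->
  exists2 C : R, 0 <= C & \forall x \near (0 : 'rV[R]_m), `|f x| <= C * `|x| ^+ d.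
Proof.
elim: d f => [|d IH] f sf vf.
  exists (`|f 0| + 1); first by rewrite addr_ge0.
  have /cvgrPdist_le/(_ 1 ltr01) := smooth_near_continuous sf.
  apply: filterS => x; rewrite expr0 mulr1 => h.
  rewrite -[f x](subrKC (f 0)); apply: le_trans (ler_normD _ _) _.
  by rewrite lerD2l distrC.
have [f0 Df] := vf.
have /choice[C CP] (j : 'I_m) : exists C : R, 0 <= C /\
    \forall x \near (0 : 'rV[R]_m), `|'D_('e_j) f x| <= C * `|x| ^+ d.
  by have [C] := IH _ (smooth_near_derive 'e_j sf) (Df 'e_j); exists C.
exists (\sum_j C j); first by apply: sumr_ge0 => j _; have [] := CP j.
have h1 : \forall x \near (0 : 'rV[R]_m),
    (forall j, `|'D_('e_j) f x| <= C j * `|x| ^+ d) /\ differentiable f x.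
  have := filter_forall (nbhs_filter (0 : 'rV[R]_m)) (fun j => (CP j).2).
  by move: (smooth_near_differentiable sf); apply: filterS2 => x dfx h; split.
have /nbhs_normP[e e0 he] := h1.
apply/nbhs_normP; exists e => // x; rewrite /= sub0r normrN => xe.
have inB (t : R) : 0 <= t <= 1 -> `|0 + t *: x| < e /\ `|0 + t *: x| <= `|x|.
  move=> /andP[t0 t1]; rewrite add0r normrZ ger0_norm //.
  have tx : t * `|x| <= `|x| by rewrite ler_piMl.
  by split => //; exact: le_lt_trans xe.
have hB (t : R) : 0 <= t <= 1 -> (forall j,
    `|'D_('e_j) f (0 + t *: x)| <= C j * `|0 + t *: x| ^+ d) /\
    differentiable f (0 + t *: x).
  move=> t01; have [te _] := inB t t01.
  by apply: he => /=; rewrite sub0r normrN.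
have [t t01|t t01] := @MVT_line _ f 0 x; first exact: (hB t t01).2.
rewrite add0r f0 subr0 => ->; have [hC df] := hB t t01.
rewrite derive_sum_delta // mulr_suml; apply: le_trans (ler_norm_sum _ _ _) _.
apply: ler_sum => j _; rewrite normrM exprS mulrCA.
apply: ler_pM => //; first exact: rV_coord_le.
apply: le_trans (hC j) _; apply: ler_wpM2l; first by have [] := CP j.
by apply: lerXn2r; rewrite ?nnegrE //; exact: (inB t t01).2.
Qed.

(** Euler's identity for homogeneous functions of degree [d], modulo higher order. By the symmetry
    of second derivatives, the derivative along [v] of the Euler defect of [r] in degree [d.+1] is
    the defect of ['D_v r] in degree [d]. *)
Lemma vanish_euler m d (r : 'rV[R]_m -> R) : smooth_near r 0 -> vanish d r ->
  vanish d.+1 (fun x => d%:R * r x - \sum_i x 0 i * 'D_('e_i) r x).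
Proof.
elim: d r => [|d IH] r sr vr; split.
- rewrite mul0r sub0r big1 ?oppr0 // => i _; by rewrite mxE mul0r.
- by [].
- by rewrite vr.1 mulr0 sub0r big1 ?oppr0 // => i _; rewrite mxE mul0r.
move=> v; apply: vanish_ext (IH _ (smooth_near_derive v sr) (vr.2 v)).
have [U [oU U0 sU]] := sr.
apply: filterS (open_nbhs_nbhs (conj oU U0)) => x Ux.
have dr : differentiable r x := (sU 1%N).1 x Ux.
have dDr i : differentiable ('D_('e_i) r) x := ((sU 2%N).2 'e_i).1 x Ux.
pose g i := (fun y : 'rV[R]_m => y 0 i) * 'D_('e_i) r.
have -> : (fun x => d.+1%:R * r x - \sum_i x 0 i * 'D_('e_i) r x)
   = d.+1%:R *: r - \sum_i g i.
  by apply/funext => y; rewrite fctE /= -[in RHS]/(- _) !fctE fct_sumE.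
have dg i : derivable (g i) x v.
  by apply: derivableM; apply: diff_derivable => //; exact: differentiable_coord.
rewrite deriveB ?deriveZ ?derive_sum //; last 3 first.
- exact: diff_derivable.
- by apply: derivableZ; exact: diff_derivable.
- by apply: derivable_sum => i; exact: dg.
have Dg i : 'D_v (g i) x = x 0 i * 'D_('e_i) ('D_v r) x + 'D_('e_i) r x * v 0 i.
  rewrite deriveM; [|apply: diff_derivable; exact: differentiable_coord|
    exact: diff_derivable].
  rewrite (derive_comm _ _ oU (sU 2%N) Ux); congr (_ + _ *: _).
  by rewrite -[in RHS](derive_id x v) derive_mx ?mxE.
under [in RHS]eq_bigr do rewrite Dg.
rewrite big_split /= opprD addrA.
have -> : \sum_i 'D_('e_i) r x * v 0 i = 'D_v r x.
  by rewrite [RHS]derive_sum_delta //; apply: eq_bigr => i _; rewrite mulrC.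
rewrite -natr1 /GRing.scale /=.
by move: (\sum_i _) ('D_v r x); clear; move=> a b; ring.
Qed.



(** * Series dominated by a geometric series and their termwise differentiation *)

Lemma geometric_tail (u : nat -> R) (C t : R) (N M : nat) : 0 <= t -> t < 1 ->
  (forall k, `|u k| <= C * t ^+ k) -> (N <= M)%N ->
  `|series u M - series u N| <= C * t ^+ N / (1 - t).
Proof.
move=> t0 t1 hu NM; have t10 : 0 < 1 - t by rewrite subr_gt0.
have C0 : 0 <= C by have := le_trans (normr_ge0 _) (hu 0%N); rewrite expr0 mulr1.
apply: (@le_trans _ _ (C * (t ^+ N - t ^+ M) / (1 - t))); last first.
  rewrite ler_pM2r ?invr_gt0 // ler_wpM2l // gerBl; exact: exprn_ge0.
move: NM => /subnK <-; elim: (M - N)%N => [|j IH].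
  by rewrite add0n !subrr normr0 mulr0 mul0r.
rewrite addSn -[series u _](subrK (series u (j + N))) -addrA.
apply: le_trans (ler_normD _ _) _; rewrite {1}/series /= big_nat_recr //=.
rewrite [X in `|X - _|]addrC addrK.
apply: le_trans (lerD (hu _) IH) _.
rewrite exprS le_eqVlt; apply/orP; left; apply/eqP.
by move: (t ^+ (j + N)) (t ^+ N) => a b; field; rewrite gt_eqF.
Qed.

Lemma geometric_cvg (u : nat -> R) (C t : R) : 0 <= t -> t < 1 ->
  (forall k, `|u k| <= C * t ^+ k) -> cvgn (series u).
Proof.
move=> t0 t1 hu; apply: normed_cvg.
have C0 : 0 <= C by have := le_trans (normr_ge0 _) (hu 0%N); rewrite expr0 mulr1.
apply: (@series_le_cvg _ _ (geometric C t)) => //.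
- by move=> n /=.
- by move=> n; rewrite /geometric /= mulr_ge0 // exprn_ge0.
- by apply: is_cvg_geometric_series; rewrite ger0_norm.
Qed.

Lemma geometric_lim_tail (u : nat -> R) (C t : R) N : 0 <= t -> t < 1 ->
  (forall k, `|u k| <= C * t ^+ k) ->
  `|limn (series u) - series u N| <= C * t ^+ N / (1 - t).
Proof.
move=> t0 t1 hu; have cu := geometric_cvg t0 t1 hu.
rewrite distrC.
have : (fun M => `|series u N - series u M|) @ \oo --> `|series u N - limn (series u)|.
  by apply: cvg_norm; apply: cvgB => //; exact: cvg_cst.
move=> /cvg_lim <- //; apply: limr_le.
  apply/cvg_ex; exists `|series u N - limn (series u)|.
  by apply: cvg_norm; apply: cvgB => //; exact: cvg_cst.
near=> M; rewrite distrC; apply: geometric_tail => //.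
by near: M; exact: nbhs_infty_ge.
Unshelve. all: by end_near.
Qed.

Lemma geometric_small (t e : R) : 0 <= t -> t < 1 -> 0 < e ->
  exists N, t ^+ N < e.
Proof.
move=> t0 t1 e0; have : `|t| < 1 by rewrite ger0_norm.
move=> /cvg_expr/cvgr0Pnorm_lt/(_ e e0)[N _ /(_ N (leqnn _))].
by rewrite ger0_norm ?exprn_ge0 //; exists N.
Qed.

Definition to_linear V W (f : V -> W) (_ : linear f) := f.
HB.instance Definition _ V W (f : V -> W) (lf : linear f) :=
  GRing.isLinear.Build R V W *:%R (to_linear lf) lf.

(** The bound on directional derivatives is linear in [|v|], so the sum of the derivatives is a
    bounded linear map; it is the differential because finitely many terms are handled exactly and
    the remainders of all others are small uniformly in [h], relative to [|h|]. *)
Lemma differentiable_series V (f : nat -> V -> R) (r C t : R) : 0 <= t -> t < 1 ->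
  (forall k x, `|x| < r -> differentiable (f k) x) ->
  (forall k x, `|x| < r -> `|f k x| <= C * t ^+ k) ->
  (forall k x v, `|x| < r -> `|'D_v (f k) x| <= C * `|v| * t ^+ k) ->
  forall x, `|x| < r ->
    differentiable (fun x => limn (series (f^~ x))) x /\
    forall v, 'D_v (fun x => limn (series (f^~ x))) x =
      limn (series (fun k => 'D_v (f k) x)).
Proof.
move=> t0 t1 df bf bD x xr.
have cf y : `|y| < r -> cvgn (series (f^~ y)).
  by move=> yr; apply: geometric_cvg t0 t1 _ => k; exact: bf.
have cD v : cvgn (series (fun k => 'D_v (f k) x)).
  by apply: geometric_cvg t0 t1 _ => k; exact: bD.
have t10 : 0 < 1 - t by rewrite subr_gt0.
have C0 : 0 <= C by have := le_trans (normr_ge0 _) (bf 0%N x xr); rewrite expr0 mulr1.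
pose G v := limn (series (fun k => 'D_v (f k) x)).
have linG : linear G.
  move=> a v w; rewrite /G.
  have -> : (fun k => 'D_(a *: v + w) (f k) x) =
     a *: (fun k => 'D_v (f k) x) + (fun k => 'D_w (f k) x).
    by apply/funext => k; rewrite differentiable_derivableD //; exact: df.
  have c1 : cvgn (series (a *: (fun k => 'D_v (f k) x))) by exact: is_cvg_seriesZ.
  by rewrite (lim_seriesD c1 (cD w)) lim_seriesZ.
have bG v : `|G v| <= C / (1 - t) * `|v|.
  have := geometric_lim_tail 0 t0 t1 (fun k => bD k x v xr).
  by rewrite {2}/series /= big_geq // subr0 expr0 mulr1 mulrAC.
have cG : continuous (to_linear linG).
  apply: bounded_linear_continuous; apply/linear_boundedP.
  exists (C / (1 - t)); split; first exact: num_real.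
  by move=> M CM v; apply: le_trans (bG v) _; apply: ler_wpM2r => //; exact: ltW.
apply: (eps_differentiable cG) => e e0.
(* [N] makes the tail of the remainders, at most [2 * C * |h| * t ^+ N / (1 - t)], smaller than half
   of [e * |h|]; the summand 1 avoids a zero denominator when [C = 0]. *)
have [N hN] : exists N, t ^+ N < e / 2 * (1 - t) / (2 * C + 1).
  apply: geometric_small => //; rewrite !(divr_gt0, mulr_gt0) //.
  by rewrite ltr_wpDl // mulr_ge0.
have dS : differentiable (\sum_(k < N) f k) x.
  by apply: differentiable_sum => k; exact: df.
have [d1 d10 h1] := differentiable_eps dS (divr_gt0 e0 (ltr0n _ 2)).
exists (Num.min d1 (r - `|x|)); first by rewrite lt_min d10 subr_gt0.
move=> h; rewrite lt_min => /andP[hd1 hr].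
have xhr : `|x + h| < r.
  by apply: le_lt_trans (ler_normD _ _) _; rewrite -ltrBrDl.
(* First-order remainder of the [k]-th term. The mean value theorem bounds both the increment and
   the derivative by [C * |h| * t ^+ k], whence the factor 2. *)
pose w k := f k (x + h) - f k x - 'D_h (f k) x.
have bw k : `|w k| <= 2 * C * `|h| * t ^+ k.
  have [s s01|s s01 E] := @MVT_line _ (f k) x h.
    apply: df; apply: le_lt_trans (ler_normD _ _) _; rewrite -ltrBrDl.
    move: s01 => /andP[s0 s1]; rewrite normrZ ger0_norm //.
    by apply: le_lt_trans hr; rewrite ler_piMl.
  rewrite /w E; apply: le_trans (ler_normB _ _) _.
  have -> : 2 * C * `|h| * t ^+ k = C * `|h| * t ^+ k + C * `|h| * t ^+ k by ring.
  apply: lerD; apply: bD => //.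
  apply: le_lt_trans (ler_normD _ _) _; rewrite -ltrBrDl.
  move: s01 => /andP[s0 s1]; rewrite normrZ ger0_norm //.
  by apply: le_lt_trans hr; rewrite ler_piMl.
have -> : limn (series (f^~ (x + h))) - limn (series (f^~ x)) - to_linear linG h =
    limn (series w).
  rewrite -lim_seriesB; [|exact: cf|exact: cf].
  rewrite -lim_seriesB //.
  exact: is_cvg_seriesB (cf _ xhr) (cf _ xr).
rewrite -[limn _](subrK (series w N)).
apply: le_trans (ler_normD _ _) _.
have -> : e * `|h| = e / 2 * `|h| + e / 2 * `|h| by field.
apply: lerD.
  apply: le_trans (geometric_lim_tail N t0 t1 bw) _.
  rewrite ler_pdivrMr //.
  have C1 : 0 < 2 * C + 1 by rewrite ltr_wpDl // mulr_ge0.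
  move: hN; rewrite ltr_pdivlMr // => hN.
  have -> : 2 * C * `|h| * t ^+ N = `|h| * (t ^+ N * (2 * C)) by ring.
  have -> : e / 2 * `|h| * (1 - t) = `|h| * (e / 2 * (1 - t)) by ring.
  apply: ler_wpM2l => //; apply: le_trans (ltW hN).
  by apply: ler_wpM2l; [exact: exprn_ge0|rewrite lerDl].
suff -> : series w N = (\sum_(k < N) f k) (x + h) - (\sum_(k < N) f k) x
   - 'D_h (\sum_(k < N) f k) x by exact: h1.
rewrite derive_sum; last by move=> k; apply: diff_derivable; exact: df.
by rewrite !fct_sumE -!sumrB /series /= big_mkord.
Qed.

(** * Tangent maps and contractions *)

Definition tangent m (F : 'rV[R]_m -> 'rV[R]_m) (z : 'rV[R]_(m + m)) :
    'rV[R]_(m + m) :=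
  row_mx (F (lsubmx z)) ('D_(rsubmx z) F (lsubmx z)).

(** The differential of [g] as a function on the tangent bundle. Base point and vector are glued
    into one row, here and in [tangent], so that both constructions stay among row vectors and can
    be iterated, each time in doubled dimension. *)
Definition tangent_fun m (g : 'rV[R]_m -> R) (z : 'rV[R]_(m + m)) : R :=
  'D_(rsubmx z) g (lsubmx z).

(* The adapted gauge [N] makes [rho] a bound on the spectral radius of the
   differential rather than on its operator norm. *)
Definition contracting m (F : 'rV[R]_m -> 'rV[R]_m) (rho : R) :=
  [/\ forall j, smooth_near (fun y => F y 0 j) 0, F 0 = 0 &
    exists (N : 'rV[R]_m -> R) (c : R), [/\ 0 < c,
      forall x, `|x| <= c * N x, forall x, N x <= c * `|x|,
      forall x y, N (x + y) <= N x + N y &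
      forall v, N ('D_v F 0) <= rho * N v]].

(** Near 0 the nonlinear remainder is absorbed by the gap between [rho] and [sigma], measured in the
    gauge; passing from the norm to the gauge and back costs [K = c * c]. The property [P] is
    carried along so that it holds on whole orbits. *)
Lemma contracting_near m (F : 'rV[R]_m -> 'rV[R]_m) rho sigma :
  contracting F rho -> 0 <= rho -> rho < sigma -> sigma < 1 ->
  forall P : 'rV[R]_m -> Prop, (\forall x \near (0 : 'rV[R]_m), P x) ->
  exists r K : R, [/\ 0 < r, 0 <= K &
    forall x, `|x| < r -> forall k, P (iter k F x) /\
      `|iter k F x| <= K * sigma ^+ k * `|x|].
Proof.
move=> [sF F0 [N [c [c0 lN Nl ND NF]]]] rho0 rs s1 P nP.
have s0 : 0 <= sigma by rewrite (le_trans rho0) // ltW.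
have dF : differentiable F 0.
  apply: rV_differentiable => j.
  exact: smooth_near_differentiable_at (sF j).
(* A remainder of at most this multiple of [|x|] has gauge at most [(sigma - rho) * N x], since each
   change between norm and gauge costs a factor [c]. *)
have e0 : 0 < (sigma - rho) / (c * c).
  by rewrite divr_gt0 ?subr_gt0 // mulr_gt0.
have [d d0 hd] := differentiable_eps dF e0.
have /nbhs_normP[r r0 hr] := nP.
pose e := Num.min d r.
have e'0 : 0 < e by rewrite lt_min d0 r0.
have N0 x : 0 <= N x.
  by have := le_trans (normr_ge0 _) (lN x); rewrite pmulr_rge0.
have step x : c * N x < e -> N (F x) <= sigma * N x.
  move=> cN; have xe : `|x| < e := le_lt_trans (lN x) cN.
  have := hd x; rewrite add0r F0 subr0.
  have xd : `|x| < d by move: xe; rewrite lt_min => /andP[].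
  move=> /(_ xd) h.
  rewrite -[F x](subrK ('D_x F 0)) addrC.
  apply: le_trans (ND _ _) _.
  apply: le_trans (lerD (NF _) (Nl _)) _.
  have -> : sigma * N x = rho * N x + (sigma - rho) * N x by ring.
  rewrite lerD2l; apply: le_trans (ler_wpM2l (ltW c0) h) _.
  apply: (@le_trans _ _ (c * ((sigma - rho) / (c * c) * (c * N x)))).
    by rewrite ler_pM2l // ler_pM2l.
  by rewrite le_eqVlt; apply/orP; left; apply/eqP; field; rewrite gt_eqF.
have iterN x k : c * N x < e -> N (iter k F x) <= sigma ^+ k * N x.
  move=> cN; elim: k => [|k IH]; first by rewrite mul1r.
  rewrite iterS exprS -mulrA; apply: le_trans (ler_wpM2l s0 IH).
  apply: step; apply: le_lt_trans cN; rewrite ler_pM2l //.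
  apply: le_trans IH _; rewrite ler_piMl //.
  by apply: exprn_ile1 => //; exact: ltW.
exists (e / (c * c)), (c * c); split.
- by rewrite divr_gt0 // mulr_gt0.
- by rewrite ltW // mulr_gt0.
move=> x; rewrite ltr_pdivlMr ?mulr_gt0 // => xe k.
have cN : c * N x < e.
  by apply: le_lt_trans xe; rewrite [leRHS]mulrC -mulrA ler_pM2l.
have b1 : `|iter k F x| <= c * (sigma ^+ k * N x).
  by apply: le_trans (lN _) _; rewrite ler_pM2l //; exact: iterN.
split; last first.
  apply: le_trans b1 _.
  have -> : c * c * sigma ^+ k * `|x| = c * (sigma ^+ k * (c * `|x|)) by ring.
  by rewrite ler_pM2l // ler_wpM2l // exprn_ge0.
apply: hr; rewrite /= sub0r normrN; apply: le_lt_trans b1 _.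
suff : c * N x < r.
  apply: le_lt_trans; rewrite ler_pM2l // ler_piMl //.
  by apply: exprn_ile1 => //; exact: ltW.
by move: cN; rewrite lt_min => /andP[].
Qed.

Lemma lsubmx_norm_le m n (z : 'rV[R]_(m + n)) : `|lsubmx z| <= `|z|.
Proof.
by apply: rV_norm_le => // j; rewrite mxE; exact: rV_coord_le.
Qed.

Lemma rsubmx_norm_le m n (z : 'rV[R]_(m + n)) : `|rsubmx z| <= `|z|.
Proof.
by apply: rV_norm_le => // j; rewrite mxE; exact: rV_coord_le.
Qed.

Lemma row_mx_norm_le m n (x : 'rV[R]_m) (y : 'rV[R]_n) :
  `|row_mx x y| <= `|x| + `|y|.
Proof.
apply: rV_norm_le => [|j]; first by rewrite addr_ge0.
rewrite mxE; case: splitP => i _.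
  by apply: le_trans (rV_coord_le x i) _; rewrite lerDl.
by apply: le_trans (rV_coord_le y i) _; rewrite lerDr.
Qed.

Lemma smooth_near_lsubmx m n j (z : 'rV[R]_(m + n)) :
  smooth_near (fun z : 'rV[R]_(m + n) => lsubmx z 0 j) z.
Proof. by under eq_fun do rewrite mxE; exact: smooth_near_coord. Qed.

Lemma smooth_near_rsubmx m n j (z : 'rV[R]_(m + n)) :
  smooth_near (fun z : 'rV[R]_(m + n) => rsubmx z 0 j) z.
Proof. by under eq_fun do rewrite mxE; exact: smooth_near_coord. Qed.

Lemma derive_coord m (x v : 'rV[R]_m) j :
  'D_v (fun y : 'rV[R]_m => y 0 j) x = v 0 j.
Proof. by rewrite -[in RHS](derive_id x v) derive_mx ?mxE. Qed.

Lemma derive_rsubmx_coord m n (z w : 'rV[R]_(m + n)) j :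
  'D_w (fun z : 'rV[R]_(m + n) => rsubmx z 0 j) z = rsubmx w 0 j.
Proof. by under eq_fun do rewrite mxE; rewrite derive_coord mxE. Qed.

Lemma derive_comp_lsubmx m n (g : 'rV[R]_m -> R) (z w : 'rV[R]_(m + n)) :
  differentiable g (lsubmx z) ->
  'D_w (fun z : 'rV[R]_(m + n) => g (lsubmx z)) z = 'D_(lsubmx w) g (lsubmx z).
Proof.
move=> dg; have dl j : differentiable (fun y : 'rV[R]_(m + n) => lsubmx y 0 j) z.
  by under eq_fun do rewrite mxE; exact: differentiable_coord.
rewrite (derive_comp_row (F := fun z => lsubmx z) w dl dg) derive_sum_delta //.
apply: eq_bigr => j _; congr (_ * _).
by under eq_fun do rewrite mxE; rewrite derive_coord mxE.
Qed.

Lemma tangent_funE m (g : 'rV[R]_m -> R) : smooth_near g 0 ->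
  \forall z \near (0 : 'rV[R]_(m + m)),
    \sum_j rsubmx z 0 j * 'D_('e_j) g (lsubmx z) = tangent_fun g z.
Proof.
move=> sg; have dg := smooth_near_differentiable sg.
have l0 : lsubmx (0 : 'rV[R]_(m + m)) = 0 by rewrite linear0.
have dg0 : \forall y \near lsubmx (0 : 'rV[R]_(m + m)), differentiable g y.
  by rewrite l0.
have := near_row_comp (fun j => smooth_near_lsubmx j 0) dg0.
by apply: filterS => z dgz; rewrite /tangent_fun derive_sum_delta.
Qed.

Lemma smooth_near_tangent_term m (g : 'rV[R]_m -> R) j : smooth_near g 0 ->
  smooth_near (fun z : 'rV[R]_(m + m) => 'D_('e_j) g (lsubmx z)) 0.
Proof.
move=> sg; apply: (@smooth_near_comp _ _ ('D_('e_j) g) (fun z => lsubmx z)).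
  by move=> i; exact: smooth_near_lsubmx.
by rewrite linear0; exact: smooth_near_derive.
Qed.

Lemma smooth_near_tangent_fun m (g : 'rV[R]_m -> R) : smooth_near g 0 ->
  smooth_near (tangent_fun g) 0.
Proof.
move=> sg; apply: smooth_near_ext (tangent_funE sg) _.
apply: smooth_near_sum => j; apply: smooth_nearM.
  exact: smooth_near_rsubmx.
exact: smooth_near_tangent_term.
Qed.

Lemma derive_tangent_fun m (g : 'rV[R]_m -> R) w : smooth_near g 0 ->
  'D_w (tangent_fun g) 0 = 'D_(rsubmx w) g 0.
Proof.
move=> sg; rewrite -(near_eq_derive _ (tangent_funE sg)).
have dr j : derivable (fun z : 'rV[R]_(m + m) => rsubmx z 0 j) 0 w.
  apply: diff_derivable.
  by under eq_fun do rewrite mxE; exact: differentiable_coord.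
have dt j : derivable (fun z : 'rV[R]_(m + m) => 'D_('e_j) g (lsubmx z)) 0 w.
  apply: diff_derivable; apply: smooth_near_differentiable_at.
  exact: smooth_near_tangent_term.
have -> : (fun z => \sum_j rsubmx z 0 j * 'D_('e_j) g (lsubmx z)) =
    \sum_j ((fun z : 'rV[R]_(m + m) => rsubmx z 0 j)
      * (fun z => 'D_('e_j) g (lsubmx z))).
  by apply/funext => z; rewrite fct_sumE.
rewrite derive_sum; last by move=> j; exact: derivableM.
rewrite derive_sum_delta; last exact: smooth_near_differentiable_at sg.
apply: eq_bigr => j _; rewrite deriveM // derive_rsubmx_coord.
by rewrite !linear0 mxE scale0r add0r /GRing.scale /= mulrC.
Qed.

(** The order lost by differentiating [g] is regained from the fibre coordinate that multiplies each
    partial derivative and vanishes at 0. *)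
Lemma vanish_tangent_fun m d (g : 'rV[R]_m -> R) : smooth_near g 0 ->
  vanish d g -> vanish d (tangent_fun g).
Proof.
case: d => [//|d] sg vg; apply: vanish_ext (tangent_funE sg) _.
apply: vanish_sum => j.
  apply: smooth_nearM; first exact: smooth_near_rsubmx.
  exact: smooth_near_tangent_term.
apply: (@vanishM _ 1 d); first exact: smooth_near_rsubmx.
- exact: smooth_near_tangent_term.
- by split; first by rewrite linear0 mxE.
apply: (@vanish_comp _ _ _ ('D_('e_j) g) (fun z => lsubmx z)).
- by move=> i; exact: smooth_near_lsubmx.
- by rewrite linear0.
- exact: smooth_near_derive.
- exact: vg.2.
Qed.

Lemma tangent_coord_l m (F : 'rV[R]_m -> 'rV[R]_m) z i :
  tangent F z 0 (lshift m i) = F (lsubmx z) 0 i.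
Proof. by rewrite /tangent row_mxEl. Qed.

Lemma tangent_coord_r m (F : 'rV[R]_m -> 'rV[R]_m) i :
  (forall j, smooth_near (fun y => F y 0 j) 0) ->
  \forall z \near (0 : 'rV[R]_(m + m)),
    tangent_fun (fun y => F y 0 i) z = tangent F z 0 (rshift m i).
Proof.
move=> sF; have dF := smooth_near_row_differentiable sF.
have dF0 : \forall y \near lsubmx (0 : 'rV[R]_(m + m)),
    forall j, differentiable (fun z => F z 0 j) y by rewrite linear0.
have := near_row_comp (fun j => smooth_near_lsubmx j 0) dF0.
by apply: filterS => z dz; rewrite /tangent row_mxEr derive_rV // mxE.
Qed.

Lemma smooth_near_tangent m (F : 'rV[R]_m -> 'rV[R]_m) :
  (forall j, smooth_near (fun y => F y 0 j) 0) ->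
  forall j, smooth_near (fun z => tangent F z 0 j) 0.
Proof.
move=> sF j; rewrite -(splitK j); case: (fintype.split j) => i /=.
  under eq_fun do rewrite tangent_coord_l.
  apply: (@smooth_near_comp _ _ (fun y => F y 0 i) (fun z => lsubmx z)).
    by move=> k; exact: smooth_near_lsubmx.
  by rewrite linear0.
apply: smooth_near_ext (tangent_coord_r i sF) _.
exact: smooth_near_tangent_fun.
Qed.

Lemma tangent0 m (F : 'rV[R]_m -> 'rV[R]_m) : F 0 = 0 -> tangent F 0 = 0.
Proof. by move=> F0; rewrite /tangent !linear0 F0 derive0 row_mx0. Qed.

Lemma derive_tangent m (F : 'rV[R]_m -> 'rV[R]_m) w :
  (forall j, smooth_near (fun y => F y 0 j) 0) ->
  'D_w (tangent F) 0 = row_mx ('D_(lsubmx w) F 0) ('D_(rsubmx w) F 0).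
Proof.
move=> sF; rewrite derive_rV; last first.
  by move=> j; apply: smooth_near_differentiable_at; exact: smooth_near_tangent.
have dF j : differentiable (fun y => F y 0 j) 0.
  exact: smooth_near_differentiable_at.
apply/rowP => j; rewrite mxE -(splitK j); case: (fintype.split j) => i /=.
  under eq_fun do rewrite tangent_coord_l.
  rewrite row_mxEl derive_rV // mxE.
  have := @derive_comp_lsubmx m m (fun y => F y 0 i) 0 w.
  by rewrite linear0; apply.
rewrite row_mxEr derive_rV // mxE.
by rewrite -(near_eq_derive _ (tangent_coord_r i sF)) derive_tangent_fun.
Qed.

(** At the origin the vector is 0, so second derivatives of [F] do not enter: the differential of
    the tangent map is block diagonal with two copies of that of [F], and the sum of the two gauges
    contracts with the same [rho]. *)
Lemma tangent_contracting m (F : 'rV[R]_m -> 'rV[R]_m) rho :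
  contracting F rho -> contracting (tangent F) rho.
Proof.
move=> [sF F0 [N [c [c0 lN Nl ND NF]]]]; split.
- exact: smooth_near_tangent.
- exact: tangent0.
have N0 x : 0 <= N x.
  by have := le_trans (normr_ge0 _) (lN x); rewrite pmulr_rge0.
exists (fun z => N (lsubmx z) + N (rsubmx z)), (2 * c); split.
- by rewrite mulr_gt0.
- move=> z; rewrite -{1}(hsubmxK z); apply: le_trans (row_mx_norm_le _ _) _.
  apply: le_trans (lerD (lN _) (lN _)) _; rewrite -mulrDr.
  by rewrite ler_wpM2r ?addr_ge0 // ler_peMl ?ltW // ltr1n.
- move=> z; apply: le_trans (lerD (Nl _) (Nl _)) _; rewrite -mulrDr.
  rewrite [2 * c]mulrC -mulrA ler_pM2l // mulrDl mul1r.
  by apply: lerD; [exact: lsubmx_norm_le|exact: rsubmx_norm_le].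
- move=> z w; rewrite !linearD /= addrACA.
  by apply: lerD; exact: ND.
- move=> w; rewrite derive_tangent // row_mxKl row_mxKr mulrDr.
  by apply: lerD; exact: NF.
Qed.

(** Functoriality of the tangent map: the tangent map of an iterate is the iterate of the tangent
    map. *)
Lemma derive_iter m (F : 'rV[R]_m -> 'rV[R]_m) k (g : 'rV[R]_m -> R) x v :
  (forall i, differentiable F (iter i F x)) ->
  differentiable g (iter k F x) ->
  differentiable (g \o iter k F) x /\
  'D_v (g \o iter k F) x = tangent_fun g (iter k (tangent F) (row_mx x v)).
Proof.
elim: k x v => [|k IH] x v dF dg.
  by rewrite /tangent_fun /= row_mxKl row_mxKr.
have dFx : differentiable F x := dF 0%N.
have [|//|d1 D1] := IH (F x) ('D_v F x).
- by move=> i; rewrite -iterSr.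
- by rewrite -iterSr.
have -> : g \o iter k.+1 F = (g \o iter k F) \o F.
  by apply/funext => y; rewrite /= -iterSr.
split; first exact: differentiable_comp.
rewrite derive_comp // D1 iterSr; congr (tangent_fun _ (iter _ _ _)).
by rewrite /tangent row_mxKl row_mxKr.
Qed.

Lemma open_norm_lt V (e : R) : open [set x : V | `|x| < e].
Proof.
rewrite openE => x /= xe; apply/nbhs_normP; exists (e - `|x|).
  by rewrite /= subr_gt0.
move=> y /= xy; rewrite -(subrK x y); apply: le_lt_trans (ler_normD _ _) _.
by rewrite -ltrBrDr distrC.
Qed.

(* Differentiating the series along [v] gives the same kind of series for the
   tangent map, so regularity is gained one order at a time with no need for
   higher chain rules. *)
Lemma Ck_near_iterated_series k m (F : 'rV[R]_m -> 'rV[R]_m) (g : 'rV[R]_m -> R)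
    (a : nat -> R) (rho sigma A L : R) (d : nat) :
  contracting F rho -> 0 <= rho -> rho < sigma -> sigma < 1 ->
  smooth_near g 0 -> vanish d g -> 0 <= L -> L * sigma ^+ d < 1 ->
  (forall i, `|a i| <= A * L ^+ i) ->
  exists U, [/\ open U, U 0 &
    Ck_on k U (fun x => limn (series (fun i => a i * g (iter i F x))))].
Proof.
(* Dimension, map and germ are generalized, because the induction hypothesis is applied to the
   tangent map in doubled dimension. *)
have [n kn] := ubnP k; elim: n => // n IHn in k kn m F g *.
move=> cF rho0 rs s1 sg vg L0 Ls ha.
have s0 : 0 <= sigma by rewrite (le_trans rho0) // ltW.
have A0 : 0 <= A by have := le_trans (normr_ge0 _) (ha 0%N); rewrite expr0 mulr1.
pose t := L * sigma ^+ d.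
have t0 : 0 <= t by rewrite mulr_ge0 // exprn_ge0.
pose cTF := tangent_contracting cF.
have [sF F0 _] := cF.
have bnd p (F' : 'rV[R]_p -> 'rV[R]_p) (g' : 'rV[R]_p -> R) :
    contracting F' rho -> smooth_near g' 0 -> vanish d g' ->
    exists r C : R, [/\ 0 < r, 0 <= C & forall x, `|x| < r -> forall i,
      `|a i * g' (iter i F' x)| <= C * t ^+ i * `|x| ^+ d].
  move=> cF' sg' vg'; have [C C0 nC] := vanish_bound sg' vg'.
  have [r [K [r0 K0 h]]] := contracting_near cF' rho0 rs s1 nC.
  exists r, (A * C * K ^+ d); split => //.
    by rewrite !mulr_ge0 // exprn_ge0.
  move=> x xr i; have [h1 h2] := h x xr i.
  rewrite normrM.
  have -> : A * C * K ^+ d * t ^+ i * `|x| ^+ d =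
     (A * L ^+ i) * (C * (K * sigma ^+ i * `|x|) ^+ d).
    by rewrite /t !exprMn -!exprM [(i * d)%N]mulnC; ring.
  apply: ler_pM => //; apply: le_trans h1 _.
  apply: ler_wpM2l => //; apply: lerXn2r; rewrite ?nnegrE //.
  by rewrite !mulr_ge0 // exprn_ge0.
have [r1 [C1 [r10 C10 b1]]] := bnd _ _ _ cF sg vg.
have [r2 [C2 [r20 C20 b2]]] := bnd _ _ _ cTF (smooth_near_tangent_fun sg)
  (vanish_tangent_fun sg vg).
have nD : \forall x \near (0 : 'rV[R]_m), differentiable F x /\ differentiable g x.
  move: (smooth_near_differentiable sg) (smooth_near_row_differentiable sF).
  by apply: filterS2 => x dg dF; split => //; exact: rV_differentiable.
have [r3 [K3 [r30 K30 h3]]] := contracting_near cF rho0 rs s1 nD.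
(* Half of [r2] is reserved for the base point; the vector will be scaled to length [r2 / 3], so
   that the pair stays in the ball of radius [r2]. *)
pose r := Num.min (Num.min r1 (r2 / 2)) r3.
have r0 : 0 < r by rewrite !lt_min r10 r30 divr_gt0.
pose f i := (fun x => a i * g (iter i F x)).
have rr x : `|x| < r -> [/\ `|x| < r1, `|x| < r2 / 2 & `|x| < r3].
  by rewrite !lt_min => /andP[/andP[]].
have dgi i x v : `|x| < r -> differentiable (g \o iter i F) x /\
  'D_v (g \o iter i F) x = tangent_fun g (iter i (tangent F) (row_mx x v)).
  move=> /rr[_ _ xr]; apply: derive_iter.
    by move=> j; have [[]] := h3 x xr j.
  by have [[]] := h3 x xr i.
have df i x : `|x| < r -> differentiable (f i) x.
  by move=> xr; apply: differentiableZ; exact: (dgi i x 0 xr).1.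
have Df i x v : `|x| < r ->
    'D_v (f i) x = a i * tangent_fun g (iter i (tangent F) (row_mx x v)).
  move=> xr; have [d1 <-] := dgi i x v xr.
  by rewrite -[f i]/(a i *: (g \o iter i F)) deriveZ //; exact: diff_derivable.
pose C := C1 * r ^+ d + 3 / r2 * C2 * r2 ^+ d.
have P1 : 0 <= C1 * r ^+ d by apply: mulr_ge0 => //; apply: exprn_ge0; exact: ltW.
have P2 : 0 <= 3 / r2 * C2 * r2 ^+ d.
  apply: mulr_ge0; last by apply: exprn_ge0; exact: ltW.
  by apply: mulr_ge0 => //; apply: divr_ge0 => //; exact: ltW.
have C0 : 0 <= C by exact: addr_ge0.
have bf i x : `|x| < r -> `|f i x| <= C * t ^+ i.
  move=> xr; have [xr1 _ _] := rr _ x xr.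
  apply: le_trans (b1 x xr1 i) _; rewrite mulrAC ler_wpM2r ?exprn_ge0 //.
  apply: (@le_trans _ _ (C1 * r ^+ d)); last by rewrite lerDl.
  by apply: ler_wpM2l => //; apply: lerXn2r; rewrite ?nnegrE //; exact: ltW.
have bD i x v : `|x| < r -> `|'D_v (f i) x| <= C * `|v| * t ^+ i.
  move=> xr; have [_ xr2 _] := rr _ x xr.
  have [->|v0] := eqVneq v 0; first by rewrite derive0 normr0 normr0 mulr0 mul0r.
  have nv0 : 0 < `|v| by rewrite normr_gt0.
  (* The tangent estimate holds only for small vectors; linearity in the direction reduces every
     nonzero [v] to one of length [r2 / 3]. *)
  pose c := r2 / 3 / `|v|.
  have c0 : 0 < c by rewrite !divr_gt0.
  have cv : `|c *: v| = r2 / 3.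
    by rewrite normrZ gtr0_norm // /c divfK // gt_eqF.
  have zr : `|row_mx x (c *: v)| < r2.
    apply: le_lt_trans (row_mx_norm_le _ _) _; rewrite cv.
    rewrite [ltRHS](splitr r2); apply: ltrD => //.
    by rewrite ltr_pM2l // ltf_pV2 ?posrE // ltr_nat.
  have E : 'D_v (f i) x = c^-1 * 'D_(c *: v) (f i) x.
    rewrite (deriveZ_dir c v (df i x xr)) -[c *: 'D_v _ _]/(c * 'D_v (f i) x).
    by rewrite mulKf // gt_eqF.
  rewrite E normrM Df // gtr0_norm ?invr_gt0 // ler_pdivrMl //.
  apply: le_trans (b2 _ zr i) _.
  apply: (@le_trans _ _ (3 / r2 * C2 * r2 ^+ d * (c * `|v|) * t ^+ i)).
    rewrite /c divfK ?gt_eqF //.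
    have -> : 3 / r2 * C2 * r2 ^+ d * (r2 / 3) * t ^+ i = C2 * t ^+ i * r2 ^+ d.
      by field; rewrite gt_eqF.
    apply: ler_wpM2l; first by rewrite mulr_ge0 ?exprn_ge0.
    by apply: lerXn2r; rewrite ?nnegrE //; exact: ltW.
  rewrite [leRHS](_ : _ = C * (c * `|v|) * t ^+ i); last first.
    by move: (c) (C) `|v| (t ^+ i); clear=> p q y z; ring.
  apply: ler_wpM2r; first exact: exprn_ge0.
  by apply: ler_wpM2r; [rewrite mulr_ge0 // ltW|rewrite lerDr].
have main := differentiable_series t0 Ls df bf bD.
have oball := @open_norm_lt 'rV[R]_m.
case: k kn => [|k] kn.
  exists [set x | `|x| < r]; split => //=; first by rewrite normr0.
  by move=> x xr; apply: differentiable_continuous; exact: (main x xr).1.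
have [U [oU U0 CU]] := IHn k kn _ _ _ cTF rho0 rs s1 (smooth_near_tangent_fun sg)
  (vanish_tangent_fun sg vg) L0 Ls ha.
have /nbhs_normP[r' r'0 hr'] := open_nbhs_nbhs (conj oU U0).
pose e := Num.min r (r' / 2).
exists [set x | `|x| < e]; split => //.
  by rewrite /= normr0 lt_min r0 divr_gt0.
have er x : `|x| < e -> `|x| < r /\ `|x| < r' / 2.
  by rewrite lt_min => /andP[].
split=> [x /er[xr _]|v]; first exact: (main x xr).1.
(* The ball of radius [e] must serve all directions at once, so [v] is shrunk rather than the ball:
   the [v]-derivative is [c^-1] times the tangent series at [(x, c *: v)], which lies in [U]. The
   summand 1 covers [v = 0]. *)
pose c := r' / 3 / (`|v| + 1).
have v10 : 0 < `|v| + 1 by rewrite ltr_wpDl.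
have c0 : 0 < c by rewrite !divr_gt0.
have lin0 : linear (fun x : 'rV[R]_m => row_mx x (0 : 'rV[R]_m)).
  by move=> b x y; rewrite scale_row_mx add_row_mx scaler0 addr0.
have clin0 : continuous (to_linear lin0).
  apply: bounded_linear_continuous; apply/linear_boundedP.
  exists 1; split; first exact: num_real.
  move=> M M1 x; apply: le_trans (row_mx_norm_le _ _) _.
  by rewrite normr0 addr0 ler_peMl // ltW.
have := Ck_on_affine (row_mx 0 (c *: v)) oU clin0 CU.
move=> /(Ck_on_sub (U := [set x | `|x| < e]))Ca.
have {}Ca := Ck_onM (oball e) (Ck_on_cst k _ c^-1) (Ca _).
apply: Ck_on_ext (Ca _) => //.
  move=> x /er[xr xr'] /=.
  rewrite /to_linear add_row_mx addr0 add0r.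
  rewrite (main x xr).2.
  have -> : (fun i => 'D_v (f i) x) = c^-1 *: (fun i =>
     a i * tangent_fun g (iter i (tangent F) (row_mx x (c *: v)))).
    apply/funext => i; rewrite /= fctE -Df // (deriveZ_dir c v (df i x xr)).
    by rewrite scalerA mulVf ?scale1r // gt_eqF.
  rewrite lim_seriesZ //.
  have -> : (fun i => a i * tangent_fun g (iter i (tangent F) (row_mx x (c *: v))))
    = (fun i => 'D_(c *: v) (f i) x) by apply/funext => i; rewrite Df.
  by apply: geometric_cvg t0 Ls _ => i; exact: bD.
move=> x /er[xr xr'] /=; apply: hr'; rewrite /= sub0r normrN.
rewrite /to_linear add_row_mx addr0 add0r.
apply: le_lt_trans (row_mx_norm_le _ _) _.
rewrite [ltRHS](splitr r'); apply: ltrD => //; rewrite normrZ gtr0_norm //.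
apply: (@le_lt_trans _ _ (r' / 3)).
  rewrite /c mulrAC ler_pdivrMr // ler_pM2l ?divr_gt0 // lerDl //.
by rewrite ltr_pM2l // ltf_pV2 ?posrE // ltr_nat.
Qed.

End Ck_calculus.

(** * Germs of complex functions and words in them *)

Section complex_germs.
Variable R : realType.
Implicit Types V W : normedModType R.
Local Notation C := R[i].

Lemma complex_ext (z w : C) : complex.Re z = complex.Re w ->
  complex.Im z = complex.Im w -> z = w.
Proof. by case: z w => [a b] [c d] /= -> ->. Qed.

Lemma cReD (z w : C) : complex.Re (z + w) = complex.Re z + complex.Re w.
Proof. by case: z w => [a b] [c d]. Qed.
Lemma cImD (z w : C) : complex.Im (z + w) = complex.Im z + complex.Im w.
Proof. by case: z w => [a b] [c d]. Qed.
Lemma cReM (z w : C) : complex.Re (z * w) =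
  complex.Re z * complex.Re w - complex.Im z * complex.Im w.
Proof. by case: z w => [a b] [c d]. Qed.
Lemma cImM (z w : C) : complex.Im (z * w) =
  complex.Re z * complex.Im w + complex.Im z * complex.Re w.
Proof. by case: z w => [a b] [c d]. Qed.

Lemma Re_sum I (s : seq I) (f : I -> C) :
  complex.Re (\sum_(i <- s) f i) = \sum_(i <- s) complex.Re (f i).
Proof. exact: (big_morph _ cReD). Qed.
Lemma Im_sum I (s : seq I) (f : I -> C) :
  complex.Im (\sum_(i <- s) f i) = \sum_(i <- s) complex.Im (f i).
Proof. exact: (big_morph _ cImD). Qed.

Definition flat_real V d (f : V -> R) := smooth_near f 0 /\ vanish d f.

Lemma flat_realD V d (f g : V -> R) : flat_real d f -> flat_real d g ->
  flat_real d (fun x => f x + g x).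
Proof.
by move=> [sf vf] [sg vg]; split; [exact: smooth_nearD|exact: vanishD].
Qed.

Lemma flat_realB V d (f g : V -> R) : flat_real d f -> flat_real d g ->
  flat_real d (fun x => f x - g x).
Proof.
by move=> [sf vf] [sg vg]; split; [exact: smooth_nearB|exact: vanishB].
Qed.

Lemma flat_realM V d e (f g : V -> R) : flat_real d f -> flat_real e g ->
  flat_real (d + e) (fun x => f x * g x).
Proof.
by move=> [sf vf] [sg vg]; split; [exact: smooth_nearM|exact: vanishM].
Qed.

(* [flat 0 f] says that the germ of [f] at [0] is smooth; in general [flat d f]
   says moreover that it belongs to the [d]-th power of the maximal ideal. *)
Definition flat V d (f : V -> C) :=
  flat_real d (fun x => complex.Re (f x)) /\ flat_real d (fun x => complex.Im (f x)).

Lemma flat_ext V d (f g : V -> C) : (\forall x \near (0 : V), f x = g x) ->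
  flat d f -> flat d g.
Proof.
move=> fg [[sf vf] [sf' vf']].
have fg1 : \forall x \near (0 : V), complex.Re (f x) = complex.Re (g x).
  by apply: filterS fg => x ->.
have fg2 : \forall x \near (0 : V), complex.Im (f x) = complex.Im (g x).
  by apply: filterS fg => x ->.
by split; split; [exact: smooth_near_ext fg1 sf|exact: vanish_ext fg1 vf|
  exact: smooth_near_ext fg2 sf'|exact: vanish_ext fg2 vf'].
Qed.

Lemma flat_le V d e (f : V -> C) : (d <= e)%N -> flat e f -> flat d f.
Proof.
by move=> de [[sf vf] [sf' vf']]; split; split => //; exact: vanish_le de _.
Qed.

Lemma flatD V d (f g : V -> C) : flat d f -> flat d g -> flat d (fun x => f x + g x).
Proof.
move=> [f1 f2] [g1 g2]; split.
  by under eq_fun do rewrite cReD; exact: flat_realD.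
by under eq_fun do rewrite cImD; exact: flat_realD.
Qed.

Lemma flatM V d e (f g : V -> C) : flat d f -> flat e g ->
  flat (d + e) (fun x => f x * g x).
Proof.
move=> [f1 f2] [g1 g2]; split.
  by under eq_fun do rewrite cReM; apply: flat_realB; exact: flat_realM.
by under eq_fun do rewrite cImM; apply: flat_realD; exact: flat_realM.
Qed.

Lemma flat_cst V (a : C) : flat 0 (fun _ : V => a).
Proof. by split; split => //; exact: smooth_near_cst. Qed.

Lemma flat0 V d : flat d (fun _ : V => 0 : C).
Proof. by split; split; [exact: smooth_near_cst|exact: vanish_cst0|
  exact: smooth_near_cst|exact: vanish_cst0]. Qed.

Lemma flatZ V d (a : C) (f : V -> C) : flat d f -> flat d (fun x => a * f x).
Proof. exact: (@flatM _ 0 d _ _ (flat_cst V a)). Qed.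

Lemma flatB V d (f g : V -> C) : flat d f -> flat d g -> flat d (fun x => f x - g x).
Proof.
move=> ff fg; under eq_fun do rewrite -mulN1r.
by apply: flatD => //; exact: flatZ.
Qed.

Lemma flat_sum V I (s : seq I) d (f : I -> V -> C) : (forall i, flat d (f i)) ->
  flat d (fun x => \sum_(i <- s) f i x).
Proof.
move=> ff; elim: s => [|i s IH].
  by under eq_fun do rewrite big_nil; exact: flat0.
by under eq_fun do rewrite big_cons; exact: flatD.
Qed.

Lemma flat_comp V m d (f : 'rV[R]_m -> C) (F : V -> 'rV[R]_m) :
  (forall j, smooth_near (fun y => F y 0 j) 0) -> F 0 = 0 ->
  flat d f -> flat d (fun x => f (F x)).
Proof.
move=> sF F0 [[s1 v1] [s2 v2]].
split; split.
- by apply: (@smooth_near_comp _ _ _ (fun x => complex.Re (f x))) => //; rewrite F0.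
- exact: (@vanish_comp _ _ _ _ (fun x => complex.Re (f x))).
- by apply: (@smooth_near_comp _ _ _ (fun x => complex.Im (f x))) => //; rewrite F0.
- exact: (@vanish_comp _ _ _ _ (fun x => complex.Im (f x))).
Qed.

Definition cderive V (v : V) (f : V -> C) (x : V) : C :=
  Complex ('D_v (fun y => complex.Re (f y)) x) ('D_v (fun y => complex.Im (f y)) x).

Lemma flat_cderive V d (f : V -> C) v : flat d.+1 f -> flat d (cderive v f).
Proof.
move=> [[s1 [_ v1]] [s2 [_ v2]]].
by split; split; [exact: smooth_near_derive|exact: v1|exact: smooth_near_derive|exact: v2].
Qed.

Lemma flat1E V (f : V -> C) : flat 0 f -> f 0 = 0 -> flat 1 f.
Proof. by move=> [[s1 _] [s2 _]] f0; split; split => //; split; rewrite ?f0. Qed.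

Lemma flat2E V (f : V -> C) : flat 0 f -> f 0 = 0 ->
  (forall v, cderive v f 0 = 0) -> flat 2 f.
Proof.
move=> [[s1 _] [s2 _]] f0 Df; split; split => //; split; rewrite ?f0 //;
  move=> v; split => //; by have [] := Df v.
Qed.

Lemma flat_at0 V d (f : V -> C) : flat d.+1 f -> f 0 = 0.
Proof. by move=> [[_ [r0 _]] [_ [i0 _]]]; exact: complex_ext. Qed.

Lemma flat_cderive0 V d (f : V -> C) v : flat d.+2 f -> cderive v f 0 = 0.
Proof. by move=> /(flat_cderive v)/flat_at0. Qed.

Lemma flat_real_complex V d (f : V -> R) : flat_real d f ->
  flat d (fun x => real_complex R (f x)).
Proof.
by move=> ff; split => //; split; [exact: smooth_near_cst|exact: vanish_cst0].
Qed.

Lemma flat_coord m (i : 'I_m) : flat 1 (fun x : 'rV[R]_m => real_complex R (x 0 i)).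
Proof.
apply: flat_real_complex; split; first exact: smooth_near_coord.
by split; rewrite ?mxE.
Qed.

Lemma flat_euler m d (r : 'rV[R]_m -> C) : flat d r ->
  flat d.+1 (fun x => d%:R * r x - \sum_i real_complex R (x 0 i) * cderive 'e_i r x).
Proof.
move=> [[s1 v1] [s2 v2]].
have ReS (x : 'rV[R]_m) : complex.Re (d%:R * r x -
     \sum_i real_complex R (x 0 i) * cderive 'e_i r x) =
    d%:R * complex.Re (r x) - \sum_i x 0 i * 'D_('e_i) (fun y => complex.Re (r y)) x.
  rewrite cReD cReM -[d%:R]/(d%:R) -(rmorph_nat (real_complex R)) /= mul0r subr0.
  congr (_ + _); rewrite -sumrN -[RHS]sumrN.
  elim/big_ind2 : _ => //= [a b c e <- <-|i _]; first by rewrite cReD.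
  by rewrite /= mul0r subr0.
have ImS (x : 'rV[R]_m) : complex.Im (d%:R * r x -
     \sum_i real_complex R (x 0 i) * cderive 'e_i r x) =
    d%:R * complex.Im (r x) - \sum_i x 0 i * 'D_('e_i) (fun y => complex.Im (r y)) x.
  rewrite cImD cImM -(rmorph_nat (real_complex R)) /= mul0r addr0.
  congr (_ + _); rewrite -sumrN -[RHS]sumrN.
  elim/big_ind2 : _ => //= [a b c e <- <-|i _]; first by rewrite cImD.
  by rewrite /= mul0r addr0.
have smE (f : 'rV[R]_m -> R) : smooth_near f 0 ->
    smooth_near (fun x => d%:R * f x - \sum_i x 0 i * 'D_('e_i) f x) 0.
  move=> sf; apply: smooth_nearB; first exact: smooth_nearZ.
  apply: smooth_near_sum => i; apply: smooth_nearM; first exact: smooth_near_coord.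
  exact: smooth_near_derive.
split.
  under eq_fun do rewrite ReS.
  by split; [exact: smE|exact: vanish_euler].
under eq_fun do rewrite ImS.
by split; [exact: smE|exact: vanish_euler].
Qed.

Lemma cderiveD V (f g : V -> C) v : flat 0 f -> flat 0 g ->
  cderive v (fun x => f x + g x) 0 = cderive v f 0 + cderive v g 0.
Proof.
move=> [[s1 _] [s2 _]] [[t1 _] [t2 _]].
have dd (h : V -> R) : smooth_near h 0 -> derivable h 0 v.
  by move=> sh; apply: diff_derivable; exact: smooth_near_differentiable_at.
apply: complex_ext; rewrite ?cReD ?cImD /=.
  by under eq_fun do rewrite cReD; apply: deriveD; exact: dd.
by under eq_fun do rewrite cImD; apply: deriveD; exact: dd.
Qed.

Lemma flat_bound m d (f : 'rV[R]_m -> C) : flat d f ->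
  exists2 K : R, 0 <= K & \forall x \near (0 : 'rV[R]_m),
    `|complex.Re (f x)| <= K * `|x| ^+ d /\ `|complex.Im (f x)| <= K * `|x| ^+ d.
Proof.
move=> [[s1 v1] [s2 v2]].
have [K1 K10 h1] := vanish_bound s1 v1; have [K2 K20 h2] := vanish_bound s2 v2.
exists (K1 + K2); first exact: addr_ge0.
move: h1 h2; apply: filterS2 => x h1 h2; rewrite mulrDl; split.
  by apply: le_trans h1 _; rewrite lerDl mulr_ge0 // exprn_ge0.
by apply: le_trans h2 _; rewrite lerDr mulr_ge0 // exprn_ge0.
Qed.

End complex_germs.

(** * Words in germs and the homological equation *)

Section words.
Variable R : realType.
Local Notation C := R[i].

(** Monomials are indexed by words: multiplication by a generator is then [cons], and the degree is
    the size of a list. The passage to multi-indices is postponed to [word_sum_multi_index]. *)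
Definition word_prod (T : Type) n (zeta : 'I_n -> T -> C) (s : seq 'I_n) (x : T) : C :=
  \prod_(j <- s) zeta j x.

Definition word_sum (T : Type) n (zeta : 'I_n -> T -> C) (s : seq (C * seq 'I_n))
  (x : T) : C := \sum_(p <- s) p.1 * word_prod zeta p.2 x.

Definition homogeneous n d (s : seq (C * seq 'I_n)) :=
  all (fun p => size p.2 == d) s.

Lemma word_sum_nil T n (zeta : 'I_n -> T -> C) x : word_sum zeta [::] x = 0.
Proof. by rewrite /word_sum big_nil. Qed.

Lemma word_sum_cons T n (zeta : 'I_n -> T -> C) p s x :
  word_sum zeta (p :: s) x = p.1 * word_prod zeta p.2 x + word_sum zeta s x.
Proof. by rewrite /word_sum big_cons. Qed.

Lemma word_sum_cat T n (zeta : 'I_n -> T -> C) s t x :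
  word_sum zeta (s ++ t) x = word_sum zeta s x + word_sum zeta t x.
Proof. by rewrite /word_sum big_cat. Qed.

Lemma word_sum_flatten T n (zeta : 'I_n -> T -> C) (ss : seq (seq (C * seq 'I_n))) x :
  word_sum zeta (flatten ss) x = \sum_(s <- ss) word_sum zeta s x.
Proof. by rewrite /word_sum big_flatten. Qed.

Lemma word_sum_mul T n (zeta : 'I_n -> T -> C) a j s x :
  word_sum zeta [seq (a * p.1, j :: p.2) | p <- s] x = a * zeta j x * word_sum zeta s x.
Proof.
rewrite /word_sum big_map mulr_sumr; apply: eq_bigr => p _.
by rewrite /word_prod big_cons /=; ring.
Qed.

Lemma flat_word_prod m n (zeta : 'I_n -> 'rV[R]_m -> C) s :
  (forall j, flat 1 (zeta j)) -> flat (size s) (word_prod zeta s).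
Proof.
move=> fz; elim: s => [|j s IH].
  by rewrite /word_prod; under eq_fun do rewrite big_nil; exact: flat_cst.
rewrite /word_prod; under eq_fun do rewrite big_cons.
exact: (@flatM _ _ 1 (size s)).
Qed.

Lemma flat_word_sum m n (zeta : 'I_n -> 'rV[R]_m -> C) d s :
  (forall j, flat 1 (zeta j)) -> homogeneous d s -> flat d (word_sum zeta s).
Proof.
move=> fz; elim: s => [_|p s IH /= /andP[/eqP sp hs]].
  by rewrite /word_sum; under eq_fun do rewrite big_nil; exact: flat0.
apply: (@flat_ext _ _ _ (fun x => p.1 * word_prod zeta p.2 x + word_sum zeta s x)).
  by near=> x; rewrite word_sum_cons.
apply: flatD (IH hs); rewrite -sp; apply: flatZ; exact: flat_word_prod.
Unshelve. all: by end_near.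
Qed.

(* Degree-d Taylor polynomial of a germ vanishing to order d, expanded in germs
   [zeta j] whose differentials at 0 form a basis. *)
Lemma flat_word_expansion m (zeta : 'I_m -> 'rV[R]_m -> C) (P : 'M[C]_m) d r :
  (forall j, flat 1 (zeta j)) ->
  (forall i, flat 2 (fun x : 'rV[R]_m => real_complex R (x 0 i) - \sum_j P j i * zeta j x)) ->
  flat d r ->
  exists2 s, homogeneous d s & flat d.+1 (fun x => r x - word_sum zeta s x).
Proof.
move=> fz fP; elim: d r => [|d IH] r fr.
  exists [:: (r 0, [::])] => //; apply: flat1E.
    by apply: flatB => //; apply: (@flat_word_sum _ _ _ 0).
  by rewrite word_sum_cons word_sum_nil /word_prod big_nil mulr1 addr0 subrr.
have /choice[s sP] (i : 'I_m) : exists s, homogeneous d s /\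
    flat d.+1 (fun x => cderive 'e_i r x - word_sum zeta s x).
  by have [s] := IH _ (flat_cderive 'e_i fr); exists s.
have d0 : (d.+1%:R : C) != 0 by rewrite pnatr_eq0.
(* By Euler, [r] is [d.+1%:R^-1] times the sum of [x_i] times its [i]-th derivative, up to order
   [d.+2]; each [x_i] is replaced by its expansion in the [zeta j] and each derivative by the words
   [s i]. *)
pose t i j := [seq (d.+1%:R^-1 * P j i * p.1, j :: p.2) | p <- s i].
exists (flatten [seq flatten [seq t i j | j <- index_enum 'I_m] | i <- index_enum 'I_m]).
  apply/allP => p /flatten_mapP[i _] /flatten_mapP[j _] /mapP[q qs ->] /=.
  by rewrite eqSS; exact: (allP (sP i).1).
set w := word_sum _ _.
have wE x : w x = d.+1%:R^-1 * \sum_i (\sum_j P j i * zeta j x) * word_sum zeta (s i) x.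
  rewrite /w word_sum_flatten big_map mulr_sumr; apply: eq_bigr => i _.
  rewrite word_sum_flatten big_map mulr_suml mulr_sumr; apply: eq_bigr => j _.
  by rewrite word_sum_mul; ring.
(* Three errors remain, all of order [d.+2]: the Euler defect, a coordinate times the error in a
   derivative, and the error in a coordinate times a word sum of degree [d]. *)
apply: (@flat_ext _ _ _ (fun x => d.+1%:R^-1 *
  ((d.+1%:R * r x - \sum_i real_complex R (x 0 i) * cderive 'e_i r x) +
   (\sum_i real_complex R (x 0 i) * (cderive 'e_i r x - word_sum zeta (s i) x) +
    \sum_i (real_complex R (x 0 i) - \sum_j P j i * zeta j x) * word_sum zeta (s i) x)))).
  near=> x; rewrite wE -big_split /=.
  rewrite -[in RHS](mulKf d0 (r x)) -mulrBr; congr (_ * _).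
  rewrite -addrA; congr (_ + _); rewrite -!sumrN -big_split /=.
  by apply: eq_bigr => i _; ring.
apply: flatZ; apply: flatD; first exact: flat_euler.
apply: flatD; apply: flat_sum => i.
  by apply: (@flatM _ _ 1 d.+1); [exact: flat_coord|exact: (sP i).2].
apply: (@flatM _ _ 2 d) => //; apply: flat_word_sum => //; exact: (sP i).1.
Unshelve. all: by end_near.
Qed.

Variables (m : nat) (F : 'rV[R]_m -> 'rV[R]_m).
Hypotheses (sF : forall j, smooth_near (fun y => F y 0 j) 0) (F0 : F 0 = 0).
Variables (zeta : 'I_m -> 'rV[R]_m -> C) (lam : 'I_m -> C) (P : 'M[C]_m).
Hypothesis fz : forall j, flat 1 (zeta j).
Hypothesis fP :
  forall i, flat 2 (fun x : 'rV[R]_m => real_complex R (x 0 i) - \sum_j P j i * zeta j x).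
Hypothesis fF : forall j, flat 2 (fun x => zeta j (F x) - lam j * zeta j x).

Definition word_eigenvalue (s : seq 'I_m) : C := \prod_(j <- s) lam j.

(** Replacing one letter composed with [F] by [lam j] times the letter makes an error of order 2 in
    a factor of order 1, so the product gains one order. *)
Lemma flat_word_prod_comp s :
  flat (size s).+1
    (fun x => word_prod zeta s (F x) - word_eigenvalue s * word_prod zeta s x).
Proof.
elim: s => [|j s IH].
  rewrite /word_prod /word_eigenvalue.
  under eq_fun do rewrite !big_nil mul1r subrr.
  exact: flat0.
rewrite /word_prod /word_eigenvalue; under eq_fun do rewrite !big_cons.
apply: (@flat_ext _ _ _ (fun x =>
   (zeta j (F x) - lam j * zeta j x) * word_prod zeta s (F x) +
   lam j * (zeta j x *
     (word_prod zeta s (F x) - word_eigenvalue s * word_prod zeta s x)))).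
  near=> x; rewrite /word_prod /word_eigenvalue.
  by move: (\prod_(_ <- _) _) (\prod_(_ <- _) _) (\prod_(_ <- _) _) => a b c; ring.
apply: flatD.
  apply: (@flatM _ _ 2 (size s)) => //.
  by apply: flat_comp => //; exact: flat_word_prod.
by apply: flatZ; apply: (@flatM _ _ 1 (size s).+1).
Unshelve. all: by end_near.
Qed.

(** Composition with [F] is diagonal on the degree-[d] graded piece in terms of words: subtracting
    [a] multiplies the coefficient of each word by its eigenvalue minus [a]. *)
Lemma flat_word_sum_comp d s a : homogeneous d s ->
  flat d.+1 (fun x => word_sum zeta s (F x) - a * word_sum zeta s x
    - word_sum zeta [seq (p.1 * (word_eigenvalue p.2 - a), p.2) | p <- s] x).
Proof.
elim: s => [|p s IH] /=.
  by under eq_fun do rewrite !word_sum_nil mulr0 !subr0; move=> _; exact: flat0.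
move=> /andP[/eqP sp hs].
apply: (@flat_ext _ _ _ (fun x => p.1 * (word_prod zeta p.2 (F x) -
    word_eigenvalue p.2 * word_prod zeta p.2 x) +
  (word_sum zeta s (F x) - a * word_sum zeta s x
    - word_sum zeta [seq (p.1 * (word_eigenvalue p.2 - a), p.2) | p <- s] x))).
  by near=> x; rewrite !word_sum_cons /=; ring.
apply: flatD; last exact: IH.
by apply: flatZ; rewrite -sp; exact: flat_word_prod_comp.
Unshelve. all: by end_near.
Qed.

(* Applying [F^* - word_eigenvalue I] removes the word [I] from the leading part
   of an eigenfunction and merely rescales the other terms. *)
Lemma flat_eigen_reduction d s t r L : homogeneous d s -> homogeneous d t ->
  all (fun p => word_eigenvalue p.2 == L) t ->
  flat d.+1 (fun x => r (F x) - L * r x) ->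
  flat d.+1 (fun x => r x - (word_sum zeta s x + word_sum zeta t x)) ->
  exists t', [/\ homogeneous d t', all (fun p => word_eigenvalue p.2 == L) t' &
    flat d.+1 (fun x => r x - word_sum zeta t' x)].
Proof.
have [k] := ubnP (size s); elim: k s t => // k IH [|p s] t sk hs ht et fr fst.
  by exists t; split => //; apply: flat_ext fst; near=> x; rewrite word_sum_nil add0r.
have [pL|pL] := eqVneq (word_eigenvalue p.2) L.
  move: hs => /= /andP[sp hs].
  apply: (IH s (p :: t)) => //=.
  - by rewrite sp.
  - by rewrite pL eqxx.
  by apply: flat_ext fst; near=> x; rewrite !word_sum_cons; congr (_ - _); ring.
have Lp0 : L - word_eigenvalue p.2 != 0 by rewrite subr_eq0 eq_sym.
pose a := word_eigenvalue p.2.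
(* Effect on words of composition with [F] minus [a], divided by [L - a]: it fixes [r] modulo order
   [d.+1], kills [p] and leaves the words of eigenvalue [L] alone. Coefficients are never compared,
   since permuted words give the same function. *)
pose g (q : C * seq 'I_m) := ((L - a)^-1 * (q.1 * (word_eigenvalue q.2 - a)), q.2).
have gE u x : word_sum zeta (map g u) x =
   (L - a)^-1 * word_sum zeta [seq (q.1 * (word_eigenvalue q.2 - a), q.2) | q <- u] x.
  rewrite /word_sum !big_map mulr_sumr; apply: eq_bigr => q _ /=.
  by rewrite !mulrA.
have hg u : homogeneous d u -> homogeneous d (map g u).
  by rewrite /homogeneous all_map.
have := hs => /= /andP[_ hs'].
apply: (IH (map g s) (map g t)) => //.
- by rewrite size_map.
- exact: hg.
- exact: hg.
- by rewrite all_map; apply: sub_all et.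
pose S x := word_sum zeta (p :: s) x + word_sum zeta t x.
have f1 : flat d.+1 (fun x => (r (F x) - S (F x)) - a * (r x - S x)).
  by apply: flatB; [exact: (flat_comp sF F0 fst)|exact: flatZ].
have f2 := flat_word_sum_comp a hs; have f3 := flat_word_sum_comp a ht.
have := flatZ (L - a)^-1 (flatD (flatB f1 fr) (flatD f2 f3)).
apply: flat_ext; near=> x.
rewrite !gE /S /= !word_sum_cons /= subrr mulr0 mul0r add0r.
by field.
Unshelve. all: by end_near.
Qed.

Lemma flat_eigen_leading_term d r L : flat d r ->
  flat d.+1 (fun x => r (F x) - L * r x) ->
  exists t, [/\ homogeneous d t, all (fun p => word_eigenvalue p.2 == L) t &
    flat d.+1 (fun x => r x - word_sum zeta t x)].
Proof.
move=> fr rL; have [s hs fs] := flat_word_expansion fz fP fr.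
apply: (flat_eigen_reduction (s := s) (t := [::])) => //.
by apply: flat_ext fs; near=> x; rewrite word_sum_nil addr0.
Unshelve. all: by end_near.
Qed.

Lemma formal_eigenfunction i N :
  (forall s, (2 <= size s)%N -> word_eigenvalue s != lam i) ->
  exists p, [/\ flat 1 p, flat 2 (fun x => p x - zeta i x) &
    flat N.+2 (fun x => p (F x) - lam i * p x)].
Proof.
move=> nres; elim: N => [|N [p [fp fpi fe]]].
  exists (zeta i); split => //.
  by apply: (@flat_ext _ _ _ (fun=> 0)); [near=> x; rewrite subrr|exact: flat0].
have [s hs fs] := flat_word_expansion fz fP fe.
(* Solution of the homological equation in degree [N.+2]. The divisors are nonzero because these
   words have at least two letters, and for the same reason the correction leaves the linear part
   [zeta i] unchanged. *)
pose g (q : C * seq 'I_m) := (q.1 / (word_eigenvalue q.2 - lam i), q.2).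
have hg : homogeneous N.+2 (map g s) by rewrite /homogeneous all_map.
exists (fun x => p x - word_sum zeta (map g s) x).
have fh := flat_word_sum fz hg; split.
- by apply: flatB => //; apply: flat_le fh.
- apply: (@flat_ext _ _ _ (fun x => (p x - zeta i x) - word_sum zeta (map g s) x)).
    by near=> x; ring.
  by apply: flatB => //; apply: flat_le fh.
have := flatB fs (flat_word_sum_comp (lam i) hg).
apply: flat_ext; near=> x.
have -> : word_sum zeta [seq (q.1 * (word_eigenvalue q.2 - lam i), q.2) | q <- map g s] x
   = word_sum zeta s x.
  rewrite /word_sum !big_map !big_seq; apply: eq_bigr => q qs /=.
  rewrite divfK // subr_eq0; apply: nres.
  by move: hs => /allP/(_ q qs)/eqP ->.
by ring.
Unshelve. all: by end_near.
Qed.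

End words.

(** * Convergence of the linearizing sequence *)

Section linearizing_series.
Variable R : realType.
Local Notation C := R[i].

(** The coefficients grow at most like [L ^+ i], while along orbits a germ of order [d] decays like
    the [i]-th power of [sigma ^+ d]; the product of the two rates is the ratio of the geometric
    bound. *)
Lemma iterated_term_bound m (F : 'rV[R]_m -> 'rV[R]_m) (g : 'rV[R]_m -> R)
    (a : nat -> R) (rho sigma A L : R) (d : nat) :
  contracting F rho -> 0 <= rho -> rho < sigma -> sigma < 1 ->
  smooth_near g 0 -> vanish d g -> 0 <= A -> 0 <= L ->
  (forall i, `|a i| <= A * L ^+ i) ->
  exists r K : R, [/\ 0 < r, 0 <= K & forall x, `|x| < r -> forall i,
      `|a i * g (iter i F x)| <= K * `|x| ^+ d * (L * sigma ^+ d) ^+ i].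
Proof.
move=> cF rho0 rs s1 sg vg A0 L0 ha.
have s0 : 0 <= sigma by rewrite (le_trans rho0) // ltW.
have [K0 K00 nK] := vanish_bound sg vg.
have [r [K [r0 Kpos h]]] := contracting_near cF rho0 rs s1 nK.
exists r, (A * K0 * K ^+ d); split => //.
  by rewrite !mulr_ge0 // exprn_ge0.
move=> x xr i; have [h1 h2] := h x xr i.
rewrite normrM.
have -> : A * K0 * K ^+ d * `|x| ^+ d * (L * sigma ^+ d) ^+ i =
   (A * L ^+ i) * (K0 * (K * sigma ^+ i * `|x|) ^+ d).
  by rewrite !exprMn -!exprM [(i * d)%N]mulnC; ring.
apply: ler_pM => //; apply: le_trans h1 _.
apply: ler_wpM2l => //; apply: lerXn2r; rewrite ?nnegrE //.
by rewrite !mulr_ge0 // exprn_ge0.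
Qed.


Section real_series.
Variables (m : nat) (F : 'rV[R]_m -> 'rV[R]_m) (rho sigma : R).
Hypotheses (cF : contracting F rho) (rho0 : 0 <= rho) (rs : rho < sigma)
  (s1 : sigma < 1).

(** An order of at least 2 makes the sum O(|x|^2), so adding it to an approximate eigenfunction does
    not change the differential at 0. *)
Lemma iterated_series_regular (g : 'rV[R]_m -> R) (a : nat -> R) (A L : R) N :
  flat_real N.+2 g -> 0 <= A -> 0 <= L -> L * sigma ^+ N.+2 < 1 ->
  (forall i, `|a i| <= A * L ^+ i) ->
  let S x := limn (series (fun i => a i * g (iter i F x))) in
  [/\ exists2 r : R, 0 < r & forall x, `|x| < r ->
        cvgn (series (fun i => a i * g (iter i F x))),
      forall k, exists U, [/\ open U, U 0 & Ck_on k U S],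
      S 0 = 0 & forall w, 'D_w S 0 = 0].
Proof.
move=> [sg vg] A0 L0 Ls ha S.
have s0 : 0 <= sigma by rewrite (le_trans rho0) // ltW.
have t0 : 0 <= L * sigma ^+ N.+2 by rewrite mulr_ge0 // exprn_ge0.
have [r [K [r0 K0 b]]] := iterated_term_bound cF rho0 rs s1 sg vg A0 L0 ha.
have t10 : 0 < 1 - L * sigma ^+ N.+2 by rewrite subr_gt0.
pose K' := K / (1 - L * sigma ^+ N.+2).
have K'0 : 0 <= K' by rewrite divr_ge0 // ltW.
have bS x : `|x| < r -> `|S x| <= K' * `|x| ^+ N.+2.
  move=> xr; have := geometric_lim_tail 0 t0 Ls (b x xr).
  by rewrite {2}/series /= big_geq // subr0 expr0 mulr1 mulrAC.
have S0 : S 0 = 0.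
  apply/eqP; rewrite -normr_eq0 eq_le normr_ge0 andbT.
  by have := bS 0; rewrite normr0 expr0n /= mulr0; apply.
split => //.
- by exists r => // x xr; exact: geometric_cvg t0 Ls (b x xr).
- by move=> k; exact: (Ck_near_iterated_series k cF rho0 rs s1 sg vg L0 Ls ha).
have lin0 : linear (fun _ : 'rV[R]_m => 0 : R) by move=> c u v; rewrite scaler0 addr0.
have c0 : continuous (to_linear lin0) by exact: (@cst_continuous 'rV[R]_m R 0).
move=> w; suff [_ ->] : differentiable S 0 /\ forall v, 'D_v S 0 = to_linear lin0 v by [].
apply: (eps_differentiable c0) => e e0.
have d0 : 0 < Num.min r (Num.min 1 (e / (K' + 1))).
  by rewrite !lt_min r0 ltr01 divr_gt0 // ltr_wpDl.
exists (Num.min r (Num.min 1 (e / (K' + 1)))) => // h.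
rewrite !lt_min => /andP[hr /andP[h1]].
rewrite ltr_pdivlMr ?ltr_wpDl // => he.
rewrite add0r S0 subr0 /to_linear subr0; apply: le_trans (bS h hr) _.
apply: (@le_trans _ _ (K' * `|h| ^+ 2)).
  rewrite ler_wpM2l // -[N.+2]addn2 exprD ler_piMl ?exprn_ge0 //.
  by rewrite exprn_ile1 // ltW.
rewrite expr2 mulrA ler_wpM2r // mulrC; apply: le_trans (ltW he).
by rewrite ler_wpM2l // lerDl.
Qed.

End real_series.

Definition clim (u : nat -> C) : C :=
  Complex (limn (fun k => complex.Re (u k))) (limn (fun k => complex.Im (u k))).

Definition ccvg (u : nat -> C) :=
  cvgn (fun k => complex.Re (u k)) /\ cvgn (fun k => complex.Im (u k)).

Lemma ccvgZ a u : ccvg u ->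
  ccvg (fun k => a * u k) /\ clim (fun k => a * u k) = a * clim u.
Proof.
move=> [c1 c2]; rewrite /ccvg /clim.
under [X in cvgn X]eq_fun do rewrite cReM.
under [X in _ /\ cvgn X]eq_fun do rewrite cImM.
under [X in Complex (limn X) _]eq_fun do rewrite cReM.
under [X in Complex _ (limn X)]eq_fun do rewrite cImM.
have h1 : (fun k => complex.Re a * complex.Re (u k) - complex.Im a * complex.Im (u k))
   @ \oo --> complex.Re (a * clim u).
  by rewrite cReM /=; apply: cvgB; apply: cvgMr.
have h2 : (fun k => complex.Re a * complex.Im (u k) + complex.Im a * complex.Re (u k))
   @ \oo --> complex.Im (a * clim u).
  by rewrite cImM /=; apply: cvgD; apply: cvgMr.
split; first by split; apply/cvg_ex; eexists; [exact: h1|exact: h2].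
by apply: complex_ext => /=; apply/cvg_lim.
Qed.

Lemma ccvg_shift j u : ccvg (fun k => u (k + j)%N) ->
  ccvg u /\ clim (fun k => u (k + j)%N) = clim u.
Proof.
move=> [c1 c2]; rewrite /ccvg /clim.
have h1 : (fun k => complex.Re (u k)) @ \oo --> limn (fun k => complex.Re (u (k + j)%N)).
  by rewrite -(cvg_shiftn j).
have h2 : (fun k => complex.Im (u k)) @ \oo --> limn (fun k => complex.Im (u (k + j)%N)).
  by rewrite -(cvg_shiftn j).
split; first by split; apply/cvg_ex; eexists; [exact: h1|exact: h2].
by apply: complex_ext => /=; apply/esym/cvg_lim.
Qed.

Lemma normc_ge_absRe (z : C) : `|complex.Re z| <= Normc.normc z.
Proof. by rewrite -lecR -[(Normc.normc z)%:C%C]/(`|z|) normc_ge_Re. Qed.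

Lemma normc_ge_absIm (z : C) : `|complex.Im z| <= Normc.normc z.
Proof.
have := normc_ge_absRe (z * 'i%C); rewrite ReiNIm normrN Normc.normcM.
by rewrite {2}/Normc.normc /= expr0n add0r expr1n sqrtr1 mulr1.
Qed.

Lemma normcX (z : C) k : Normc.normc (z ^+ k) = Normc.normc z ^+ k.
Proof.
elim: k => [|k IH]; first by rewrite !expr0 Normc.normc1.
by rewrite !exprS Normc.normcM IH.
Qed.

(** The sequence is rewritten as [p] plus the partial sums of a series in the defect [g], which
    vanishes to order [N.+2], and the regularity of iterated series applies. *)
Lemma linearizing_limit m (F : 'rV[R]_m -> 'rV[R]_m) (rho sigma : R) (lam : C)
    (p : 'rV[R]_m -> C) N :
  contracting F rho -> 0 <= rho -> rho < sigma -> sigma < 1 -> lam != 0 ->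
  Normc.normc lam^-1 * sigma ^+ N.+2 < 1 ->
  flat 1 p -> flat N.+2 (fun x => p (F x) - lam * p x) ->
  let v x k := lam^-1 ^+ k * p (iter k F x) in
  let psi x := clim (v x) in
  [/\ \forall x \near (0 : 'rV[R]_m), ccvg (v x),
      forall k, exists U, [/\ open U, U 0, Ck_on k U (fun x => complex.Re (psi x)) &
        Ck_on k U (fun x => complex.Im (psi x))],
      psi 0 = 0 &
      forall w, cderive w psi 0 = cderive w p 0].
Proof.
move=> cF rho0 rs s1 lam0 Ls fp fg v psi.
pose g x := p (F x) - lam * p x.
pose L : R := Normc.normc lam^-1; have L0 : 0 <= L.
  by apply: le_trans (normc_ge_absRe lam^-1).
pose a i := complex.Re (lam^-1 ^+ i.+1); pose b i := complex.Im (lam^-1 ^+ i.+1).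
have ha i : `|a i| <= L * L ^+ i.
  by rewrite -exprS /L -normcX; exact: normc_ge_absRe.
have hb i : `|b i| <= L * L ^+ i.
  by rewrite -exprS /L -normcX; exact: normc_ge_absIm.
(* Telescoping: consecutive terms of the sequence differ by [lam^-1 ^+ i.+1 * g (iter i F x)]. The
   exponent [i.+1] is why the coefficient bounds have the form [L * L ^+ i]. *)
have vE x k : v x k = p x + \sum_(0 <= i < k) lam^-1 ^+ i.+1 * g (iter i F x).
  elim: k => [|k IH]; first by rewrite big_geq // addr0 /v expr0 mul1r.
  rewrite big_nat_recr //= addrA -IH /v /g -iterS exprS.
  by field.
have [f1 f2] := fg.
have reg := iterated_series_regular cF rho0 rs s1.
(* Complex multiplication splits the series into four real ones: [T1 - T2] is the real part and
   [T3 + T4] the imaginary part of the correction to [p]. *)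
have [[r1 r10 c1] C1 S1 D1] := reg _ _ _ _ _ f1 L0 L0 Ls ha.
have [[r2 r20 c2] C2 S2 D2] := reg _ _ _ _ _ f2 L0 L0 Ls hb.
have [[r3 r30 c3] C3 S3 D3] := reg _ _ _ _ _ f2 L0 L0 Ls ha.
have [[r4 r40 c4] C4 S4 D4] := reg _ _ _ _ _ f1 L0 L0 Ls hb.
set T1 := (fun x => limn _) in C1 S1 D1.
set T2 := (fun x => limn _) in C2 S2 D2.
set T3 := (fun x => limn _) in C3 S3 D3.
set T4 := (fun x => limn _) in C4 S4 D4.
have {}S1 : T1 0 = 0 := S1.
have {}S2 : T2 0 = 0 := S2.
have {}S3 : T3 0 = 0 := S3.
have {}S4 : T4 0 = 0 := S4.
pose r := Num.min (Num.min r1 r2) (Num.min r3 r4).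
have r0 : 0 < r by rewrite !lt_min r10 r20 r30 r40.
have rr (x : 'rV[R]_m) : `|x| < r -> [/\ `|x| < r1, `|x| < r2, `|x| < r3 & `|x| < r4].
  by rewrite !lt_min => /andP[/andP[-> ->] /andP[-> ->]].
have ReL x : `|x| < r ->
    (fun k => complex.Re (v x k)) @ \oo --> complex.Re (p x) + (T1 x - T2 x).
  move=> /rr[x1 x2 x3 x4].
  rewrite (_ : (fun k => _) = (fun k => complex.Re (p x) +
    (series (fun i => a i * complex.Re (g (iter i F x))) k -
     series (fun i => b i * complex.Im (g (iter i F x))) k))).
    apply: cvgD; first exact: cvg_cst.
    by apply: cvgB; [exact: c1|exact: c2].
  apply/funext => k; rewrite vE cReD; congr (_ + _).
  rewrite /series /= -sumrB.
  by rewrite Re_sum; apply: eq_bigr => i _; rewrite cReM.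
have ImL x : `|x| < r ->
    (fun k => complex.Im (v x k)) @ \oo --> complex.Im (p x) + (T3 x + T4 x).
  move=> /rr[x1 x2 x3 x4].
  rewrite (_ : (fun k => _) = (fun k => complex.Im (p x) +
    (series (fun i => a i * complex.Im (g (iter i F x))) k +
     series (fun i => b i * complex.Re (g (iter i F x))) k))).
    apply: cvgD; first exact: cvg_cst.
    by apply: cvgD; [exact: c3|exact: c4].
  apply/funext => k; rewrite vE cImD; congr (_ + _).
  rewrite /series /= -big_split /=.
  by rewrite Im_sum; apply: eq_bigr => i _; rewrite cImM.
have RePsi x : `|x| < r -> complex.Re (psi x) = complex.Re (p x) + (T1 x - T2 x).
  by move=> xr; rewrite /psi /clim /=; apply/cvg_lim => //; exact: ReL.
have ImPsi x : `|x| < r -> complex.Im (psi x) = complex.Im (p x) + (T3 x + T4 x).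
  by move=> xr; rewrite /psi /clim /=; apply/cvg_lim => //; exact: ImL.
have [[[W1 [oW1 W10 sW1]] _] [[W2 [oW2 W20 sW2]] _]] := fp.
have nr : \forall x \near (0 : 'rV[R]_m), `|x| < r.
  by apply/nbhs_normP; exists r => // x; rewrite /= sub0r normrN.
have Ck k : exists U, [/\ open U, U 0, Ck_on k U (fun x => complex.Re (psi x)) &
        Ck_on k U (fun x => complex.Im (psi x))].
  have [U1 [oU1 U10 K1]] := C1 k; have [U2 [oU2 U20 K2]] := C2 k.
  have [U3 [oU3 U30 K3]] := C3 k; have [U4 [oU4 U40 K4]] := C4 k.
  pose U := (U1 `&` U2) `&` (U3 `&` U4) `&` (W1 `&` W2) `&` [set x | `|x| < r].
  have oU : open U by rewrite /U; do ?apply: openI => //; exact: open_norm_lt.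
  have subU x : U x -> [/\ U1 x, U2 x, U3 x & U4 x] /\ [/\ W1 x, W2 x & `|x| < r].
    by move=> [[[[? ?] [? ?]] [? ?]] ?].
  have N1 : Ck_on k U (fun x => - T2 x).
    apply: (Ck_on_ext (f := fun x => (cst (-1) : 'rV[R]_m -> R) x * T2 x)) => //.
      by move=> x _; rewrite mulN1r.
    apply: Ck_onM => //; first exact: Ck_on_cst.
    by apply: Ck_on_sub K2 => x /subU[[]].
  exists U; split => //.
  - by split => //=; rewrite normr0.
  - apply: (Ck_on_ext (f := fun x => complex.Re (p x) + (T1 x + - T2 x))) => //.
      by move=> x /subU[_ [_ _ xr]]; rewrite RePsi.
    apply: Ck_onD => //; first by apply: Ck_on_sub (sW1 k) => x /subU[_ []].
    by apply: Ck_onD => //; apply: Ck_on_sub K1 => x /subU[[]].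
  - apply: (Ck_on_ext (f := fun x => complex.Im (p x) + (T3 x + T4 x))) => //.
      by move=> x /subU[_ [_ _ xr]]; rewrite ImPsi.
    apply: Ck_onD => //; first by apply: Ck_on_sub (sW2 k) => x /subU[_ []].
    by apply: Ck_onD => //; [apply: Ck_on_sub K3 => x /subU[[]]|
      apply: Ck_on_sub K4 => x /subU[[]]].
have dT (T : 'rV[R]_m -> R) :
    (forall k, exists U, [/\ open U, U 0 & Ck_on k U T]) -> forall w, derivable T 0 w.
  move=> /(_ 1%N)[U [_ U0 [dU _]]] w; apply: diff_derivable; exact: dU.
have dp : forall w, derivable (fun x => complex.Re (p x)) 0 w /\
   derivable (fun x => complex.Im (p x)) 0 w.
  move=> w; split; apply: diff_derivable; apply: smooth_near_differentiable_at.
    by exists W1.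
  by exists W2.
have r00 : `|0 : 'rV[R]_m| < r by rewrite normr0.
split => //.
- apply: filterS nr => x xr.
  by split; apply/cvg_ex; eexists; [exact: ReL|exact: ImL].
- have p0 := flat_at0 fp.
  apply: complex_ext; first by rewrite RePsi // p0 S1 S2 /= subrr addr0.
  by rewrite ImPsi // p0 S3 S4 /= !addr0.
move=> w; apply: complex_ext => /=.
  rewrite (@near_eq_derive _ _ _ _ ((fun x => complex.Re (p x)) + (T1 - T2))).
    rewrite deriveD ?deriveB ?D1 ?D2 ?subrr ?addr0 //.
    + exact: dT.
    + exact: dT.
    + exact: (dp w).1.
    + by apply: derivableB; exact: dT.
  by apply: filterS nr => x xr; exact: RePsi.
rewrite (@near_eq_derive _ _ _ _ ((fun x => complex.Im (p x)) + (T3 + T4))).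
  rewrite deriveD ?[X in _ + X]deriveD ?D3 ?D4 ?addr0 //.
  + exact: dT.
  + exact: dT.
  + exact: (dp w).2.
  + by apply: derivableD; exact: dT.
by apply: filterS nr => x xr; exact: ImPsi.
Qed.

(* A germ that is invariant up to the factor [lam] and vanishes to an order at
   which the contraction beats [lam] is zero: iterate the equation. *)
Lemma flat_eigen_eq0 m (F : 'rV[R]_m -> 'rV[R]_m) (rho sigma : R) (lam : C)
    (f : 'rV[R]_m -> C) N :
  contracting F rho -> 0 <= rho -> rho < sigma -> sigma < 1 -> lam != 0 ->
  Normc.normc lam^-1 * sigma ^+ N < 1 -> flat N f ->
  (\forall x \near (0 : 'rV[R]_m), f (F x) = lam * f x) ->
  \forall x \near (0 : 'rV[R]_m), f x = 0.
Proof.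
move=> cF rho0 rs s1 lam0 Ls ff fe.
have s0 : 0 <= sigma by rewrite (le_trans rho0) // ltW.
have [K K0 nK] := flat_bound ff.
have [r [M [r0 M0 h]]] := contracting_near cF rho0 rs s1 (filterI nK fe).
apply/nbhs_normP; exists r => // x; rewrite /= sub0r normrN => xr.
have E k : f x = lam^-1 ^+ k * f (iter k F x).
  elim: k => [|k IH]; first by rewrite expr0 mul1r.
  have [[_ hk] _] := h x xr k.
  by rewrite {1}IH iterS hk exprS; field.
pose L : R := Normc.normc lam^-1; pose t : R := L * sigma ^+ N.
have L0 : 0 <= L by apply: le_trans (normc_ge_absRe lam^-1).
have t0 : 0 <= t by rewrite mulr_ge0 // exprn_ge0.
have bnd k : `|complex.Re (f x)| <= 2 * K * (M * `|x|) ^+ N * t ^+ k /\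
    `|complex.Im (f x)| <= 2 * K * (M * `|x|) ^+ N * t ^+ k.
  have [[[hR hI] _] hM] := h x xr k.
  have le1 : K * `|iter k F x| ^+ N <= K * (M * `|x|) ^+ N * sigma ^+ N ^+ k.
    rewrite -mulrA ler_wpM2l // -exprM mulnC exprM -exprMn.
    by apply: lerXn2r; rewrite ?nnegrE ?mulr_ge0 ?exprn_ge0 // mulrAC.
  have hL : Normc.normc (lam^-1 ^+ k) = L ^+ k by exact: normcX.
  have hl1 := normc_ge_absRe (lam^-1 ^+ k); have hl2 := normc_ge_absIm (lam^-1 ^+ k).
  rewrite hL in hl1 hl2.
  have tE : 2 * K * (M * `|x|) ^+ N * t ^+ k =
     L ^+ k * (K * (M * `|x|) ^+ N * sigma ^+ N ^+ k) +
     L ^+ k * (K * (M * `|x|) ^+ N * sigma ^+ N ^+ k).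
    rewrite /t [(L * _) ^+ k]exprMn.
    by move: ((M * `|x|) ^+ N) (L ^+ k) (sigma ^+ N ^+ k); clear => y z w; ring.
  rewrite (E k) cReM cImM tE; split.
    apply: le_trans (ler_normB _ _) _; rewrite !normrM.
    by apply: lerD; apply: ler_pM => //; apply: le_trans le1.
  apply: le_trans (ler_normD _ _) _; rewrite !normrM.
  by apply: lerD; apply: ler_pM => //; apply: le_trans le1.
pose B := 2 * K * (M * `|x|) ^+ N.
have B0 : 0 <= B by rewrite !mulr_ge0 ?exprn_ge0 ?mulr_ge0.
have zero (y : R) : (forall k, `|y| <= B * t ^+ k) -> y = 0.
  move=> hy; apply/eqP; rewrite -normr_eq0 eq_le normr_ge0 andbT.
  apply/ler_addgt0Pr => e e0; rewrite add0r.
  have B10 : 0 < B + 1 by rewrite ltr_wpDl.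
  have [k hk] := geometric_small t0 Ls (divr_gt0 e0 B10).
  apply: le_trans (hy k) _; rewrite mulrC.
  move: hk; rewrite ltr_pdivlMr // => /ltW; apply: le_trans.
  by rewrite ler_wpM2l ?exprn_ge0 // lerDl.
by apply: complex_ext; apply: zero => k; have [] := bnd k.
Qed.

End linearizing_series.

(** * Spectral data of the differential *)

Section diagonal_forms.
Variables (R : realType) (n : nat).
Local Notation C := R[i].
Variables (Y : 'M[R]_n) (W : 'M[C]_n) (lam : 'I_n -> C).
Hypothesis W_unit : W \in unitmx.
Hypothesis YW : complexify Y *m W = W *m diag_mx (\row_j lam j).

(** Derivative matrices act on row vectors from the right, so the columns of [W] are linear forms
    that [Y] multiplies by the [lam j]. *)
Definition diag_form (j : 'I_n) (x : 'rV[R]_n) : C :=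
  (map_mx (real_complex R) x *m W) 0 j.

Lemma diag_formE j x : diag_form j x = \sum_i real_complex R (x 0 i) * W i j.
Proof. by rewrite /diag_form mxE; apply: eq_bigr => i _; rewrite mxE. Qed.

Lemma diag_formD j x y : diag_form j (x + y) = diag_form j x + diag_form j y.
Proof. by rewrite /diag_form map_mxD mulmxDl mxE. Qed.

Lemma diag_form_eigen j x : diag_form j (x *m Y) = lam j * diag_form j x.
Proof.
rewrite /diag_form map_mxM -mulmxA -/(complexify Y) YW mulmxA mul_mx_diag !mxE.
by rewrite mulrC.
Qed.

Lemma coord_diag_form i (x : 'rV[R]_n) :
  real_complex R (x 0 i) = \sum_j invmx W j i * diag_form j x.
Proof.
transitivity ((map_mx (real_complex R) x *m W *m invmx W) 0 i).
  by rewrite mulmxK // mxE.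
by rewrite mxE; apply: eq_bigr => j _; rewrite mulrC.
Qed.

Lemma normc_sum I (s : seq I) (P : pred I) (f : I -> C) :
  Normc.normc (\sum_(i <- s | P i) f i) <= \sum_(i <- s | P i) Normc.normc (f i).
Proof.
elim/big_ind2 : _ => //; first by rewrite Normc.normc0.
move=> a b c d ab cd; apply: le_trans (le_normcD _ _) _; exact: lerD.
Qed.

Lemma normc_ge0 (z : C) : 0 <= Normc.normc z.
Proof. exact: le_trans (normc_ge_absRe z). Qed.

Lemma normc_real (x : R) : Normc.normc (real_complex R x) = `|x|.
Proof. by rewrite /Normc.normc /= expr0n addr0 sqrtr_sqr. Qed.

(** The predicate selects a part of the spectrum: [predT] gives the gauge adapted to [Y], other
    choices the stable or unstable component. Each form is merely scaled by [Y], so the rates are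
    exactly the moduli of the [lam j]. *)
Definition form_norm (P : pred 'I_n) (x : 'rV[R]_n) : R :=
  \sum_(j | P j) Normc.normc (diag_form j x).

Lemma form_norm_ge0 P x : 0 <= form_norm P x.
Proof. by apply: sumr_ge0 => j _; exact: normc_ge0. Qed.

Lemma form_normD P x y : form_norm P (x + y) <= form_norm P x + form_norm P y.
Proof.
rewrite -big_split /=; apply: ler_sum => j _.
by rewrite diag_formD; exact: le_normcD.
Qed.

Lemma form_norm_le P x : form_norm P x <= form_norm predT x.
Proof.
rewrite /form_norm [leRHS](bigID P) /= lerDl.
by apply: sumr_ge0 => j _; exact: normc_ge0.
Qed.

Lemma form_norm_equiv : exists c : R, [/\ 0 < c,
  forall x, `|x| <= c * form_norm predT x & forall x, form_norm predT x <= c * `|x|].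
Proof.
pose c1 := \sum_j \sum_i Normc.normc (W i j).
pose c2 := \sum_i \sum_j Normc.normc (invmx W j i).
have c10 : 0 <= c1 by do 2!apply: sumr_ge0 => ? _; exact: normc_ge0.
have c20 : 0 <= c2 by do 2!apply: sumr_ge0 => ? _; exact: normc_ge0.
exists (c1 + c2 + 1); split.
- by rewrite ltr_wpDl // addr_ge0.
- move=> x; apply: (@le_trans _ _ (c2 * form_norm predT x)); last first.
    rewrite ler_wpM2r ?form_norm_ge0 // -addrA [c2 + 1]addrC addrA.
    by rewrite lerDr addr_ge0.
  apply: rV_norm_le => [|i]; first by rewrite mulr_ge0 ?form_norm_ge0.
  rewrite -normc_real coord_diag_form.
  apply: le_trans (normc_sum _ _ _) _.
  apply: (@le_trans _ _ (\sum_j Normc.normc (invmx W j i) * form_norm predT x)).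
    apply: ler_sum => j _; rewrite Normc.normcM ler_wpM2l ?normc_ge0 //.
    rewrite /form_norm (bigD1 j) //= lerDl.
    by apply: sumr_ge0 => k _; exact: normc_ge0.
  rewrite -mulr_suml ler_wpM2r ?form_norm_ge0 //.
  rewrite /c2 [leRHS](bigD1 i) //= lerDl.
  by do 2!apply: sumr_ge0 => ? _; exact: normc_ge0.
- move=> x; apply: (@le_trans _ _ (c1 * `|x|)); last first.
    by rewrite ler_wpM2r // -addrA lerDl addr_ge0.
  rewrite /form_norm /c1 mulr_suml; apply: ler_sum => j _.
  rewrite diag_formE; apply: le_trans (normc_sum _ _ _) _.
  rewrite mulr_suml; apply: ler_sum => i _; rewrite Normc.normcM mulrC normc_real.
  by rewrite ler_wpM2l ?normc_ge0 //; exact: rV_coord_le.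
Qed.

(** The eigenvector [E] for [lam j0] is complex, but the vector sought must be real. Its conjugate
    is an eigenvector for the conjugate eigenvalue, of the same modulus, so every form with modulus
    at most 1 vanishes on both, hence on the real and imaginary parts of [E], one of which is
    nonzero. *)
Lemma unstable_vector j0 : 1 < Normc.normc (lam j0) ->
  exists2 x : 'rV[R]_n, x != 0 &
    forall i, Normc.normc (lam i) <= 1 -> diag_form i x = 0.
Proof.
move=> l1.
have eig (v : 'rV[C]_n) mu i : v *m complexify Y = mu *: v ->
    1 < Normc.normc mu -> Normc.normc (lam i) <= 1 -> (v *m W) 0 i = 0.
  move=> vY mu1 ui; have : (v *m W) 0 i * lam i = mu * (v *m W) 0 i.
    have : (v *m complexify Y *m W) 0 i = (v *m W *m diag_mx (\row_j lam j)) 0 i.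
      by rewrite -!mulmxA YW.
    by rewrite vY -scalemxAl mul_mx_diag !mxE => ->.
  move=> h; apply/eqP; have : (lam i - mu) * (v *m W) 0 i == 0.
    by rewrite mulrBl mulrC h subrr.
  rewrite mulf_eq0 => /orP[|//]; rewrite subr_eq0 => /eqP E.
  by move: ui; rewrite E leNgt mu1.
pose E := row j0 (invmx W).
have EY : E *m complexify Y = lam j0 *: E.
  have h : invmx W *m complexify Y = diag_mx (\row_j lam j) *m invmx W.
    have h : invmx W *m (complexify Y *m W) = diag_mx (\row_j lam j).
      by rewrite YW mulmxA mulVmx // mul1mx.
    by rewrite -h -!mulmxA mulmxV // mulmx1.
  by rewrite /E -row_mul h row_mul row_diag_mx -scalemxAl -rowE mxE.
pose E' := map_mx conjc E.
have E'Y : E' *m complexify Y = conjc (lam j0) *: E'.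
  have -> : complexify Y = map_mx conjc (complexify Y).
    by apply/matrixP => a b; rewrite !mxE conjc_real.
  by rewrite /E' -map_mxM EY map_mxZ.
have E0 : E != 0.
  apply/eqP => E0; have : (E *m W) 0 j0 = 1.
    by rewrite /E -row_mul mulVmx // !mxE eqxx.
  by rewrite E0 mul0mx mxE => /esym/eqP; rewrite oner_eq0.
have l1' : 1 < Normc.normc (conjc (lam j0)).
  by move: l1; case: (lam j0) => a b; rewrite /Normc.normc /= sqrrN.
have [Er0|Er0] := eqVneq (map_mx (@complex.Re R) E) 0; last first.
  exists (map_mx (@complex.Re R) E) => // i ui.
  have h : map_mx (real_complex R) (map_mx (@complex.Re R) E) = 2^-1 *: (E + E').
    by apply/rowP => k; rewrite !mxE ReJ_add mulrC.
  rewrite /diag_form h -scalemxAl mulmxDl mxE [X in _ * X]mxE.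
  by rewrite (eig _ _ _ EY) // (eig _ _ _ E'Y) // addr0 mulr0.
exists (map_mx (@complex.Im R) E).
  apply: contra E0 => /eqP Ei0; apply/eqP/rowP => k.
  move/rowP/(_ k): Er0; move/rowP/(_ k): Ei0; rewrite !mxE => h1 h2.
  exact: complex_ext.
move=> i ui.
have h : map_mx (real_complex R) (map_mx (@complex.Im R) E) = ('i%C / 2) *: (E' - E).
  by apply/rowP => k; rewrite !mxE ImJ_sub mulrC mulrA mulrAC.
rewrite /diag_form h -scalemxAl mulmxBl mxE [X in _ * X]mxE [X in _ * (_ + X)]mxE.
by rewrite (eig _ _ _ EY) // (eig _ _ _ E'Y) // subr0 mulr0.
Qed.

Variable F : 'rV[R]_n -> 'rV[R]_n.
Hypotheses (sF : forall j, smooth_near (fun y => F y 0 j) 0) (F0 : F 0 = 0).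
Hypothesis DF : forall v, 'D_v F 0 = v *m Y.

Lemma diag_contracting rho : (forall j, Normc.normc (lam j) <= rho) ->
  contracting F rho.
Proof.
move=> hl; split => //.
have [c [c0 h1 h2]] := form_norm_equiv.
exists (form_norm predT), c; split => //.
  by move=> x y; exact: form_normD.
move=> v; rewrite DF /form_norm mulr_sumr; apply: ler_sum => j _.
by rewrite diag_form_eigen Normc.normcM ler_wpM2r ?normc_ge0.
Qed.

Lemma flat_diag_form j : flat 1 (diag_form j).
Proof.
apply: (@flat_ext _ _ _ (fun x : 'rV[R]_n => \sum_i W i j * real_complex R (x 0 i))).
  by near=> x; rewrite diag_formE; apply: eq_bigr => i _; rewrite mulrC.
by apply: flat_sum => i; apply: flatZ; exact: flat_coord.
Unshelve. all: by end_near.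
Qed.

Lemma cderive_diag_form j x v : cderive v (diag_form j) x = diag_form j v.
Proof.
have dR (a : 'I_n -> R) : 'D_v (fun x : 'rV[R]_n => \sum_i x 0 i * a i) x =
    \sum_i v 0 i * a i.
  have -> : (fun x : 'rV[R]_n => \sum_i x 0 i * a i) =
      \sum_i (a i *: (fun x : 'rV[R]_n => x 0 i)).
    by apply/funext => y; rewrite fct_sumE; apply: eq_bigr => i _; rewrite mulrC.
  have dc i : derivable (fun x : 'rV[R]_n => x 0 i) x v.
    by apply: diff_derivable; exact: differentiable_coord.
  rewrite derive_sum; last by move=> i; exact: derivableZ.
  by apply: eq_bigr => i _; rewrite deriveZ // derive_coord mulrC.
have ReE y : complex.Re (diag_form j y) = \sum_i y 0 i * complex.Re (W i j).
  rewrite diag_formE Re_sum; apply: eq_bigr => i _.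
  by rewrite cReM /= mul0r subr0.
have ImE y : complex.Im (diag_form j y) = \sum_i y 0 i * complex.Im (W i j).
  rewrite diag_formE Im_sum; apply: eq_bigr => i _.
  by rewrite cImM /= mul0r addr0.
apply: complex_ext => /=.
  by under eq_fun do rewrite ReE; rewrite dR ReE.
by under eq_fun do rewrite ImE; rewrite dR ImE.
Qed.

(* Otherwise the cone in which the components with [|lam| > 1] dominate the other
   ones is invariant near 0 and orbits in it escape. *)
Lemma diag_form_stable j :
  (forall e : R, 0 < e -> exists2 d : R, 0 < d &
     forall x, `|x| < d -> forall k, `|iter k F x| < e) ->
  Normc.normc (lam j) <= 1.
Proof.
move=> stab; rewrite leNgt; apply/negP => lj.
pose u := [pred i | 1 < Normc.normc (lam i)].
have uj : u j by [].
(* The smallest modulus above 1 bounds from below the expansion of the whole unstable component. *)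
have [j0 uj0 minj0] := arg_minP (fun i => Normc.normc (lam i)) uj.
set sigma := Normc.normc (lam j0) in minj0.
have s1 : 1 < sigma by exact: uj0.
have [c [c0 lN Nl]] := form_norm_equiv.
pose Mu := form_norm u; pose Ms := form_norm (predC u).
have NE x : form_norm predT x = Mu x + Ms x by rewrite /form_norm (bigID u).
have Mu0 x : 0 <= Mu x by exact: form_norm_ge0.
have Ms0 x : 0 <= Ms x by exact: form_norm_ge0.
have dF : differentiable F 0.
  by apply: rV_differentiable => i; exact: smooth_near_differentiable_at.
(* Inside the cone the remainder is at most [2 * e * Mu x = (sigma - 1) / 2 * Mu x], which still
   leaves the growth factor [q = (1 + sigma) / 2 > 1]. *)
pose e := (sigma - 1) / 4.
have e0 : 0 < e by rewrite divr_gt0 // subr_gt0.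
have [d d0 hd] := differentiable_eps dF (divr_gt0 e0 (mulr_gt0 c0 c0)).
have rem x : `|x| < d -> form_norm predT (F x - x *m Y) <= e * (Mu x + Ms x).
  move=> xd; apply: le_trans (Nl _) _.
  have := hd x xd; rewrite add0r F0 subr0 DF => h.
  apply: le_trans (ler_wpM2l (ltW c0) h) _.
  rewrite mulrA; apply: (@le_trans _ _ (c * (e / (c * c)) * (c * (Mu x + Ms x)))).
    apply: ler_wpM2l; last by rewrite -NE; exact: lN.
    by apply: mulr_ge0; [|apply: divr_ge0; [|apply: mulr_ge0]]; exact: ltW.
  rewrite le_eqVlt; apply/orP; left; apply/eqP; field; by rewrite gt_eqF.
have MuY x : sigma * Mu x <= Mu (x *m Y).
  rewrite /Mu /form_norm mulr_sumr; apply: ler_sum => i ui.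
  by rewrite diag_form_eigen Normc.normcM ler_wpM2r ?normc_ge0 // minj0.
have MsY x : Ms (x *m Y) <= Ms x.
  rewrite /Ms /form_norm; apply: ler_sum => i ui.
  by rewrite diag_form_eigen Normc.normcM ler_piMl ?normc_ge0 // leNgt.
pose q := (1 + sigma) / 2.
have q1 : 1 < q by rewrite /q ltr_pdivlMr // mul1r -[2]/(1 + 1) ltrD2l.
have step x : `|x| < d -> Ms x <= Mu x -> q * Mu x <= Mu (F x) /\ Ms (F x) <= Mu (F x).
  move=> xd su; have hr := rem x xd.
  set r := F x - x *m Y in hr.
  have Fx : F x = x *m Y + r by rewrite /r addrC subrK.
  have h1 : sigma * Mu x <= Mu (F x) + e * (Mu x + Ms x).
    apply: le_trans (MuY x) _.
    have -> : x *m Y = F x + (- r) by rewrite Fx addrK.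
    apply: le_trans (form_normD _ _ _) _; rewrite lerD2l.
    apply: le_trans hr; apply: le_trans (form_norm_le _ _) _.
    rewrite /form_norm; apply: ler_sum => i _.
    rewrite /diag_form map_mxN mulNmx mxE -[leRHS]normcN //.
  have h2 : Ms (F x) <= Ms x + e * (Mu x + Ms x).
    rewrite Fx; apply: le_trans (form_normD _ _ _) _; apply: lerD; first exact: MsY.
    by apply: le_trans hr; exact: form_norm_le.
  have h3 : e * (Mu x + Ms x) <= (sigma - 1) / 2 * Mu x.
    apply: (@le_trans _ _ (e * (Mu x + Mu x))); first by rewrite ler_pM2l // lerD2l.
    by rewrite le_eqVlt /e; apply/orP; left; apply/eqP; field.
  have h4 : q * Mu x <= Mu (F x).
    rewrite -(lerD2r ((sigma - 1) / 2 * Mu x)).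
    apply: (@le_trans _ _ (sigma * Mu x)).
      by rewrite le_eqVlt /q; apply/orP; left; apply/eqP; field.
    by apply: le_trans h1 _; rewrite lerD2l.
  split => //; apply: le_trans h2 _; apply: le_trans h4.
  apply: le_trans (lerD su h3) _.
  by rewrite le_eqVlt /q; apply/orP; left; apply/eqP; field.
have [d' d'0 hd'] := stab d d0.
have grow x : `|x| < d' -> Ms x <= Mu x -> forall k,
    q ^+ k * Mu x <= Mu (iter k F x) /\ Ms (iter k F x) <= Mu (iter k F x).
  move=> xd su; elim=> [|k [IH1 IH2]]; first by rewrite expr0 mul1r.
  have [h1 h2] := step _ (hd' x xd k) IH2; split; last exact: h2.
  rewrite exprS -mulrA; apply: le_trans h1.
  by rewrite ler_pM2l // (lt_trans ltr01).
(* A small multiple of this vector has no stable component, so it starts in the cone; its unstable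
   component then grows by [q] at each step, which contradicts the confinement to the ball of radius
   [d]. *)
have [x0 x00 sx0] := unstable_vector uj0.
have nx0 : 0 < `|x0| by rewrite normr_gt0.
pose s := d' / 2 / `|x0|.
have s0 : 0 < s by rewrite !divr_gt0.
pose x := s *: x0.
have xd : `|x| < d'.
  rewrite normrZ gtr0_norm // /s divfK ?gt_eqF //.
  by rewrite ltr_pdivrMr // ltr_pMr ?ltr1n.
have Msx : Ms x = 0.
  rewrite /Ms /form_norm big1 // => i; rewrite /= -leNgt => ui.
  by rewrite /diag_form map_mxZ -scalemxAl mxE -/(diag_form i x0) sx0 // mulr0 Normc.normc0.
have Mux : 0 < Mu x.
  have := lN x; rewrite NE Msx addr0 => h.
  have : 0 < c * Mu x.
    by apply: lt_le_trans h; rewrite normr_gt0 scaler_eq0 negb_or x00 gt_eqF.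
  by rewrite pmulr_rgt0.
have q0 : 0 < q := lt_trans ltr01 q1.
have cd0 : 0 < c * d by rewrite mulr_gt0.
have [k hk] : exists k, q^-1 ^+ k < Mu x / (c * d).
  apply: geometric_small; rewrite ?invr_ge0 ?(ltW q0) //; first by rewrite invf_lt1.
  by rewrite divr_gt0.
have [|h1 _] := grow x xd _ k; first by rewrite Msx.
have : q ^+ k * Mu x <= c * d.
  apply: le_trans h1 _; apply: le_trans (form_norm_le _ _) _.
  apply: le_trans (Nl _) _; rewrite ler_pM2l //; exact/ltW/hd'.
rewrite leNgt => /negP; apply.
by move: hk; rewrite ltr_pdivlMr // exprVn ltr_pdivrMl ?exprn_gt0.
Qed.

End diagonal_forms.

(** * The complex exponential and a linear differential equation *)

Section complex_exponential.
Variable R : realType.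
Local Notation C := R[i].

Lemma cexpD (z w : C) : cexp (z + w) = cexp z * cexp w.
Proof.
case: z w => [a b] [c d]; rewrite /cexp /= expRD cosD sinD.
by apply: complex_ext => /=; ring.
Qed.

Lemma cexp0 : cexp (0 : C) = 1.
Proof. by rewrite /cexp /= expR0 cos0 sin0 mulr1 mulr0. Qed.

Lemma cexpN (z : C) : cexp (- z) * cexp z = 1.
Proof. by rewrite -cexpD addNr cexp0. Qed.

Lemma cexp_neq0 (z : C) : cexp z != 0.
Proof.
apply/eqP => h; have := cexpN z; rewrite h mulr0 => /esym/eqP.
by rewrite oner_eq0.
Qed.

(** Polar form: [acos] supplies the argument on the closed upper half plane, and its opposite on the
    lower one. *)
Lemma cexp_surj (z : C) : z != 0 -> exists mu, cexp mu = z.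
Proof.
move=> z0; pose r := Normc.normc z.
have r0 : 0 < r.
  rewrite lt_def normc_ge0 andbT; apply: contra z0 => /eqP/Normc.eq0_normc ->.
  by [].
have rE : r ^+ 2 = complex.Re z ^+ 2 + complex.Im z ^+ 2.
  rewrite /r; case: z {z0 r r0} => a b /=.
  by rewrite sqr_sqrtr // addr_ge0 // sqr_ge0.
pose x := complex.Re z / r.
have x1 : -1 <= x <= 1.
  rewrite -ler_norml normrM normfV (gtr0_norm r0) ler_pdivrMr // mul1r.
  exact: normc_ge_absRe.
have sx : sin (acos x) = `|complex.Im z| / r.
  rewrite sin_acos //.
  have -> : 1 - x ^+ 2 = (complex.Im z / r) ^+ 2.
    rewrite /x !expr_div_n rE; field.
    by rewrite -rE expf_neq0 // gt_eqF.
  by rewrite sqrtr_sqr normrM normfV (gtr0_norm r0).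
have [Iz|Iz] := leP 0 (complex.Im z).
  exists (Complex (ln r) (acos x)); rewrite /cexp /= lnK // sx acosK //.
  by apply: complex_ext => /=; rewrite ?(ger0_norm Iz) mulrC divfK // gt_eqF.
exists (Complex (ln r) (- acos x)); rewrite /cexp /= lnK // cosN sinN sx acosK //.
apply: complex_ext => /=; first by rewrite mulrC divfK // gt_eqF.
by rewrite (ltr0_norm Iz) mulNr opprK mulrC divfK // gt_eqF.
Qed.

(* The derivative of [exp (- mu t) (x + i y) - t w] vanishes. *)
Lemma linear_ode_solution (mu : C) (w : C) (x y : R -> R) :
  (forall t : R, is_derive t 1 x
    (complex.Re (mu * Complex (x t) (y t) + cexp (mu * real_complex R t) * w))) ->
  (forall t : R, is_derive t 1 y
    (complex.Im (mu * Complex (x t) (y t) + cexp (mu * real_complex R t) * w))) ->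
  forall t : R, Complex (x t) (y t) =
    cexp (mu * real_complex R t) * (Complex (x 0) (y 0) + real_complex R t * w).
Proof.
case: mu w => a b [u v] dx dy t.
pose E (t : R) := expR (- a * t); pose c (t : R) := cos (b * t).
pose s (t : R) := sin (b * t).
have dl (k r : R) : is_derive r 1 (fun t : R => k * t) k.
  have := is_deriveZ k (is_derive_id r 1).
  by move=> h; apply: (is_derive_eq h); rewrite /GRing.scale /= mulr1.
have dE (r : R) : is_derive r 1 E (E r * - a).
  exact: (is_derive1_comp (is_derive_expR (- a * r)) (dl (- a) r)).
have dc (r : R) : is_derive r 1 c (- s r * b).
  exact: (is_derive1_comp (is_derive_cos (b * r)) (dl b r)).
have ds (r : R) : is_derive r 1 s (c r * b).
  exact: (is_derive1_comp (is_derive_sin (b * r)) (dl b r)).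
have E1 r : E r * expR (a * r) = 1 by rewrite /E -expRD mulNr addNr expR0.
have cs r : c r ^+ 2 + s r ^+ 2 = 1 by rewrite /c /s cos2Dsin2.
pose p : R -> R := E * (c * x + s * y) - (fun t => u * t).
pose q : R -> R := E * (c * y - s * x) - (fun t => v * t).
have dp (r : R) : is_derive r 1 p 0.
  have := dx r; have := dy r.
  rewrite /= !mulr0 !subr0 !add0r -/(c r) -/(s r) => dyr dxr.
  have := is_deriveB (is_deriveM (dE r) (is_deriveD (is_deriveM (dc r) dxr)
    (is_deriveM (ds r) dyr))) (dl u r).
  move=> h; apply: (is_derive_eq h); rewrite /GRing.scale /= !fctE.
  move: (E1 r) (cs r); move: (E r) (expR (a * r)) (c r) (s r) (x r) (y r).
  (* The two relations e f = 1 and g^2 + h^2 = 1 are unknown to [ring]; they are brought in by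
     multiplying the last term by their left-hand sides. *)
  clear=> e f g h X Y h1 h2; rewrite -[X in _ - X]mulr1 -h1 -[e * f]mulr1 -h2; ring.
have dq (r : R) : is_derive r 1 q 0.
  have := dx r; have := dy r.
  rewrite /= !mulr0 !subr0 !add0r -/(c r) -/(s r) => dyr dxr.
  have := is_deriveB (is_deriveM (dE r) (is_deriveB (is_deriveM (dc r) dyr)
    (is_deriveM (ds r) dxr))) (dl v r).
  move=> h; apply: (is_derive_eq h); rewrite /GRing.scale /= !fctE.
  move: (E1 r) (cs r); move: (E r) (expR (a * r)) (c r) (s r) (x r) (y r).
  clear=> e f g h X Y h1 h2; rewrite -[X in _ - X]mulr1 -h1 -[e * f]mulr1 -h2; ring.
have E0 : E 0 = 1 by rewrite /E mulr0 expR0.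
have c0 : c 0 = 1 by rewrite /c mulr0 cos0.
have s0 : s 0 = 0 by rewrite /s mulr0 sin0.
have hp : E t * (c t * x t + s t * y t) - u * t = x 0.
  have := @is_derive_0_is_cst R p t 0 dp; rewrite /p !fctE => ->.
  by rewrite E0 c0 s0; ring.
have hq : E t * (c t * y t - s t * x t) - v * t = y 0.
  have := @is_derive_0_is_cst R q t 0 dq; rewrite /q !fctE => ->.
  by rewrite E0 c0 s0; ring.
rewrite /cexp /= !mulr0 subr0 add0r -/(c t) -/(s t) -hp -hq.
move: (E1 t) (cs t); move: (E t) (expR (a * t)) (c t) (s t) (x t) (y t).
clear=> e f g h X Y h1 h2; apply: complex_ext => /=.
  rewrite -[LHS]mulr1 -h1 -[X in X * _]mulr1 -h2; ring.
rewrite -[LHS]mulr1 -h1 -[X in X * _]mulr1 -h2; ring.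
Qed.

End complex_exponential.

(** * Simultaneous diagonalization of a one-parameter group of matrices *)

Section spectral_flow.
Variable R : realType.
Local Notation C := R[i].

Lemma diagonalizable_eigenbasis n (M : 'M[C]_n) : diagonalizable M ->
  exists (W : 'M[C]_n) (d : 'I_n -> C),
    W \in unitmx /\ M *m W = W *m diag_mx (\row_j d j).
Proof.
move=> [P uP /diagonalizable_forPex[D /simmxPp]].
have sP : stablemx P M by apply: submx_full; rewrite row_full_unit.
move=> /(_ sP) PM.
exists (invmx P), (fun j => D 0 j); rewrite unitmx_inv; split => //.
have -> : \row_j D 0 j = D by apply/rowP => j; rewrite mxE.
rewrite -[LHS]mul1mx -(mulVmx uP) -mulmxA; congr (_ *m _).
by rewrite mulmxA PM mulmxK.
Qed.

Lemma col_mulmx m n p (A : 'M[C]_(m, n)) (B : 'M[C]_(n, p)) j :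
  col j (A *m B) = A *m col j B.
Proof. by rewrite !colE mulmxA. Qed.

(** In eigencoordinates [(d i - nu)] sends the [i]-th entry of [w1] to that of [w2] and annihilates
    the latter, which is impossible unless it is 0. *)
Lemma diagonal_no_jordan n (M W : 'M[C]_n) (d : 'I_n -> C) nu (w1 w2 : 'cV[C]_n) :
  W \in unitmx -> M *m W = W *m diag_mx (\row_j d j) ->
  M *m w1 = nu *: w1 + w2 -> M *m w2 = nu *: w2 -> w2 = 0.
Proof.
move=> uW MW M1 M2.
have [c1 W1] : exists c1, w1 = W *m c1 by exists (invmx W *m w1); rewrite mulKVmx.
have [c2 W2] : exists c2, w2 = W *m c2 by exists (invmx W *m w2); rewrite mulKVmx.
have D1 : diag_mx (\row_j d j) *m c1 = nu *: c1 + c2.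
  apply: (can_inj (mulKmx uW)).
  by rewrite mulmxA -MW -mulmxA -W1 M1 mulmxDr -scalemxAr -W1 -W2.
have D2 : diag_mx (\row_j d j) *m c2 = nu *: c2.
  apply: (can_inj (mulKmx uW)).
  by rewrite mulmxA -MW -mulmxA -W2 M2 -scalemxAr -W2.
rewrite W2; suff -> : c2 = 0 by rewrite mulmx0.
apply/colP => i; rewrite mxE.
have e1 : d i * c1 i 0 = nu * c1 i 0 + c2 i 0.
  have := congr1 (fun M : 'cV[C]_n => M i 0) D1.
  by rewrite mul_diag_mx !mxE.
have e2 : d i * c2 i 0 = nu * c2 i 0.
  have := congr1 (fun M : 'cV[C]_n => M i 0) D2.
  by rewrite mul_diag_mx !mxE.
have := mulf_eq0 (d i - nu) (c2 i 0); rewrite mulrBl e2 subrr eqxx.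
move=> /esym/orP[|/eqP //]; rewrite subr_eq0 => /eqP E.
by apply: (@addrI _ (nu * c1 i 0)); rewrite addr0 -e1 E.
Qed.

Lemma no_jordan_diagonalizable n (B : 'M[C]_n) : (0 < n)%N ->
  (forall mu (w1 w2 : 'cV[C]_n),
     B *m w1 = mu *: w1 + w2 -> B *m w2 = mu *: w2 -> w2 = 0) ->
  diagonalizable B.
Proof.
case: n B => // n B _ noj; apply/diagonalizableP.
have [r rE] := closed_field_poly_normal (mxminpoly B).
move: rE; rewrite (monicP (mxminpoly_monic B)) scale1r => rE.
exists (undup r); first exact: undup_uniq.
(* The factor [q] collects the roots already treated, so that each step of the induction speaks of a
   full annihilating polynomial. *)
suff H (s : seq C) q : horner_mx B (q * \prod_(z <- s) ('X - z%:P)) = 0 ->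
    horner_mx B (q * \prod_(z <- undup s) ('X - z%:P)) = 0.
  apply: mxminpoly_min; rewrite -[\prod_(_ <- _) _]mul1r; apply: H.
  by rewrite mul1r -rE mx_root_minpoly.
elim: s q => [//|z s IH] q /=.
case: ifP => zs.
  rewrite big_cons => h; apply: IH.
  have sE : \prod_(y <- s) ('X - y%:P) =
      ('X - z%:P) * \prod_(y <- rem z s) ('X - y%:P).
    by rewrite (perm_big _ (perm_to_rem zs)) big_cons.
  rewrite sE in h *.
  set M := horner_mx B (q * \prod_(y <- rem z s) ('X - y%:P)).
  have E p : horner_mx B (('X - z%:P) * p) = (B - z%:M) *m horner_mx B p.
    by rewrite rmorphM rmorphB /= horner_mx_X horner_mx_C.
  have M1 : (B - z%:M) *m ((B - z%:M) *m M) = 0.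
    by rewrite /M -!E -[RHS]h; congr (horner_mx B _); ring.
  have -> : q * (('X - z%:P) * \prod_(y <- rem z s) ('X - y%:P)) =
     ('X - z%:P) * (q * \prod_(y <- rem z s) ('X - y%:P)) by ring.
  rewrite E -/M; apply/matrixP => i j.
  have := noj z (col j M) (col j ((B - z%:M) *m M)).
  have c1 : B *m col j M = z *: col j M + col j ((B - z%:M) *m M).
    by rewrite col_mulmx mulmxBl mul_scalar_mx addrC subrK.
  have c2 : B *m col j ((B - z%:M) *m M) = z *: col j ((B - z%:M) *m M).
    apply/eqP; rewrite -subr_eq0 -mul_scalar_mx -mulmxBl.
    by rewrite -col_mulmx M1; apply/eqP/colP => k; rewrite !mxE.
  by move=> /(_ c1 c2)/colP/(_ i); rewrite !mxE.
rewrite !big_cons => h; rewrite mulrA; apply: IH.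
by rewrite -mulrA.
Qed.

Variables (n : nat) (Yt : R -> 'M[R]_n).
Hypothesis n_gt0 : (0 < n)%N.
Hypothesis Yt0 : Yt 0 = 1%:M.
Hypothesis YtD : forall t s, Yt (t + s) = Yt s *m Yt t.
Hypothesis dYt : forall i j, derivable (fun t : R => Yt t i j) 0 1.

Definition flow_generator : 'M[R]_n := \matrix_(i, j) 'D_1 (fun t : R => Yt t i j) 0.

(** The group law carries differentiability from time 0 to every time. *)
Lemma is_derive_flow (t : R) i j :
  is_derive t 1 (fun s => Yt s i j) ((Yt t *m flow_generator) i j).
Proof.
pose f (h : R) := \sum_k Yt t i k * Yt h k j.
have fE : (fun s => Yt s i j) = (fun s => f (s + (- t))).
  apply/funext => s; have -> : Yt s = Yt t *m Yt (s - t) by rewrite -YtD subrK.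
  by rewrite mxE.
have fS : f = \sum_k (Yt t i k *: (fun h => Yt h k j)).
  by apply/funext => h; rewrite /f fct_sumE.
have df0 : derivable f 0 1.
  by rewrite fS; apply: derivable_sum => k; exact: derivableZ.
have Df0 : 'D_1 f 0 = (Yt t *m flow_generator) i j.
  rewrite fS derive_sum; last by move=> k; exact: derivableZ.
  by rewrite mxE; apply: eq_bigr => k _; rewrite deriveZ // mxE.
rewrite fE; have dt : differentiable f (t + (- t)).
  by rewrite subrr; apply/derivable1_diffP.
apply: DeriveDef; first by apply/diff_derivable; exact: differentiable_shift.
by rewrite derive_shift_arg subrr.
Qed.

(** With [w2 = 0] this is the flow of an eigenvector of the generator; otherwise [w1] and [w2] span
    a Jordan block, which shows in the secular term [t w2]. *)
Lemma flow_column_ode (mu : C) (w1 w2 : 'cV[C]_n) :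
  complexify flow_generator *m w1 = mu *: w1 + w2 ->
  (forall t : R, complexify (Yt t) *m w2 = cexp (mu * real_complex R t) *: w2) ->
  forall t : R, complexify (Yt t) *m w1 =
    cexp (mu * real_complex R t) *: (w1 + real_complex R t *: w2).
Proof.
move=> Aw1 Yw2 t; apply/colP => i.
pose x (s : R) := \sum_k Yt s i k * complex.Re (w1 k 0).
pose y (s : R) := \sum_k Yt s i k * complex.Im (w1 k 0).
have xyE s : Complex (x s) (y s) = (complexify (Yt s) *m w1) i 0.
  apply: complex_ext; rewrite mxE ?Re_sum ?Im_sum /=; apply: eq_bigr => k _.
    by rewrite mxE cReM /= mul0r subr0.
  by rewrite mxE cImM /= mul0r addr0.
have key (s : R) : (complexify (Yt s *m flow_generator) *m w1) i 0 =
    mu * Complex (x s) (y s) + cexp (mu * real_complex R s) * w2 i 0.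
  rewrite /complexify map_mxM -mulmxA -!/(complexify _) Aw1 mulmxDr -scalemxAr Yw2.
  by rewrite xyE !mxE.
have dsum (a : 'I_n -> R) (s : R) : is_derive s 1 (fun s => \sum_k Yt s i k * a k)
    (\sum_k (Yt s *m flow_generator) i k * a k).
  have -> : (fun s => \sum_k Yt s i k * a k) = \sum_k (a k *: (fun s => Yt s i k)).
    by apply/funext => r; rewrite fct_sumE; apply: eq_bigr => k _; rewrite mulrC.
  have h := is_derive_sum (fun k => is_deriveZ (a k) (is_derive_flow s i k)).
  by apply: (is_derive_eq h); apply: eq_bigr => k _; rewrite mulrC.
have dx (s : R) : is_derive s 1 x
    (complex.Re (mu * Complex (x s) (y s) + cexp (mu * real_complex R s) * w2 i 0)).
  apply: (is_derive_eq (dsum _ s)); rewrite -key mxE Re_sum.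
  by apply: eq_bigr => k _; rewrite [complexify _ _ _]mxE cReM /= mul0r subr0.
have dy (s : R) : is_derive s 1 y
    (complex.Im (mu * Complex (x s) (y s) + cexp (mu * real_complex R s) * w2 i 0)).
  apply: (is_derive_eq (dsum _ s)); rewrite -key mxE Im_sum.
  by apply: eq_bigr => k _; rewrite [complexify _ _ _]mxE cImM /= mul0r addr0.
rewrite -xyE (linear_ode_solution dx dy) xyE Yt0 /complexify map_mx1 mul1mx.
by rewrite !mxE.
Qed.

(** At time 1 the secular term would turn a Jordan block of the generator into one of [Yt 1]. So the
    generator is diagonalizable; its eigenbasis serves all times and its eigenvalues are the
    required exponents. *)
Lemma flow_spectrum : diagonalizable (complexify (Yt 1)) ->
  exists (W : 'M[C]_n) (mu : 'I_n -> C), W \in unitmx /\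
    forall t : R, complexify (Yt t) *m W =
      W *m diag_mx (\row_j cexp (mu j * real_complex R t)).
Proof.
move=> /diagonalizable_eigenbasis[W1 [d [uW1 dW1]]].
have eigen mu (w : 'cV[C]_n) : complexify flow_generator *m w = mu *: w ->
    forall t : R, complexify (Yt t) *m w = cexp (mu * real_complex R t) *: w.
  move=> Aw t; rewrite (flow_column_ode (mu := mu) (w2 := 0)) ?addr0 //.
    by rewrite scaler0 addr0.
  by move=> s; rewrite mulmx0 scaler0.
have [|W [mu [uW AW]]] :=
  @diagonalizable_eigenbasis _ (complexify flow_generator).
  apply: no_jordan_diagonalizable => // mu w1 w2 A1 A2.
  have h2 := eigen _ _ A2; have h1 := flow_column_ode A1 h2 1.
  have := diagonal_no_jordan uW1 dW1 (nu := cexp mu) (w1 := w1)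
    (w2 := cexp mu *: w2).
  have one : mu * real_complex R 1 = mu by rewrite rmorph1 mulr1.
  rewrite h1 one rmorph1 scale1r scalerDr => /(_ erefl).
  rewrite -scalemxAr h2 one => /(_ erefl)/eqP.
  by rewrite scaler_eq0 (negPf (cexp_neq0 mu)) => /eqP.
exists W, mu; split => // t.
apply/matrixP => i j.
have colM (M : 'M[C]_n) : (M *m W) i j = (M *m col j W) i 0.
  by rewrite -col_mulmx [RHS]mxE.
rewrite colM (eigen (mu j)).
  by rewrite mul_mx_diag !mxE mulrC.
rewrite -col_mulmx AW; apply/colP => k.
by rewrite mul_mx_diag !mxE mulrC.
Qed.

End spectral_flow.

(** * Localization and translation of C^k maps *)

Section Ck_localization.
Variable R : realType.
Implicit Types V W : normedModType R.

Lemma Ck_on_local V W k (U : set V) (f : V -> W) :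
  (forall x, U x -> exists2 U', U' x & Ck_on k U' f) -> Ck_on k U f.
Proof.
elim: k f => [|k IH] f h /=.
  by move=> x Ux; have [U' U'x] := h x Ux; exact.
split=> [x Ux|v]; first by have [U' U'x [df _]] := h x Ux; exact: df.
by apply: IH => x Ux; have [U' U'x [_ Df]] := h x Ux; exists U' => //; exact: Df.
Qed.

Lemma Ck_on_coord V m k (U : set V) (F : V -> 'rV[R]_m) j : open U ->
  Ck_on k U F -> Ck_on k U (fun x => F x 0 j).
Proof.
move=> oU; elim: k F => [|k IH] F.
  move=> /= cF x Ux.
  by apply: (@continuous_comp _ _ _ F (fun y : 'rV[R]_m => y 0 j)) => //;
    [exact: cF|exact: coord_continuous].
move=> [dF DF]; split=> [x Ux|v].
  apply: (@differentiable_comp _ _ _ _ F (fun y : 'rV[R]_m => y 0 j)).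
    exact: dF.
  exact: differentiable_coord.
apply: Ck_on_ext (IH _ (DF v)) => // x Ux.
by rewrite derive_mx ?mxE //; apply: diff_derivable; exact: dF.
Qed.

Lemma shift_continuous V (b : V) : continuous (fun y : V => y + b).
Proof. by move=> x; apply: cvgD; [exact: cvg_id|exact: cvg_cst]. Qed.

Lemma Ck_on_shift V W k (U : set V) (f : V -> W) b : open U -> Ck_on k U f ->
  Ck_on k [set x | U (x + b)] (fun x => f (x + b)).
Proof.
move=> oU; apply: (@Ck_on_affine _ _ _ _ k U f idfun) => //.
by move=> x; exact: cvg_id.
Qed.

Lemma open_shift V (U : set V) b : open U -> open [set x | U (x + b)].
Proof.
by apply: open_comp => x _; exact: shift_continuous.
Qed.

Lemma open_row_preimage V m (U : set V) (U' : set 'rV[R]_m) (F : V -> 'rV[R]_m) :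
  open U -> open U' ->
  (forall x, U x -> forall j, {for x, continuous (fun y => F y 0 j)}) ->
  open (U `&` F @^-1` U').
Proof.
move=> oU oU' cF; rewrite openE => y [Uy U'Fy]; apply: filterI.
  exact: open_nbhs_nbhs (conj oU Uy).
have cFy : {for y, continuous F} by apply: rV_cvg => j; exact: cF.
exact: (cFy _ (open_nbhs_nbhs (conj oU' U'Fy))).
Qed.

End Ck_localization.

(** * Eigenfunctions on the manifold *)

Section local_coordinates.
Variables (R : realType) (n : nat) (Q : smooth_manifold R n) (x0 : Q).
Local Notation C := R[i].

Definition base_chart : chart R n Q := chart_at x0.
Definition base_coord : 'rV[R]_n := chart_map base_chart x0.

(* The preferred chart at [x0], translated so that [x0] has coordinate [0]. *)
Definition loc (x : Q) : 'rV[R]_n := chart_map base_chart x - base_coord.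
Definition unloc (y : 'rV[R]_n) : Q := chart_inv base_chart (y + base_coord).

Lemma chart_invK (c : chart R n Q) y : chart_img c y -> chart_map c (chart_inv c y) = y.
Proof. by move=> [x cx <-]; rewrite chart_mapK. Qed.

Lemma loc0 : loc x0 = 0.
Proof. by rewrite /loc subrr. Qed.

Lemma unlocK x : chart_dom base_chart x -> unloc (loc x) = x.
Proof. by move=> cx; rewrite /unloc /loc subrK chart_mapK. Qed.

Lemma unloc0 : unloc 0 = x0.
Proof. by rewrite -loc0 unlocK //; exact: chart_at_dom. Qed.

Lemma base_img : chart_img base_chart base_coord.
Proof. by exists x0 => //; exact: chart_at_dom. Qed.

Definition loc_img : set 'rV[R]_n := [set y | chart_img base_chart (y + base_coord)].

Lemma open_loc_img : open loc_img.
Proof. by apply: open_shift; exact: chart_img_open. Qed.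

Lemma loc_img0 : loc_img 0.
Proof. by rewrite /loc_img /= add0r; exact: base_img. Qed.

Lemma locK y : loc_img y -> loc (unloc y) = y.
Proof. by move=> iy; rewrite /loc /unloc chart_invK // addrK. Qed.

Lemma near_loc_img : \forall y \near (0 : 'rV[R]_n), loc_img y.
Proof. exact: open_nbhs_nbhs (conj open_loc_img loc_img0). Qed.

Lemma near_dom : \forall x \near x0, chart_dom base_chart x.
Proof. exact: open_nbhs_nbhs (conj (@chart_dom_open _ _ _ _) (chart_at_dom x0)). Qed.

Lemma unloc_continuous y : loc_img y -> {for y, continuous unloc}.
Proof.
move=> iy.
suff h : {for y, continuous (chart_inv base_chart \o (fun y => y + base_coord))} by exact: h.
apply: continuous_comp; first exact: shift_continuous.
exact: chart_inv_continuous.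
Qed.

Lemma loc_continuous x : chart_dom base_chart x -> {for x, continuous loc}.
Proof. by move=> cx; apply: cvgB; [exact: chart_map_continuous|exact: cvg_cst]. Qed.

Lemma near_unloc (P : Q -> Prop) : (\forall x \near x0, P x) ->
  \forall y \near (0 : 'rV[R]_n), P (unloc y).
Proof. by move=> nP; apply: (unloc_continuous loc_img0); rewrite unloc0. Qed.

Lemma near_loc (P : 'rV[R]_n -> Prop) : (\forall y \near (0 : 'rV[R]_n), P y) ->
  \forall x \near x0, P (loc x).
Proof. by move=> nP; apply: (loc_continuous (chart_at_dom x0)); rewrite loc0. Qed.

Lemma flat_smooth_fun (psi : Q -> C) : smooth_fun psi ->
  flat 0 (fun y => psi (unloc y)).
Proof.
move=> spsi; have at0 := chart_at_atlas x0.
split; split => //; exists loc_img; split; try exact: open_loc_img;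
  try exact: loc_img0; move=> k.
  exact: Ck_on_shift (@chart_img_open _ _ _ base_chart) (spsi k _ at0).1.
exact: Ck_on_shift (@chart_img_open _ _ _ base_chart) (spsi k _ at0).2.
Qed.

Lemma fun_derivE (psi : Q -> C) v : smooth_fun psi ->
  fun_deriv psi x0 v = cderive v (fun y => psi (unloc y)) 0.
Proof.
move=> spsi; have [[dR _] [dI _]] := spsi 1%N _ (chart_at_atlas x0).
rewrite /fun_deriv /cderive /unloc.
rewrite (derive_shift_arg (fun y => complex.Re (psi (chart_inv base_chart y)))).
rewrite (derive_shift_arg (fun y => complex.Im (psi (chart_inv base_chart y)))).
by rewrite add0r !deriveE //; [exact: dI base_img|exact: dR base_img].
Qed.

Lemma chart_preimage_open (G : Q -> Q) (c d : chart R n Q) : continuous G ->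
  open [set y | chart_img c y /\ chart_dom d (G (chart_inv c y))].
Proof.
move=> cG; rewrite openE => y [iy dGy]; apply: filterI.
  exact: open_nbhs_nbhs (conj (@chart_img_open _ _ _ c) iy).
have cy : {for y, continuous (G \o chart_inv c)}.
  by apply: continuous_comp; [exact: chart_inv_continuous|exact: cG].
exact: (cy _ (open_nbhs_nbhs (conj (@chart_dom_open _ _ _ d) dGy))).
Qed.

Lemma smooth_map_loc (G : Q -> Q) (c : chart R n Q) : smooth_map G -> atlas Q c ->
  forall j, smooth_on [set y | chart_img c y /\ chart_dom base_chart (G (chart_inv c y))]
    (fun y => loc (G (chart_inv c y)) 0 j).
Proof.
move=> [cG sG] ac j k.
have oU := chart_preimage_open (c := c) (d := base_chart) cG.
have := Ck_on_coord j oU (sG c base_chart ac (chart_at_atlas x0) k) => h.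
apply: (Ck_on_ext oU _ (Ck_onD oU h (Ck_on_cst k _ (- base_coord 0 j)))) => y _.
by rewrite /loc !mxE.
Qed.

Variable (G : Q -> Q).
Hypotheses (sG : smooth_map G) (G0 : G x0 = x0).

Definition loc_map (y : 'rV[R]_n) : 'rV[R]_n := loc (G (unloc y)).

Lemma loc_map0 : loc_map 0 = 0.
Proof. by rewrite /loc_map unloc0 G0 loc0. Qed.

Lemma smooth_near_loc_map j : smooth_near (fun y => loc_map y 0 j) 0.
Proof.
have oU := chart_preimage_open (c := base_chart) (d := base_chart) sG.1.
exists [set y | [set y | chart_img base_chart y /\
  chart_dom base_chart (G (chart_inv base_chart y))] (y + base_coord)]; split.
- exact: open_shift.
- rewrite /= add0r; split; first exact: base_img.
  by rewrite chart_mapK ?G0; exact: chart_at_dom.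
- move=> k; apply: (@Ck_on_shift _ _ _ k _ (fun y => loc (G (chart_inv base_chart y)) 0 j)) => //.
  exact: smooth_map_loc sG (chart_at_atlas x0) j k.
Qed.

Lemma near_unloc_map : \forall y \near (0 : 'rV[R]_n),
  [/\ loc_img y, loc (unloc y) = y & unloc (loc_map y) = G (unloc y)].
Proof.
have h : \forall y \near (0 : 'rV[R]_n), chart_dom base_chart (G (unloc y)).
  apply: (near_unloc (P := fun x => chart_dom base_chart (G x))).
  by apply: (sG.1 x0); rewrite G0; exact: near_dom.
move: near_loc_img h; apply: filterS2 => y iy dy; split => //.
  exact: locK.
exact: unlocK.
Qed.

Lemma derive_loc_map v : 'D_v loc_map 0 = v *m mfd_deriv G x0.
Proof.
rewrite /mfd_deriv G0 mul_rV_lin1 /=.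
have oU := chart_preimage_open (c := base_chart) (d := base_chart) sG.1.
set f := chart_map _ \o G \o _.
have df : differentiable f base_coord.
  have [_ /(_ _ _ (chart_at_atlas x0) (chart_at_atlas x0) 1%N) [df _]] := sG.
  apply: df; split; first exact: base_img.
  by rewrite /base_coord chart_mapK ?G0; exact: chart_at_dom.
have E : loc_map = (fun y => f (y + base_coord)) + cst (- base_coord) by [].
have df' : differentiable (fun y => f (y + base_coord)) 0.
  by apply: differentiable_shift; rewrite add0r.
rewrite E deriveD ?derive_cst ?addr0.
- by rewrite derive_shift_arg add0r deriveE.
- exact: diff_derivable.
- exact: derivable_cst.
Qed.

End local_coordinates.

(** The exponent has the form [N.+2] because this is the order that [formal_eigenfunction]
    delivers. *)
Lemma contraction_order (R : realType) (z : R[i]) (sigma : R) : 0 <= sigma ->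
  sigma < 1 -> exists N, Normc.normc z * sigma ^+ N.+2 < 1.
Proof.
move=> s0 s1; have z1 : 0 < Normc.normc z + 1 by rewrite ltr_wpDl // normc_ge0.
have [|N hN] := @geometric_small _ sigma (Normc.normc z + 1)^-1 s0 s1.
  by rewrite invr_gt0.
exists N; apply: (@le_lt_trans _ _ ((Normc.normc z + 1) * sigma ^+ N)).
  apply: ler_pM; rewrite ?normc_ge0 ?exprn_ge0 // ?lerDl //.
  by rewrite -[N.+2]addn2 exprD ler_piMr ?exprn_ge0 // exprn_ile1 // ltW.
by rewrite -ltr_pdivlMl // mulr1.
Qed.

(** * From a neighbourhood of the fixed point to the whole basin *)

Section global_eigenfunctions.
Variables (R : realType) (n : nat) (Q : smooth_manifold R n) (x0 : Q) (G : Q -> Q).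
Local Notation C := R[i].
Hypotheses (sGk : forall k, smooth_map (iter k G)) (G0 : G x0 = x0).
Hypothesis basin : forall x (U : set Q), nbhs x0 U ->
  exists k0, forall k, (k0 <= k)%N -> U (iter k G x).

Local Notation loc := (@loc R n Q x0).
Local Notation unloc := (@unloc R n Q x0).
Local Notation F := (loc_map x0 G).

Lemma smooth_G : smooth_map G.
Proof. exact: (sGk 1). Qed.

Lemma eigen_iter (psi : Q -> C) lam k x : (forall x, psi (G x) = lam * psi x) ->
  psi (iter k G x) = lam ^+ k * psi x.
Proof.
move=> e; elim: k => [|k IH]; first by rewrite expr0 mul1r.
by rewrite iterS e IH exprS mulrA.
Qed.

Lemma eigen_eq0 (psi : Q -> C) lam : lam != 0 ->
  (forall x, psi (G x) = lam * psi x) ->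
  (\forall y \near (0 : 'rV[R]_n), psi (unloc y) = 0) -> forall x, psi x = 0.
Proof.
move=> lam0 e z x.
have nz : \forall x \near x0, psi x = 0.
  move: (near_dom x0) (near_loc x0 z).
  by apply: filterS2 => y dy; rewrite unlocK.
have [k /(_ k (leqnn k))] := basin x nz.
rewrite (eigen_iter _ _ e) => /eqP; rewrite mulf_eq0 expf_eq0 (negPf lam0) andbF /=.
by move/eqP.
Qed.

(** Near a point that [iter k G] brings close to [x0], [psi] is [lam^-1 ^+ k] times its local
    expression composed with [iter k G]. The neighbourhood [U] and the number [k] may depend on the
    order [r], since smoothness is checked one order at a time. *)
Lemma eigen_smooth (psi : Q -> C) lam : lam != 0 ->
  (forall x, psi (G x) = lam * psi x) ->
  (forall k, exists U, [/\ open U, U (0 : 'rV[R]_n),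
      Ck_on k U (fun y => complex.Re (psi (unloc y))) &
      Ck_on k U (fun y => complex.Im (psi (unloc y)))]) ->
  smooth_fun psi.
Proof.
move=> lam0 e reg r c ac.
have [U [oU U0 sR sI]] := reg r.
suff H y : chart_img c y -> exists2 U', U' y &
    Ck_on r U' (fun y => complex.Re (psi (chart_inv c y))) /\
    Ck_on r U' (fun y => complex.Im (psi (chart_inv c y))).
  by split; apply: Ck_on_local => y /H[U' U'y []]; exists U'.
move=> iy.
have nU : \forall x \near x0, chart_dom (base_chart x0) x /\ U (loc x).
  by apply: filterI; [exact: near_dom|apply: near_loc; exact: open_nbhs_nbhs (conj oU U0)].
have [k /(_ k (leqnn k))[dGy UGy]] := basin (chart_inv c y) nU.
have cont := (sGk k).1.
pose O1 := [set y | chart_img c y /\ chart_dom (base_chart x0) (iter k G (chart_inv c y))].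
have oO1 : open O1 by exact: chart_preimage_open.
pose H y := loc (iter k G (chart_inv c y)).
have sH j := smooth_map_loc x0 (sGk k) ac j.
have oU' : open (O1 `&` H @^-1` U).
  by apply: open_row_preimage => // z Oz j; exact: (sH j 0%N).
exists (O1 `&` H @^-1` U); first by split.
have sub1 : (O1 `&` H @^-1` U) `<=` O1 by move=> z [].
have RR : Ck_on r (O1 `&` H @^-1` U) (fun y => complex.Re (psi (unloc (H y)))).
  apply: (Ck_on_comp (U' := U) (f := fun y => complex.Re (psi (unloc y)))) => //.
    by move=> z [].
  by move=> j; apply: Ck_on_sub sub1 (sH j r).
have II : Ck_on r (O1 `&` H @^-1` U) (fun y => complex.Im (psi (unloc (H y)))).
  apply: (Ck_on_comp (U' := U) (f := fun y => complex.Im (psi (unloc y)))) => //.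
    by move=> z [].
  by move=> j; apply: Ck_on_sub sub1 (sH j r).
have E z : (O1 `&` H @^-1` U) z ->
    psi (chart_inv c z) = lam^-1 ^+ k * psi (unloc (H z)).
  move=> [[_ dz] _]; rewrite /H unlocK // (eigen_iter _ _ e) mulrA -exprMn mulVf //.
  by rewrite expr1n mul1r.
pose a : C := lam^-1 ^+ k.
have cM (b : R) (f : 'rV[R]_n -> R) : Ck_on r (O1 `&` H @^-1` U) f ->
    Ck_on r (O1 `&` H @^-1` U) (fun z => b * f z).
  by move=> Cf; apply: Ck_onM => //; exact: Ck_on_cst.
split.
  apply: (Ck_on_ext oU' _ (Ck_onD oU' (cM (complex.Re a) _ RR) (cM (- complex.Im a) _ II))).
  by move=> z Oz; rewrite (E z Oz) cReM mulNr.
apply: (Ck_on_ext oU' _ (Ck_onD oU' (cM (complex.Re a) _ II) (cM (complex.Im a) _ RR))).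
by move=> z Oz; rewrite (E z Oz) cImM.
Qed.

(** The chart conjugates [G] to [F] only near 0; contraction keeps orbits there, so one
    neighbourhood works for all [k]. *)
Lemma loc_orbit rho sigma : contracting F rho -> 0 <= rho -> rho < sigma -> sigma < 1 ->
  \forall y \near (0 : 'rV[R]_n), forall k, loc (iter k G (unloc y)) = iter k F y.
Proof.
move=> cF rho0 rs s1.
have [r [K [r0 K0 h]]] := contracting_near cF rho0 rs s1 (near_unloc_map smooth_G G0).
apply/nbhs_normP; exists r => // y; rewrite /= sub0r normrN => yr k.
suff -> : iter k G (unloc y) = unloc (iter k F y) by have [[_ -> _] _] := h y yr k.
elim: k => [//|k IH].
by rewrite iterS IH; have [[_ _ <-] _] := h y yr k.
Qed.

Lemma extend_eigenfunction rho sigma lam (p : 'rV[R]_n -> C) N :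
  contracting F rho -> 0 <= rho -> rho < sigma -> sigma < 1 -> lam != 0 ->
  Normc.normc lam^-1 * sigma ^+ N.+2 < 1 ->
  flat 1 p -> flat N.+2 (fun x => p (F x) - lam * p x) ->
  exists psi : Q -> C, [/\ smooth_fun psi, forall x, psi (G x) = lam * psi x &
    flat 2 (fun y => psi (unloc y) - p y)].
Proof.
move=> cF rho0 rs s1 lam0 Ls fp fg.
have [cv reg psi0 Dpsi] := linearizing_limit cF rho0 rs s1 lam0 Ls fp fg.
have orb := loc_orbit cF rho0 rs s1.
(* The formula makes sense on all of [Q]: while the orbit is outside the chart, [loc] takes
   irrelevant values, but orbits end up near [x0] and the limit depends only on the tail. *)
pose u x k := lam^-1 ^+ k * p (loc (iter k G x)).
pose psi x := clim (u x).
pose psil (y : 'rV[R]_n) := clim (fun k => lam^-1 ^+ k * p (iter k F y)).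
have uE : \forall y \near (0 : 'rV[R]_n),
    u (unloc y) = (fun k => lam^-1 ^+ k * p (iter k F y)).
  by apply: filterS orb => y oy; apply/funext => k; rewrite /u oy.
have psiE : \forall y \near (0 : 'rV[R]_n), psil y = psi (unloc y).
  by apply: filterS uE => y; rewrite /psi => ->.
have cu x : ccvg (u x).
  have ncv : \forall z \near x0, ccvg (u z).
    have cuE : \forall y \near (0 : 'rV[R]_n), ccvg (u (unloc y)).
      by move: cv uE; apply: filterS2 => y c1 ->.
    have := @near_loc _ _ _ x0 (fun y => ccvg (u (unloc y))) cuE; move: (near_dom x0).
    by apply: filterS2 => z dz; rewrite unlocK.
  (* The sequence at [iter m G x], rescaled by [lam^-1 ^+ m], is a tail of the sequence at [x]. *)
  have [m /(_ m (leqnn m)) cm] := basin x ncv.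
  have [c1 _] := ccvgZ (lam^-1 ^+ m) cm.
  suff h : (fun k => u x (k + m)%N) = (fun k => lam^-1 ^+ m * u (iter m G x) k).
    by apply: (ccvg_shift (j := m) _).1; rewrite h.
  by apply/funext => k; rewrite /u iterD exprD mulrA [X in X * _]mulrC.
have psiG x : psi (G x) = lam * psi x.
  have c1 : ccvg (fun k => u x (k + 1)%N).
    have -> : (fun k => u x (k + 1)%N) = (fun k => lam^-1 * u (G x) k).
      by apply/funext => k; rewrite /u addn1 iterSr exprS mulrA.
    exact: (ccvgZ _ (cu (G x))).1.
  have [_ E1] := ccvg_shift c1; have [_ E2] := ccvgZ lam c1.
  rewrite /psi -E1 -E2; congr clim; apply/funext => k.
  by rewrite /u addn1 iterSr exprS; field.
have spsi : smooth_fun psi.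
  apply: (eigen_smooth lam0 psiG) => k.
  have [U [oU U0 RR II]] := reg k.
  have [U' [oU' U'0] U'E] : exists2 U' : set 'rV[R]_n, open_nbhs (0 : 'rV[R]_n) U' &
      U' `<=` [set y | psil y = psi (unloc y)].
    by move: psiE; rewrite /prop_near1 nbhsE.
  exists (U `&` U'); split => //; first exact: openI.
    apply: (Ck_on_ext (f := fun y => complex.Re (psil y))); first exact: openI.
      by move=> y [_ /U'E E]; congr (complex.Re _).
    by apply: Ck_on_sub RR => y [].
  apply: (Ck_on_ext (f := fun y => complex.Im (psil y))); first exact: openI.
    by move=> y [_ /U'E E]; congr (complex.Im _).
  by apply: Ck_on_sub II => y [].
exists psi; split => //.
have f0 := flat_smooth_fun x0 spsi.
have fp0 : flat 0 p by exact: flat_le fp.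
have psi00 : psi (unloc 0) = 0 by rewrite -(nbhs_singleton psiE).
apply: flat2E.
- exact: flatB.
- by rewrite psi00 (flat_at0 fp) subrr.
move=> v; have := cderiveD v (flatB f0 fp0) fp0.
have -> : (fun x => psi (unloc x) - p x + p x) = (fun x => psi (unloc x)).
  by apply/funext => x; rewrite subrK.
have -> : cderive v (fun x => psi (unloc x)) 0 = cderive v p 0.
  rewrite -Dpsi; apply: complex_ext => /=; apply: near_eq_derive;
  apply: filterS psiE => y E; by [exact: (congr1 (@complex.Re R) (esym E))|
    exact: (congr1 (@complex.Im R) (esym E))].
by move=> /eqP; rewrite -subr_eq subrr => /eqP <-.
Qed.

Lemma word_prod_eigen m (psi : 'I_m -> Q -> C) (lam : 'I_m -> C) s x :
  (forall j x, psi j (G x) = lam j * psi j x) ->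
  word_prod psi s (G x) = word_eigenvalue lam s * word_prod psi s x.
Proof.
move=> e; rewrite /word_prod /word_eigenvalue -big_split /=.
by apply: eq_bigr => j _.
Qed.

Lemma word_sum_eigen m (psi : 'I_m -> Q -> C) (lam : 'I_m -> C) L t x :
  (forall j x, psi j (G x) = lam j * psi j x) ->
  all (fun p => word_eigenvalue lam p.2 == L) t ->
  word_sum psi t (G x) = L * word_sum psi t x.
Proof.
move=> e /allP tL; rewrite /word_sum mulr_sumr !big_seq; apply: eq_bigr => p pt.
by rewrite (word_prod_eigen _ _ e) (eqP (tL p pt)); ring.
Qed.

Section classification.
Variables (psi : 'I_n -> Q -> C) (lam : 'I_n -> C) (P : 'M[C]_n) (rho sigma : R).
Hypothesis psiG : forall j x, psi j (G x) = lam j * psi j x.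
Hypothesis fpsi : forall j, flat 1 (fun y => psi j (unloc y)).
Hypothesis fP : forall i, flat 2 (fun y : 'rV[R]_n =>
  real_complex R (y 0 i) - \sum_j P j i * psi j (unloc y)).
Hypotheses (cF : contracting F rho) (rho0 : 0 <= rho) (rs : rho < sigma)
  (s1 : sigma < 1).

Lemma eigen_near (phi : Q -> C) L : (forall x, phi (G x) = L * phi x) ->
  \forall y \near (0 : 'rV[R]_n), phi (unloc (F y)) = L * phi (unloc y).
Proof.
move=> e; apply: filterS (near_unloc_map smooth_G G0) => y [_ _ ->].
exact: e.
Qed.

Lemma eigen_flat_near d (phi : Q -> C) L : (forall x, phi (G x) = L * phi x) ->
  flat d (fun y => phi (unloc (F y)) - L * phi (unloc y)).
Proof.
move=> e; apply: (@flat_ext _ _ _ (fun=> 0)); last exact: flat0.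
by apply: filterS (eigen_near e) => y ->; rewrite subrr.
Qed.

Lemma eigen_leading_term d (phi : Q -> C) L : (forall x, phi (G x) = L * phi x) ->
  flat d (fun y => phi (unloc y)) ->
  exists t, [/\ homogeneous d t, all (fun p => word_eigenvalue lam p.2 == L) t &
    flat d.+1 (fun y => phi (unloc y) - word_sum psi t (unloc y))].
Proof.
move=> e fphi.
exact: (flat_eigen_leading_term (fun j => smooth_near_loc_map smooth_G G0 j)
  (loc_map0 G0) fpsi fP (fun j => eigen_flat_near 2 (psiG j)) fphi (eigen_flat_near _ e)).
Qed.

(** The order [N] depends on [L] alone, so it is fixed before any word is subtracted from an
    eigenfunction. *)
Lemma eigen_flat_eq0 (L : C) : L != 0 -> exists N, forall phi : Q -> C,
  (forall x, phi (G x) = L * phi x) -> flat N (fun y => phi (unloc y)) ->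
  forall x, phi x = 0.
Proof.
move=> L0; have s0 : 0 <= sigma by rewrite (le_trans rho0) // ltW.
have [N hN] := contraction_order L^-1 s0 s1.
exists N.+2 => phi e fphi; apply: (eigen_eq0 L0 e).
exact: (flat_eigen_eq0 cF rho0 rs s1 L0 hN fphi (eigen_near e)).
Qed.

Lemma eigen_word_sum (phi : Q -> C) L : L != 0 ->
  (forall x, phi (G x) = L * phi x) -> flat 0 (fun y => phi (unloc y)) ->
  exists s, forall x, phi x = word_sum psi s x.
Proof.
move=> L0 e fphi; have [N zN] := eigen_flat_eq0 L0.
have [s sL fs] : exists2 s, all (fun p => word_eigenvalue lam p.2 == L) s &
    flat N (fun y => phi (unloc y) - word_sum psi s (unloc y)).
  elim: N {zN} => [|d [s sL fs]].
    exists [::] => //; apply: (@flat_ext _ _ _ (fun y => phi (unloc y))) => //.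
    by near=> y; rewrite word_sum_nil subr0.
  (* The letters are genuine eigenfunctions on [Q], so subtracting words of eigenvalue [L] leaves an
     exact eigenfunction with factor [L], to which the next step applies. *)
  have e' x : phi (G x) - word_sum psi s (G x) = L * (phi x - word_sum psi s x).
    by rewrite e (word_sum_eigen _ psiG sL) mulrBr.
  have [t [_ tL ft]] := eigen_leading_term (phi := fun x => phi x - word_sum psi s x) e' fs.
  exists (s ++ t); first by rewrite all_cat sL.
  by apply: flat_ext ft; near=> y; rewrite word_sum_cat opprD addrA.
exists s => x; apply/eqP; rewrite -subr_eq0; apply/eqP.
apply: (zN (fun x => phi x - word_sum psi s x)) => // y.
by rewrite e (word_sum_eigen _ psiG sL) mulrBr.
Unshelve. all: by end_near.
Qed.

Lemma eigen_unique i (phi : Q -> C) : lam i != 0 ->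
  (forall s, (2 <= size s)%N -> word_eigenvalue lam s != lam i) ->
  (forall x, phi (G x) = lam i * phi x) -> flat 2 (fun y => phi (unloc y)) ->
  forall x, phi x = 0.
Proof.
move=> l0 nres e f2; have [N zN] := eigen_flat_eq0 l0.
apply: zN => //; apply: (@flat_le _ _ _ N.+2); first by rewrite -addn2 leq_addr.
elim: N => [//|d IH].
(* A word in the leading part would have at least two letters and eigenvalue [lam i]; nonresonance
   leaves only the empty sum, and the order of vanishing rises by one. *)
have [[|p t] [ht tL ft]] := eigen_leading_term e IH.
  by apply: flat_ext ft; near=> y; rewrite word_sum_nil subr0.
move: ht tL => /= /andP[/eqP sp _] /andP[pL _].
have sp2 : (2 <= size p.2)%N by rewrite sp.
by case/negP: (nres _ sp2); exact: pL.
Unshelve. all: by end_near.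
Qed.

End classification.
End global_eigenfunctions.

Section diag_form_germs.
Variables (R : realType) (n : nat) (Y : 'M[R]_n) (W : 'M[R[i]]_n) (lam : 'I_n -> R[i]).
Hypothesis W_unit : W \in unitmx.
Hypothesis YW : complexify Y *m W = W *m diag_mx (\row_j lam j).

Lemma flat_diag_form_map (F : 'rV[R]_n -> 'rV[R]_n) j :
  (forall j, smooth_near (fun y => F y 0 j) 0) -> F 0 = 0 ->
  (forall v, 'D_v F 0 = v *m Y) ->
  flat 2 (fun y => diag_form W j (F y) - lam j * diag_form W j y).
Proof.
move=> sF F0 DF.
have f0 : flat 0 (diag_form W j) by exact: flat_le (flat_diag_form W j).
have fF : flat 0 (fun y => diag_form W j (F y)) by exact: flat_comp.
have fl : flat 0 (fun y => lam j * diag_form W j y) by exact: flatZ.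
have d0 : diag_form W j 0 = 0 by exact: flat_at0 (flat_diag_form W j).
apply: flat2E; first exact: flatB.
  by rewrite F0 d0 mulr0 subrr.
move=> v; have := cderiveD v (flatB fF fl) fl.
have -> : (fun x => diag_form W j (F x) - lam j * diag_form W j x +
    lam j * diag_form W j x) = (fun x => diag_form W j (F x)).
  by apply/funext => x; rewrite subrK.
have -> : cderive v (fun x => lam j * diag_form W j x) 0 = lam j * diag_form W j v.
  (* The multiple is the [j]-th form of the scaled matrix, so its derivative is already known. *)
  have -> : (fun x => lam j * diag_form W j x) = diag_form (lam j *: W) j.
    apply/funext => x; rewrite !diag_formE mulr_sumr; apply: eq_bigr => i _.
    by rewrite !mxE; ring.
  rewrite cderive_diag_form !diag_formE mulr_sumr; apply: eq_bigr => i _.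
  by rewrite !mxE; ring.
have -> : cderive v (fun x => diag_form W j (F x)) 0 = lam j * diag_form W j v.
  rewrite -(diag_form_eigen YW) -DF -(cderive_diag_form W j 0) /cderive.
  have dF : differentiable F 0.
    by apply: rV_differentiable => i; exact: smooth_near_differentiable_at.
  have [[sr _] [si _]] := f0.
  apply: complex_ext => /=.
    rewrite -{2}F0 -(derive_comp (f := fun x => complex.Re (diag_form W j x))) //.
    by rewrite F0; exact: smooth_near_differentiable_at.
  rewrite -{2}F0 -(derive_comp (f := fun x => complex.Im (diag_form W j x))) //.
  by rewrite F0; exact: smooth_near_differentiable_at.
by move/eqP; rewrite -subr_eq subrr => /eqP <-.
Qed.

Lemma coord_flat (zeta : 'I_n -> 'rV[R]_n -> R[i]) i :
  (forall j, flat 2 (fun y => zeta j y - diag_form W j y)) ->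
  flat 2 (fun y : 'rV[R]_n =>
    real_complex R (y 0 i) - \sum_j invmx W j i * zeta j y).
Proof.
move=> fz; have := flat_sum (index_enum 'I_n) (fun j => flatZ (- invmx W j i) (fz j)).
apply: flat_ext; near=> y; rewrite (coord_diag_form W_unit) -sumrB.
by apply: eq_bigr => j _; ring.
Unshelve. all: by end_near.
Qed.

End diag_form_germs.

(** * Principal eigenfunctions at a stable hyperbolic fixed point *)

Section principal_eigenfunctions.
Variables (R : realType) (n : nat) (Q : smooth_manifold R n) (x0 : Q) (G : Q -> Q).
Local Notation C := R[i].
Hypotheses (sGk : forall k, smooth_map (iter k G)) (G0 : G x0 = x0).
Hypothesis basin : forall x (U : set Q), nbhs x0 U ->
  exists k0, forall k, (k0 <= k)%N -> U (iter k G x).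
Hypothesis stable : forall U : set Q, nbhs x0 U -> exists2 V, nbhs x0 V &
  forall x k, V x -> U (iter k G x).
Variables (W : 'M[C]_n) (lam : 'I_n -> C).
Hypothesis W_unit : W \in unitmx.
Hypothesis YW : complexify (mfd_deriv G x0) *m W = W *m diag_mx (\row_j lam j).
Hypothesis lam0 : forall j, lam j != 0.
Hypothesis lam1 : forall j, Normc.normc (lam j) != 1.
Hypothesis nonresonant : forall (s : seq 'I_n) i, (2 <= size s)%N ->
  word_eigenvalue lam s != lam i.

Local Notation loc := (@loc R n Q x0).
Local Notation unloc := (@unloc R n Q x0).
Local Notation F := (loc_map x0 G).

(** No contraction is available yet, since this lemma serves to establish it. It is Lyapunov
    stability that keeps the [G]-orbit in the chart domain, which makes the iterates of [F] the
    chart images of those of [G] at all times. *)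
Lemma stable_loc_map (e : R) : 0 < e -> exists2 d : R, 0 < d &
  forall y, `|y| < d -> forall k, `|iter k F y| < e.
Proof.
move=> e0; have sG := sGk 1.
have [r r0 hr] : exists2 r : R, 0 < r & forall y, `|y| < r ->
    [/\ loc_img x0 y, loc (unloc y) = y & unloc (F y) = G (unloc y)].
  have /nbhs_normP[r r0 h] := near_unloc_map sG G0.
  by exists r => // y yr; apply: h; rewrite /= sub0r normrN.
pose e' := Num.min e r.
have e'0 : 0 < e' by rewrite lt_min e0.
have nU : \forall x \near x0, chart_dom (base_chart x0) x /\ `|loc x| < e'.
  apply: filterI; first exact: near_dom.
  apply: (@near_loc _ _ _ x0 (fun y => `|y| < e')).
  by apply/nbhs_normP; exists e' => // y; rewrite /= sub0r normrN.
have [V nV hV] := stable nU.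
have /nbhs_normP[d d0 hd] := near_unloc nV.
exists (Num.min d e'); first by rewrite lt_min d0.
move=> y; rewrite lt_min => /andP[yd ye].
have Vy : V (unloc y) by apply: hd; rewrite /= sub0r normrN.
suff H k : iter k F y = loc (iter k G (unloc y)).
  by move=> k; rewrite H; have [_] := hV _ k Vy; rewrite lt_min => /andP[].
elim: k => [|k IH] /=.
  by have [|_ -> //] := hr y; move: ye; rewrite lt_min => /andP[].
have [dk] := hV _ k Vy; rewrite lt_min => /andP[_ kr].
by rewrite IH /loc_map unlocK.
Qed.

Lemma spectrum_lt1 j : Normc.normc (lam j) < 1.
Proof.
rewrite lt_neqAle lam1 /=; apply: (diag_form_stable W_unit YW (F := F)).
- exact: smooth_near_loc_map (sGk 1) G0.
- exact: loc_map0.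
- exact: derive_loc_map (sGk 1) G0.
- exact: stable_loc_map.
Qed.

Lemma spectral_bound : exists rho : R, [/\ 0 <= rho, rho < 1 &
  forall j, Normc.normc (lam j) <= rho].
Proof.
exists (\big[Order.max/0]_j Normc.normc (lam j)); split.
- apply: (big_ind (fun x : R => 0 <= x)) => // [x y x_ge0 _|j _]; last exact: normc_ge0.
  by rewrite le_max x_ge0.
- apply: (big_ind (fun x : R => x < 1)) => // [x y x1 y1|j _]; last exact: spectrum_lt1.
  by rewrite gt_max x1.
- by move=> j; exact: le_bigmax.
Qed.

Lemma contracting_loc_map : exists rho sigma : R,
  [/\ contracting F rho, 0 <= rho, rho < sigma & sigma < 1].
Proof.
have [rho [rho0 rho1 lr]] := spectral_bound.
exists rho, ((rho + 1) / 2); split => //; try lra.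
exact: (diag_contracting W_unit YW (smooth_near_loc_map (sGk 1) G0) (loc_map0 G0)
  (derive_loc_map (sGk 1) G0)).
Qed.

Lemma principal_eigenfunctions : exists psi : 'I_n -> Q -> C, forall j,
  [/\ smooth_fun (psi j), forall x, psi j (G x) = lam j * psi j x &
    flat 2 (fun y => psi j (unloc y) - diag_form W j y)].
Proof.
suff H j : exists psi : Q -> C, [/\ smooth_fun psi,
    forall x, psi (G x) = lam j * psi x &
    flat 2 (fun y => psi (unloc y) - diag_form W j y)].
  by have [psi h] := choice H; exists psi.
have [rho [sigma [cF rho0 rs s1]]] := contracting_loc_map.
have s0 : 0 <= sigma by rewrite (le_trans rho0) // ltW.
have [N hN] := contraction_order (lam j)^-1 s0 s1.
have sF := smooth_near_loc_map (sGk 1) G0.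
have [||||p [fp fpz fpN]] := @formal_eigenfunction _ _ _ sF (loc_map0 G0)
    (diag_form W) lam (invmx W) _ _ _ j N.
- exact: flat_diag_form.
- move=> i; apply: coord_flat => // k.
  by apply: (@flat_ext _ _ _ (fun=> 0)); [near=> y; rewrite subrr|exact: flat0].
- move=> k; apply: (flat_diag_form_map YW) => //; first exact: loc_map0.
  exact: derive_loc_map (sGk 1) G0.
- by move=> s ss; exact: nonresonant.
have [psi [spsi psiG fpsi]] := extend_eigenfunction sGk G0 basin cF rho0 rs s1
  (lam0 j) hN fp fpN.
exists psi; split => //.
apply: flat_ext (flatD fpsi fpz); near=> y; by rewrite addrA subrK.
Unshelve. all: by end_near.
Qed.

Variable psi : 'I_n -> Q -> C.
Hypothesis psi_smooth : forall j, smooth_fun (psi j).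
Hypothesis psiG : forall j x, psi j (G x) = lam j * psi j x.
Hypothesis psi_form : forall j, flat 2 (fun y => psi j (unloc y) - diag_form W j y).

Lemma principal_flat j : flat 1 (fun y => psi j (unloc y)).
Proof.
apply: flat_ext (flatD (flat_le (leqnSn 1) (psi_form j)) (flat_diag_form W j)).
by near=> y; rewrite subrK.
Unshelve. all: by end_near.
Qed.

Lemma principal_at0 j : psi j x0 = 0.
Proof. by rewrite -(unloc0 x0) (flat_at0 (principal_flat j)). Qed.

Lemma principal_fun_deriv j v : fun_deriv (psi j) x0 v = diag_form W j v.
Proof.
rewrite fun_derivE //.
have f0 : flat 0 (diag_form W j) by exact: flat_le (flat_diag_form W j).
have := cderiveD v (flat_le (leq0n 2) (psi_form j)) f0.
under eq_fun do rewrite subrK.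
by rewrite (flat_cderive0 _ (psi_form j)) add0r cderive_diag_form.
Qed.

Lemma principal_word_sum (phi : Q -> C) L : L != 0 ->
  (forall x, phi (G x) = L * phi x) -> smooth_fun phi ->
  exists s, forall x, phi x = word_sum psi s x.
Proof.
move=> L0 e sphi; have [rho [sigma [cF rho0 rs s1]]] := contracting_loc_map.
apply: (eigen_word_sum sGk G0 basin psiG principal_flat (fun i => coord_flat W_unit i psi_form)
  cF rho0 rs s1 L0 e).
exact: flat_smooth_fun.
Qed.

Lemma principal_unique i (phi : Q -> C) : (forall x, phi (G x) = lam i * phi x) ->
  flat 2 (fun y => phi (unloc y)) -> forall x, phi x = 0.
Proof.
move=> e f2; have [rho [sigma [cF rho0 rs s1]]] := contracting_loc_map.
apply: (eigen_unique sGk G0 basin psiG principal_flat (fun i => coord_flat W_unit i psi_form)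
  cF rho0 rs s1 (lam0 i) _ e f2).
by move=> s; exact: nonresonant.
Qed.

End principal_eigenfunctions.

Lemma diag_form_neq0 (R : realType) (n : nat) (W : 'M[R[i]]_n) j :
  W \in unitmx -> exists v, diag_form W j v != 0.
Proof.
move=> Wu; apply: contrapT => h.
have Z i : W i j = 0.
  apply/eqP/negP => Wij; apply: h; exists 'e_i.
  by apply/negP => /eqP; rewrite /diag_form map_delta_mx -rowE mxE => /eqP.
have : (invmx W *m W) j j = 0.
  by rewrite mxE big1 // => i _; rewrite Z mulr0.
by rewrite mulVmx // mxE eqxx => /eqP; rewrite oner_eq0.
Qed.

(** * Eigenbases and the characteristic polynomial *)

Section spectrum_of_eigenbasis.
Variables (F : fieldType) (n : nat) (M W : 'M[F]_n) (lam : 'I_n -> F).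
Hypotheses (W_unit : W \in unitmx) (MW : M *m W = W *m diag_mx (\row_j lam j)).

(** The intertwining relation lifts to the characteristic matrices over polynomials, where the
    nonzero constant det [W] cancels. *)
Lemma eigenbasis_char_poly : char_poly M = \prod_(j < n) ('X - (lam j)%:P).
Proof.
have <- : char_poly (diag_mx (\row_j lam j)) = \prod_(j < n) ('X - (lam j)%:P).
  rewrite char_poly_trig ?diag_mx_is_trig //.
  by apply: eq_bigr => j _; rewrite !mxE eqxx mulr1n.
pose WP := map_mx polyC W.
have : char_poly_mx M *m WP = WP *m char_poly_mx (diag_mx (\row_j lam j)).
  rewrite /char_poly_mx mulmxBl mulmxBr -!map_mxM MW; congr (_ - _).
  by rewrite scalar_mxC.
move/(congr1 (fun A => \det A)); rewrite !det_mulmx mulrC.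
apply: mulfI; rewrite det_map_mx polyC_eq0 -unitfE; exact: W_unit.
Qed.

Lemma eigenbasis_eigenvalue j : eigenvalue M (lam j).
Proof.
rewrite eigenvalue_root_char eigenbasis_char_poly (bigD1 j) //= rootM.
by rewrite root_XsubC eqxx.
Qed.

Lemma eigenbasis_neq0 j : M \in unitmx -> lam j != 0.
Proof.
move=> Mu; have : \det (diag_mx (\row_j lam j)) != 0.
  have : \det (M *m W) != 0.
    by rewrite det_mulmx mulf_neq0 // -unitfE.
  by rewrite MW det_mulmx mulf_eq0 negb_or => /andP[].
by rewrite det_diag (bigD1 j) //= mxE mulf_eq0 negb_or => /andP[].
Qed.

End spectrum_of_eigenbasis.

(** * From words to multi-indices *)

Section words_and_multi_indices.
Variable R : realType.
Local Notation C := R[i].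

Lemma prod_count_mem n (a : 'I_n -> C) (s : seq 'I_n) :
  \prod_(j <- s) a j = \prod_j a j ^+ count_mem j s.
Proof.
elim: s => [|i s IH]; first by rewrite big_nil big1.
rewrite big_cons IH [RHS](bigD1 i) //= eqxx exprS -mulrA.
rewrite [in LHS](bigD1 i) //=; congr (_ * (_ * _)).
by apply: eq_bigr => j ji; rewrite eq_sym (negPf ji).
Qed.

Lemma sum_count_mem n (s : seq 'I_n) : (\sum_j count_mem j s)%N = size s.
Proof.
elim: s => [|i s IH]; first by rewrite big1.
rewrite /= -IH [in LHS](bigD1 i) //= eqxx [in RHS](bigD1 i) //= addSn.
congr (_ + _).+1; apply: eq_bigr => j ji.
by rewrite eq_sym (negPf ji).
Qed.

Definition word_index n k (s : seq 'I_n) : multi_index n k :=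
  [ffun j => inord (count_mem j s)].

Lemma word_indexE n k (s : seq 'I_n) j : (size s <= k)%N ->
  word_index k s j = count_mem j s :> nat.
Proof.
by move=> sk; rewrite ffunE inordK // ltnS (leq_trans (count_size _ _)).
Qed.

Lemma mi_length_word n k (s : seq 'I_n) : (size s <= k)%N ->
  mi_length (word_index k s) = size s.
Proof.
move=> sk; rewrite -sum_count_mem; apply: eq_bigr => j _; exact: word_indexE.
Qed.

Lemma mi_power_word n k (Q : Type) (psi : 'I_n -> Q -> C) (s : seq 'I_n) x :
  (size s <= k)%N -> mi_power psi (word_index k s) x = word_prod psi s x.
Proof.
move=> sk; rewrite /word_prod prod_count_mem; apply: eq_bigr => j _.
by rewrite word_indexE.
Qed.

(** Words with the same letter counts are collected into one coefficient. The second family [psi']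
    is arbitrary, so that the conjugates can be put in its place. *)
Lemma word_sum_multi_index n (Q : Type) (s : seq (C * seq 'I_n)) :
  exists (k : nat) (c : multi_index n k -> multi_index n k -> C),
  forall (psi psi' : 'I_n -> Q -> C) x,
    word_sum psi s x = \sum_(l : multi_index n k)
      \sum_(m : multi_index n k | (mi_length l + mi_length m <= k)%N)
        c l m * mi_power psi l x * mi_power psi' m x.
Proof.
pose k := \max_(p <- s) size p.2.
have sk p : p \in s -> (size p.2 <= k)%N.
  by move=> ps; exact: (leq_bigmax_seq (F := fun p : C * seq 'I_n => size p.2)).
pose z : multi_index n k := [ffun=> ord0].
(* Only the zero multi-index is used for the second family; its power is the constant 1. *)
pose c (l m : multi_index n k) : C := if m == z then
  \sum_(p <- s | word_index k p.2 == l) p.1 else 0.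
have z0 : mi_length z = 0%N by rewrite /mi_length big1 // => j _; rewrite ffunE.
exists k, c => psi psi' x.
have cE l : \sum_(m : multi_index n k | (mi_length l + mi_length m <= k)%N)
    c l m * mi_power psi l x * mi_power psi' m x =
    \sum_(p <- s | word_index k p.2 == l) p.1 * word_prod psi p.2 x.
  have [lk|lk] := leqP (mi_length l) k.
    rewrite (bigD1 z) ?z0 ?addn0 //= big1 ?addr0 => [|m /andP[_ mz]]; last first.
      by rewrite /c (negPf mz) !mul0r.
    rewrite /c eqxx mulr_suml mulr_suml [LHS]big_seq_cond [RHS]big_seq_cond; apply: eq_bigr.
    move=> p /andP[ps /eqP <-]; rewrite mi_power_word ?sk //.
    by rewrite /mi_power big1 ?mulr1 // => j _; rewrite ffunE expr0.
  rewrite big1 => [|m lmk]; last first.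
    by move: lmk; rewrite leqNgt (leq_trans lk) // leq_addr.
  rewrite big_seq_cond big1 // => p /andP[ps /eqP pl]; move: lk.
  by rewrite -pl mi_length_word ?sk // ltnNge sk.
under eq_bigr do rewrite cE.
rewrite /word_sum (exchange_big_dep predT) //=; apply: eq_bigr => p _.
by rewrite (big_pred1 (word_index k p.2)) // => l; rewrite /= eq_sym.
Qed.

Lemma nonresonant_words n (Y : 'M[R]_n) (W : 'M[C]_n) (lam : 'I_n -> C)
    (s : seq 'I_n) i :
  infty_nonresonant Y -> W \in unitmx ->
  complexify Y *m W = W *m diag_mx (\row_j lam j) ->
  (2 <= size s)%N -> word_eigenvalue lam s != lam i.
Proof.
move=> nres Wu YW s2; apply/eqP => e.
have := nres lam (eigenbasis_char_poly Wu YW) i (fun j => count_mem j s).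
by rewrite sum_count_mem => /(_ s2); apply; rewrite -e /word_eigenvalue prod_count_mem.
Qed.

Lemma norm_normc (z : C) : `|z| = real_complex R (Normc.normc z).
Proof. by case: z. Qed.

Lemma cexp_nat (mu : C) k : cexp (mu * real_complex R k%:R) = cexp mu ^+ k.
Proof.
elim: k => [|k IH]; first by rewrite mulr0n rmorph0 mulr0 cexp0 expr0.
by rewrite -addn1 natrD rmorphD rmorph1 mulrDr cexpD mulr1 IH addn1 exprSr.
Qed.

End words_and_multi_indices.

Lemma delta_mulmx (R : pzRingType) n (A : 'M[R]_n) i j : (delta_mx (0 : 'I_1) i *m A) 0 j = A i j.
Proof. by rewrite -rowE mxE. Qed.

Lemma derive_slice (R : realType) (V W : normedModType R) (f : V * R -> W) v b t :
  'D_v (fun y => f (y, t)) b = 'D_(v, 0) f (b, t).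
Proof.
have E h : (h *: v + b, t) = h *: (v, 0) + (b, t) :> V * R.
  by congr (_, _); rewrite /= scaler0 add0r.
by rewrite /derive /comp /=; under eq_fun do rewrite E.
Qed.

(** * Discrete and continuous time *)

Section smooth_flows.
Variables (R : realType) (n : nat) (Q : smooth_manifold R n) (Phi : Q -> R -> Q).
Hypothesis sPhi : smooth_map_time Phi.

Let dom (c d : chart R n Q) := [set p : 'rV[R]_n * R |
  chart_img c p.1 /\ chart_dom d (Phi (chart_inv c p.1) p.2)].

Lemma open_flow_dom c d : open (dom c d).
Proof.
rewrite openE => -[y t] [/= iy dy]; apply: filterI.
  have : \forall p \near (y, t), chart_img c p.1.
    apply: (@cvg_fst _ _ (nbhs y) (nbhs t)).
    exact: open_nbhs_nbhs (conj (@chart_img_open _ _ _ c) iy).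
  by [].
have cp : {for (y, t), continuous
    ((fun q : Q * R => Phi q.1 q.2) \o (fun p => (chart_inv c p.1, p.2)))}.
  apply: continuous_comp; last exact: sPhi.1.
  have h1 : chart_inv c p.1 @[p --> (y, t)] --> chart_inv c y.
    apply: (@cvg_comp _ _ _ fst (chart_inv c) _ (nbhs y)); first exact: cvg_fst.
    exact: chart_inv_continuous.
  have h2 : p.2 @[p --> (y, t)] --> t by exact: cvg_snd.
  exact: (cvg_pair h1 h2).
exact: (cp _ (open_nbhs_nbhs (conj (@chart_dom_open _ _ _ d) dy))).
Qed.

Lemma insert_linear : linear (fun y : 'rV[R]_n => (y, 0 : R)).
Proof. by move=> a x y; rewrite /= ; congr (_, _); rewrite /= scaler0 addr0. Qed.

Lemma smooth_map_slice t : smooth_map (fun x => Phi x t).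
Proof.
split.
  move=> x; apply: (@continuous_comp _ _ _ (fun x => (x, t)) (fun q : Q * R => Phi q.1 q.2)).
    exact: (cvg_pair (@cvg_id _ (nbhs x)) (@cvg_cst _ t _ (nbhs x) _)).
  exact: sPhi.1.
move=> c d ac ad k.
have cl : continuous (to_linear insert_linear).
  by move=> y; exact: (cvg_pair (@cvg_id _ (nbhs y)) (@cvg_cst _ (0 : R) _ (nbhs y) _)).
pose L y := to_linear insert_linear y + (0, t).
have LE : L = fun y => (y, t).
  by apply/funext => y; rewrite /L /to_linear; congr (_, _); rewrite /= ?addr0 ?add0r.
have H : Ck_on k (dom c d \o L)
    ((fun p => chart_map d (Phi (chart_inv c p.1) p.2)) \o L) :=
  Ck_on_affine (0, t) (@open_flow_dom c d) cl (sPhi.2 c d ac ad k).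
by rewrite LE in H.
Qed.

Variable x0 : Q.
Hypothesis fixed : forall t, Phi x0 t = x0.

(** In the chart at [x0] an entry of the derivative of the time-[t] map is a partial derivative of
    the jointly smooth flow, itself differentiable along the line of times; joint regularity of
    order 2 is what enters. *)
Lemma derivable_flow_deriv i j :
  derivable (fun t => mfd_deriv (fun x => Phi x t) x0 i j) 0 1.
Proof.
set c := chart_at x0; set b := chart_map c x0.
pose f (p : 'rV[R]_n * R) := chart_map c (Phi (chart_inv c p.1) p.2).
have sf := sPhi.2 c c (chart_at_atlas x0) (chart_at_atlas x0).
have db t : dom c c (b, t).
  split; first by exists x0 => //; exact: chart_at_dom.
  by rewrite /= /b chart_mapK ?fixed; exact: chart_at_dom.
have E t : mfd_deriv (fun x => Phi x t) x0 i j = 'D_('e_i, 0) f (b, t) 0 j.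
  have -> : mfd_deriv (fun x => Phi x t) x0 i j =
      (delta_mx (0 : 'I_1) i *m mfd_deriv (fun x => Phi x t) x0) 0 j by rewrite delta_mulmx.
  rewrite /mfd_deriv fixed mul_rV_lin1 /= -/c -/b.
  have [_ /(_ c c (chart_at_atlas x0) (chart_at_atlas x0) 1%N) [df _]] := smooth_map_slice t.
  rewrite -deriveE; last by apply: df; exact: db.
  by congr (fun_of_matrix _ 0 j); exact: derive_slice.
under eq_fun do rewrite E.
apply: diff_derivable.
pose g (p : 'rV[R]_n * R) := 'D_('e_i, 0) f p 0 j.
apply: (@differentiable_comp _ _ _ _ (fun t => (b, t)) g).
  apply: differentiable_pair; first exact: differentiable_cst.
  by apply/derivable1_diffP; exact: derivable_id.
apply: (@differentiable_comp _ _ _ _ ('D_('e_i, 0) f) (fun y : 'rV[R]_n => y 0 j)).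
  by apply: ((sf 2%N).2 ('e_i, 0)).1; exact: db.
exact: differentiable_coord.
Qed.

End smooth_flows.

Section derivative_of_composite.
Variables (R : realType) (n : nat) (Q : smooth_manifold R n) (x0 : Q).

Lemma mulmx_ext (A B : 'M[R]_n) : (forall v : 'rV_n, v *m A = v *m B) -> A = B.
Proof. by move=> h; apply/row_matrixP => i; rewrite !rowE. Qed.

(** The action on row vectors reverses the factors of the chain rule; as both maps fix [x0], a
    single chart suffices. *)
Lemma mfd_deriv_comp (G H : Q -> Q) : smooth_map G -> smooth_map H ->
  smooth_map (G \o H) -> G x0 = x0 -> H x0 = x0 ->
  mfd_deriv (G \o H) x0 = mfd_deriv H x0 *m mfd_deriv G x0.
Proof.
move=> sG sH sGH G0 H0; apply: mulmx_ext => v.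
have GH0 : (G \o H) x0 = x0 by rewrite /= H0.
have <- : 'D_v (loc_map x0 (G \o H)) 0 = v *m mfd_deriv (G \o H) x0.
  exact: derive_loc_map.
have <- : 'D_('D_v (loc_map x0 H) 0) (loc_map x0 G) 0 =
    v *m (mfd_deriv H x0 *m mfd_deriv G x0).
  by rewrite (derive_loc_map sG G0) (derive_loc_map sH H0) mulmxA.
have dl (K : Q -> Q) : smooth_map K -> K x0 = x0 -> differentiable (loc_map x0 K) 0.
  move=> sK K0; apply: rV_differentiable => j.
  exact: smooth_near_differentiable_at (smooth_near_loc_map sK K0 j).
have -> : 'D_('D_v (loc_map x0 H) 0) (loc_map x0 G) 0 =
    'D_v (loc_map x0 G \o loc_map x0 H) 0.
  have d2 : differentiable (loc_map x0 G) (loc_map x0 H 0).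
    by rewrite (loc_map0 H0); exact: dl sG G0.
  by rewrite (derive_comp v (dl H sH H0) d2) (loc_map0 H0).
apply: near_eq_derive.
apply: filterS (near_unloc_map sH H0) => y [_ _ e].
by rewrite /= /loc_map /= -/(loc_map x0 H y) e.
Qed.

Lemma mfd_deriv_idfun (G : Q -> Q) : smooth_map G -> G =1 id ->
  mfd_deriv G x0 = 1%:M.
Proof.
move=> sG Gid; apply: mulmx_ext => v; rewrite -derive_loc_map ?Gid // mulmx1.
rewrite -[RHS](derive_id 0 v); apply: near_eq_derive.
apply: filterS (near_unloc_map sG (Gid x0)) => y [_ e _].
by rewrite /loc_map Gid e.
Qed.

End derivative_of_composite.

(** * Reduction to the time-one map *)

Section time_one_map.
Variables (R : realType) (n : nat) (Q : smooth_manifold R n) (T : time_kind).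
Variables (Phi : Q -> time R T -> Q) (x0 : Q).
Local Notation C := R[i].
Local Notation G := (fun x => Phi x 1).
Hypothesis Phi_system : dynamical_system Phi.
Hypothesis sPhi : forall t, smooth_map (fun x => Phi x t).
Hypothesis Phi_basin : attracting_hyperbolic_basin Phi x0.

Lemma time_val1 : time_val (1 : time R T) = 1.
Proof. by case: T. Qed.

Lemma time_le_nat (t : time R T) : exists k0 : nat, forall k, (k0 <= k)%N -> t <= k%:R.
Proof.
case: T t => /= t.
  exists `|t|%N => k; rewrite -(ler_nat int) => tk; apply: le_trans tk.
  by rewrite natz; exact: lez_abs.
exists (Num.bound t) => k; rewrite -(ler_nat R) => tk; apply: le_trans tk.
have [t0|t0] := leP 0 t; first exact: ltW (archi_boundP t0).
by apply: le_trans (ltW t0) _; exact: ler0n.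
Qed.

Lemma iter_time_one k x : iter k G x = Phi x k%:R.
Proof.
elim: k => [|k IH]; first by rewrite Phi_system.1.
by rewrite iterS IH -Phi_system.2 -natr1 addrC.
Qed.

Lemma smooth_iter_time_one k : smooth_map (iter k G).
Proof.
have -> : iter k G = fun x => Phi x k%:R by apply/funext => x; exact: iter_time_one.
exact: sPhi.
Qed.

Lemma time_one_basin x (U : set Q) : nbhs x0 U ->
  exists k0, forall k, (k0 <= k)%N -> U (iter k G x).
Proof.
have [_ _ cv _] := Phi_basin; move=> nU; have [t0 ht] := cv x U nU.
have [k0 hk] := time_le_nat t0; exists k0 => k kk; rewrite iter_time_one.
by apply: ht; exact: hk.
Qed.

Lemma time_one_stable (U : set Q) : nbhs x0 U -> exists2 V, nbhs x0 V &
  forall x k, V x -> U (iter k G x).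
Proof.
have [_ [st _] _ _] := Phi_basin; move=> nU; have [V nV hV] := st U nU.
by exists V => // x k Vx; rewrite iter_time_one; apply: hV => //; exact: ler0n.
Qed.

Variables (W : 'M[C]_n) (mu : 'I_n -> C).
Hypothesis W_unit : W \in unitmx.
Hypothesis YW : complexify (time_one_deriv Phi x0) *m W =
  W *m diag_mx (\row_j cexp (mu j)).
Hypothesis nonresonant : infty_nonresonant (time_one_deriv Phi x0).

Let lam j := cexp (mu j).

Lemma time_one_fixed : Phi x0 1 = x0.
Proof. by have [fx _ _ _] := Phi_basin. Qed.

Lemma time_one_normc j : Normc.normc (lam j) != 1.
Proof.
have [_ _ _ /(_ (lam j) (eigenbasis_eigenvalue W_unit YW j))] := Phi_basin.
by rewrite norm_normc; apply: contra => /eqP ->; rewrite rmorph1.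
Qed.

Lemma time_one_nonresonant (s : seq 'I_n) i : (2 <= size s)%N ->
  word_eigenvalue lam s != lam i.
Proof. exact: nonresonant_words nonresonant W_unit YW. Qed.

Lemma time_one_unique (psi : 'I_n -> Q -> C) i (phi : Q -> C) :
  (forall j x, psi j (Phi x 1) = lam j * psi j x) ->
  (forall j, flat 2 (fun y => psi j (unloc x0 y) - diag_form W j y)) ->
  (forall x, phi (Phi x 1) = lam i * phi x) ->
  flat 2 (fun y => phi (unloc x0 y)) -> forall x, phi x = 0.
Proof.
move=> psiG psif.
exact: (principal_unique smooth_iter_time_one time_one_fixed time_one_basin
  time_one_stable W_unit YW (fun j => cexp_neq0 (mu j)) time_one_normc
  time_one_nonresonant psiG psif).
Qed.

(** Discrete and continuous time differ only in the passage from the relation at time 1 to the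
    relation at all times, which is isolated as the premise. *)
Lemma principal_eigenfunction_basis :
  (forall psi : 'I_n -> Q -> C,
    (forall j x, psi j (Phi x 1) = lam j * psi j x) ->
    (forall j, flat 2 (fun y => psi j (unloc x0 y) - diag_form W j y)) ->
    forall j t x,
      psi j (Phi x t) = cexp (mu j * real_complex R (time_val t)) * psi j x) ->
  exists psi : 'I_n -> Q -> C,
    (forall j, principal_eigenfunction Phi x0 (psi j) /\ smooth_fun (psi j)) /\
    forall phi : Q -> C, koopman_eigenfunction Phi phi -> smooth_fun phi ->
      exists s, forall x, phi x = word_sum psi s x.
Proof.
move=> koopman.
have [psi hpsi] := principal_eigenfunctions smooth_iter_time_one time_one_fixed
  time_one_basin time_one_stable W_unit YW (fun j => cexp_neq0 (mu j)) time_one_normc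
  time_one_nonresonant.
have psi_smooth j : smooth_fun (psi j) by have [] := hpsi j.
have psiG j x : psi j (Phi x 1) = lam j * psi j x by have [_ ->] := hpsi j.
have psi_form j : flat 2 (fun y => psi j (unloc x0 y) - diag_form W j y).
  by have [] := hpsi j.
exists psi; split=> [j|phi [_ [mu' e]] sphi].
  split=> //; have [v v0] := diag_form_neq0 j W_unit.
  have D : fun_deriv (psi j) x0 v <> 0.
    by rewrite (principal_fun_deriv psi_smooth psi_form); exact/eqP.
  split; [exact: psi_smooth| |exact: (principal_at0 psi_form)|by exists v].
  split; last by exists (mu j) => t x; exact: koopman.
  (* An identically zero function would have zero differential at [x0], whereas this differential is
     a nonzero eigenform. *)
  apply: contrapT => h; apply: D.
  have z x : psi j x = 0 by apply: contrapT => zx; apply: h; exists x.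
  rewrite /fun_deriv; apply: complex_ext => /=.
    by under eq_fun do rewrite z; rewrite diff_cst.
  by under eq_fun do rewrite z; rewrite diff_cst.
apply: (principal_word_sum smooth_iter_time_one time_one_fixed time_one_basin
  time_one_stable W_unit YW time_one_normc psiG psi_form (cexp_neq0 mu') _ sphi).
by move=> x; rewrite e time_val1 rmorph1 mulr1.
Qed.

End time_one_map.

Lemma koopman_discrete (R : realType) (Q : Type) (Phi : Q -> int -> Q)
    (psi : Q -> R[i]) (mu : R[i]) :
  @dynamical_system R discrete_time Q Phi ->
  (forall x, psi (Phi x 1) = cexp mu * psi x) ->
  forall (t : int) x, psi (Phi x t) = cexp (mu * real_complex R t%:~R) * psi x.
Proof.
move=> [Phi0 PhiD] e.
have H (k : nat) x : psi (Phi x k) = cexp (mu * real_complex R k%:R) * psi x.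
  elim: k => [|k IH]; first by rewrite Phi0 mulr0n rmorph0 mulr0 cexp0 mul1r.
  by rewrite intS PhiD e IH !cexp_nat exprS mulrA.
case=> [k x|k x]; first exact: H.
rewrite NegzE; set y := Phi x _.
have -> : x = Phi y k.+1 by rewrite -PhiD subrr Phi0.
rewrite H mulrA -cexpD -mulrDr -rmorphD mulrNz.
by rewrite /= addNr rmorph0 mulr0 cexp0 mul1r.
Qed.

(** The hypothesis on [W] for all [t] makes the [j]-th form an eigenform of every time-[t]
    derivative with factor [cexp (mu j * t)]; this is why the defect below has zero differential,
    which the relation at time 1 alone would not give. *)
Lemma koopman_continuous (R : realType) (n : nat) (Q : smooth_manifold R n)
    (Phi : Q -> R -> Q) (x0 : Q) (W : 'M[R[i]]_n) (mu : 'I_n -> R[i]) :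
  @dynamical_system R continuous_time Q Phi -> smooth_map_time Phi ->
  @attracting_hyperbolic_basin R n Q continuous_time Phi x0 ->
  W \in unitmx ->
  (forall t, complexify (mfd_deriv (fun x => Phi x t) x0) *m W =
     W *m diag_mx (\row_j cexp (mu j * real_complex R t))) ->
  infty_nonresonant (mfd_deriv (fun x => Phi x 1) x0) ->
  forall psi : 'I_n -> Q -> R[i],
    (forall j x, psi j (Phi x 1) = cexp (mu j) * psi j x) ->
    (forall j, flat 2 (fun y => psi j (unloc x0 y) - diag_form W j y)) ->
    forall j t x, psi j (Phi x t) = cexp (mu j * real_complex R t) * psi j x.
Proof.
move=> Psys sPhi Pb Wu YW nres psi psiG psif j t x.
have fx : Phi x0 t = x0 by have [fx _ _ _] := Pb; exact: fx.
have sPt s : smooth_map (fun x => Phi x s) by exact: smooth_map_slice.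
have YW1 : complexify (mfd_deriv (fun x => Phi x 1) x0) *m W =
    W *m diag_mx (\row_j cexp (mu j)).
  rewrite YW; congr (_ *m diag_mx _); apply/rowP => i.
  by rewrite !mxE rmorph1 mulr1.
set c := cexp _; apply/eqP; rewrite -subr_eq0; apply/eqP.
apply: (@time_one_unique R n Q continuous_time Phi x0 Psys sPt Pb W mu Wu YW1 nres
  psi j (fun x => psi j (Phi x t) - c * psi j x) psiG psif).
  move=> z; have -> : Phi (Phi z 1) t = Phi (Phi z t) 1.
    by rewrite -(Psys.2 t 1) -(Psys.2 1 t) addrC.
  by rewrite !psiG; ring.
pose q y := psi j (unloc x0 y) - diag_form W j y.
have sF := smooth_near_loc_map (sPt t) fx.
have F0 := @loc_map0 _ _ _ x0 (fun x => Phi x t) fx.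
have fq : flat 2 (fun y => q (loc_map x0 (fun x => Phi x t) y)).
  exact: flat_comp (psif j).
have fd := flat_diag_form_map (YW t) j sF F0 (derive_loc_map (sPt t) fx).
(* Writing [psi j] as its linear form plus [q], the defect splits into [q] after the flow, the
   defect of the linear form, and [- c * q], each of order 2. *)
apply: flat_ext (flatB (flatD fq fd) (flatZ c (psif j))).
apply: filterS (near_unloc_map (sPt t) fx) => y [_ _ e].
by rewrite /q e /c; ring.
Qed.

(** The time [-1] map inverts the time-one derivative, so the eigenvalues are nonzero and have
    logarithms; at integer times any choice of logarithm will do. *)
Lemma discrete_spectrum (R : realType) (n : nat) (Q : smooth_manifold R n)
    (Phi : Q -> int -> Q) (x0 : Q) :
  @dynamical_system R discrete_time Q Phi -> (forall t, smooth_map (fun x => Phi x t)) ->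
  (forall t, Phi x0 t = x0) ->
  diagonalizable (complexify (mfd_deriv (fun x => Phi x 1) x0)) ->
  exists (W : 'M[R[i]]_n) (mu : 'I_n -> R[i]), W \in unitmx /\
    complexify (mfd_deriv (fun x => Phi x 1) x0) *m W =
    W *m diag_mx (\row_j cexp (mu j)).
Proof.
move=> [Phi0 PhiD] sPhi fx /diagonalizable_eigenbasis[W [lam [Wu YW]]].
have Yu : mfd_deriv (fun x => Phi x 1) x0 \in unitmx.
  have id1 : (fun x => Phi x (-1)) \o (fun x => Phi x 1) = id.
    by apply/funext => x; rewrite /= -PhiD addNr Phi0.
  have sid : smooth_map ((fun x => Phi x (-1)) \o (fun x => Phi x 1)).
    have -> : (fun x => Phi x (-1)) \o (fun x => Phi x 1) = fun x => Phi x 0.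
      by apply/funext => x; rewrite /= -PhiD addNr.
    exact: sPhi.
  have := mfd_deriv_comp (sPhi (-1)) (sPhi 1) sid (fx _) (fx _).
  rewrite mfd_deriv_idfun //; last by move=> x; rewrite id1.
  by move=> E; exact: (mulmx1_unit (esym E)).1.
have Ycu : complexify (mfd_deriv (fun x => Phi x 1) x0) \in unitmx.
  by rewrite /complexify map_unitmx.
have [mu hmu] := choice (fun j => cexp_surj (eigenbasis_neq0 Wu YW j Ycu)).
exists W, mu; split => //; rewrite YW; congr (_ *m diag_mx _).
by apply/rowP => j; rewrite !mxE hmu.
Qed.

Lemma continuous_spectrum (R : realType) (n : nat) (Q : smooth_manifold R n)
    (Phi : Q -> R -> Q) (x0 : Q) : (1 <= n)%N ->
  @dynamical_system R continuous_time Q Phi -> smooth_map_time Phi ->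
  (forall t, Phi x0 t = x0) ->
  diagonalizable (complexify (mfd_deriv (fun x => Phi x 1) x0)) ->
  exists (W : 'M[R[i]]_n) (mu : 'I_n -> R[i]), W \in unitmx /\
    forall t, complexify (mfd_deriv (fun x => Phi x t) x0) *m W =
      W *m diag_mx (\row_j cexp (mu j * real_complex R t)).
Proof.
move=> n1 [Phi0 PhiD] sPhi fx diagY.
have sPt s : smooth_map (fun x => Phi x s) by exact: smooth_map_slice.
apply: (@flow_spectrum R n (fun t => mfd_deriv (fun x => Phi x t) x0)) => //.
- exact: mfd_deriv_idfun.
- move=> t s; have E : (fun x => Phi x (t + s)) =
      (fun x => Phi x t) \o (fun x => Phi x s) by apply/funext => x; exact: PhiD.
  by rewrite E mfd_deriv_comp // -E.
- by move=> i j; exact: derivable_flow_deriv.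
Qed.

Theorem theorem3 (R : realType) (n : nat) (n_ge1 : (1 <= n)%N)
    (Q : smooth_manifold R n) (T : time_kind) (Phi : Q -> time R T -> Q)
    (x0 : Q)
    (Phi_system : dynamical_system Phi)
    (Phi_smooth : smooth_system Phi)
    (Phi_basin : attracting_hyperbolic_basin Phi x0)
    (Y_semisimple : diagonalizable (complexify (time_one_deriv Phi x0)))
    (Y_nonresonant : infty_nonresonant (time_one_deriv Phi x0)) :
  exists psi : 'I_n -> Q -> R[i],
    (forall j, principal_eigenfunction Phi x0 (psi j) /\ smooth_fun (psi j)) /\
    forall phi : Q -> R[i],
      koopman_eigenfunction Phi phi -> smooth_fun phi ->
      exists (k : nat) (c : multi_index n k -> multi_index n k -> R[i]),
        forall x : Q,
          phi x = \sum_(l : multi_index n k)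
                   \sum_(m : multi_index n k | (mi_length l + mi_length m <= k)%N)
                     c l m * mi_power psi l x *
                     mi_power (fun j y => conjc (psi j y)) m x.
Proof.

have [fx _ _ _] := Phi_basin.
suff [psi [Ppsi cpsi]] : exists psi : 'I_n -> Q -> R[i],
    (forall j, principal_eigenfunction Phi x0 (psi j) /\ smooth_fun (psi j)) /\
    forall phi : Q -> R[i], koopman_eigenfunction Phi phi -> smooth_fun phi ->
      exists s, forall x, phi x = word_sum psi s x.
  exists psi; split=> // phi kphi sphi; have [s hs] := cpsi phi kphi sphi.
  have [k [c hc]] := word_sum_multi_index Q s.
  by exists k, c => x; rewrite hs.
case: T Phi Phi_system Phi_smooth Phi_basin Y_semisimple Y_nonresonant fx
  => Phi Psys Psmooth Pb dY nY fx.
  have [W [mu [Wu YW]]] := discrete_spectrum Psys Psmooth fx dY.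
  apply: (principal_eigenfunction_basis Psys Psmooth Pb Wu YW nY) => psi psiG _ j.
  exact: koopman_discrete (psiG j).
have [W [mu [Wu YW]]] := continuous_spectrum n_ge1 Psys Psmooth fx dY.
have YW1 : complexify (mfd_deriv (fun x => Phi x 1) x0) *m W =
    W *m diag_mx (\row_j cexp (mu j)).
  rewrite YW; congr (_ *m diag_mx _); apply/rowP => i.
  by rewrite !mxE rmorph1 mulr1.
apply: (principal_eigenfunction_basis Psys _ Pb Wu YW1 nY).
  exact: smooth_map_slice.
exact: koopman_continuous.
Qed.
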